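(* Let $k\ge 1$. There exists a polynomial-time adaptive search algorithm which, given a tree $T=(V,E,w)$ with a $k$-monotonic cost function $w$ (together with a partition $T_1,\dots,T_l$ and a vertex $r$ witnessing $k$-monotonicity), finds the target with a worst-case total query cost of at most $8k\cdot\mathrm{OPT}(T)$.
   Context: $T=(V,E,w)$ is a finite tree with query cost function $w\colon V\to\mathbb{R}_+$. Search model: an unknown target $t\in V$ is to be found; querying a vertex $q$ costs $w(q)$ and reveals either that $q=t$ or which neighbor of $q$ is closer to $t$ (equivalently, which connected component of $T-q$ contains $t$). An adaptive search strategy is encoded by a decision tree, defined recursively: if $|V|=1$ it consists of that single vertex; otherwise one chooses a vertex $q$ (the first query), and the decision tree is the rooted tree with root $q$ whose children are the roots of decision trees for the connected components of $T-q$. For a decision tree $D$, $\mathrm{COST}(D)$ is the maximum over root-to-leaf paths $P$ of $D$ of $\sum_{v\in P}w(v)$, and $\mathrm{OPT}(T)$ is the minimum of $\mathrm{COST}(D)$ over all decision trees for $T$. A cost function on a tree is up-monotonic (resp. down-monotonic) if there is a vertex $r$ such that whenever $v$ lies on the path between $r$ and $u$ we have $w(u)\le w(v)$ (resp. $w(v)\le w(u)$). The cost function $w$ is $k$-monotonic if $T$ can be partitioned into vertex-disjoint subtrees $T_1,\dots,T_l$ such that the restriction of $w$ to each $T_i$ is up-monotonic or down-monotonic, and for some $r\in V$ every path from $r$ to a leaf of $T$ intersects at most $k$ of the trees $T_i$. *)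

(* Defs.v *)
From HB Require Import structures.
From mathcomp Require Import all_boot all_order all_algebra.
From mathcomp Require Import reals.
From Stdlib Require List.

Set Implicit Arguments.
Unset Strict Implicit.
Unset Printing Implicit Defensive.

Import Order.TTheory GRing.Theory Num.Theory.
Local Open Scope ring_scope.

Section Graphs.
Variable n : nat.
Implicit Types (e : rel 'I_n) (A : {set 'I_n}).

Definition restr e A : rel 'I_n := fun x y => [&& e x y, x \in A & y \in A].

Definition drop_edge e (x y : 'I_n) : rel 'I_n :=
  fun a b => e a b && ~~ (((a == x) && (b == y)) || ((a == y) && (b == x))).

(* a tree: a simple (symmetric, irreflexive) graph that is connected and
   acyclic; acyclicity of a connected graph is expressed as "every edge is a
   bridge" (removing it disconnects its endpoints). *)
Definition is_tree e : Prop :=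
  [/\ irreflexive e, symmetric e,
      (forall x y, connect e x y) &
      (forall x y, e x y -> ~~ connect (drop_edge e x y) x y)].

Definition onpath e (x y v : 'I_n) : bool :=
  [|| v == x, v == y | ~~ connect (restr e (~: [set v])) x y].

Definition comps e A : {set {set 'I_n}} :=
  [set [set y in A | connect (restr e A) x y] | x in A].

Definition is_subtree e A : Prop :=
  forall x y, x \in A -> y \in A -> connect (restr e A) x y.

Definition leaf e (l : 'I_n) : bool := (#|[set u | e l u]| <= 1)%N.

End Graphs.

Section Mono.
Variables (R : realType) (n : nat) (e : rel 'I_n) (w : 'I_n -> R).

Definition up_mono (A : {set 'I_n}) : Prop :=
  exists2 rho, rho \in A &
    forall u v, u \in A -> v \in A -> onpath e rho u v -> w u <= w v.

Definition down_mono (A : {set 'I_n}) : Prop :=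
  exists2 rho, rho \in A &
    forall u v, u \in A -> v \in A -> onpath e rho u v -> w v <= w u.

Definition cls (part : 'I_n -> 'I_n) (i : 'I_n) : {set 'I_n} :=
  [set v | part v == i].

(* (part, r) witnesses that w is k-monotonic: the nonempty classes of the
   labelling part : V -> 'I_n form a partition of V into vertex-disjoint
   subtrees T_1..T_l, w restricted to each is up- or down-monotonic, and
   every path from r to a leaf of T meets at most k of the T_i. *)
Definition k_monotonic_wit (part : 'I_n -> 'I_n) (r : 'I_n) (k : nat) : Prop :=
  (forall i, cls part i != set0 ->
     is_subtree e (cls part i) /\ (up_mono (cls part i) \/ down_mono (cls part i)))
  /\ (forall l, leaf e l ->
        (#|[set part v | v in [set v | onpath e r l v]]| <= k)%N).

End Mono.

Inductive dtree (n : nat) : Type := DNode of 'I_n & seq (dtree n).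

Fixpoint dverts n (D : dtree n) : {set 'I_n} :=
  let: DNode q ch := D in
  q |: (fix go (l : seq (dtree n)) : {set 'I_n} :=
          if l is c :: l' then dverts c :|: go l' else set0) ch.

Fixpoint dcost (R : realType) n (w : 'I_n -> R) (D : dtree n) : R :=
  let: DNode q ch := D in
  w q + (fix go (l : seq (dtree n)) : R :=
          if l is c :: l' then Num.max (dcost w c) (go l') else 0) ch.

Inductive valid_dtree n (e : rel 'I_n) : {set 'I_n} -> dtree n -> Prop :=
| VNode (S : {set 'I_n}) (q : 'I_n) (ch : seq (dtree n)) :
    q \in S ->
    perm_eq (map (@dverts n) ch) (enum (comps e (S :\ q))) ->
    (forall c, List.In c ch -> valid_dtree e (dverts c) c) ->
    valid_dtree e S (DNode q ch).

Definition answer n (e : rel 'I_n) (t q : 'I_n) : 'I_n :=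
  if q == t then q
  else odflt q [pick u | e q u && connect (restr e (~: [set q])) u t].

(* Machine model: a unit-cost real RAM with a query instruction.             *)
(* Nat memory M : nat -> nat, real memory X : nat -> R.  Nat operations are  *)
(* +, truncated -, comparison, indirect addressing; real operations are      *)
(* +, -, *, comparison, indirect addressing (no real->nat conversion).       *)
(* Query a b : queries vertex M[a] of the hidden target; the answer is       *)
(* written to M[b] and the weight of the queried vertex is added to the      *)
(* accumulated query cost.  Each instruction costs one time step.            *)

Inductive instr : Type :=
| NConst of nat & nat
| NAdd of nat & nat & nat
| NSub of nat & nat & nat
| NLoad of nat & nat
| NStore of nat & nat
| RAdd of nat & nat & nat
| RSub of nat & nat & nat
| RMul of nat & nat & nat
| RLoad of nat & nat
| RStore of nat & nat
| JLe of nat & nat & nat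
| RJLe of nat & nat & nat
| Query of nat & nat.

Record config (R : realType) : Type := Config {
  pc : nat;
  NMem : nat -> nat;
  XMem : nat -> R;
  qcost : R }.

Definition upd (T : Type) (f : nat -> T) (a : nat) (v : T) : nat -> T :=
  fun x => if x == a then v else f x.

Section Machine.
Variables (R : realType) (orc : nat -> nat * R) (p : seq instr).

Definition step (c : config R) : option (config R) :=
  let: Config i M X qc := c in
  if (i < size p)%N then
  Some (match nth (NConst 0 0) p i with
  | NConst a k => Config i.+1 (upd M a k) X qc
  | NAdd a b d => Config i.+1 (upd M a (M b + M d)%N) X qc
  | NSub a b d => Config i.+1 (upd M a (M b - M d)%N) X qc
  | NLoad a b => Config i.+1 (upd M a (M (M b))) X qc
  | NStore a b => Config i.+1 (upd M (M a) (M b)) X qc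
  | RAdd a b d => Config i.+1 M (upd X a (X b + X d)) qc
  | RSub a b d => Config i.+1 M (upd X a (X b - X d)) qc
  | RMul a b d => Config i.+1 M (upd X a (X b * X d)) qc
  | RLoad a b => Config i.+1 M (upd X a (X (M b))) qc
  | RStore a b => Config i.+1 M (upd X (M a) (X b)) qc
  | JLe a b t => Config (if (M a <= M b)%N then t else i.+1) M X qc
  | RJLe a b t => Config (if X a <= X b then t else i.+1) M X qc
  | Query a b => Config i.+1 (upd M b (orc (M a)).1) X (qc + (orc (M a)).2)
  end)
  else None.

Fixpoint run (fuel : nat) (c : config R) : option (config R) :=
  match step c with
  | None => Some c
  | Some c' => if fuel is f.+1 then run f c' else None
  end.

End Machine.

Definition oracle (R : realType) n (e : rel 'I_n) (w : 'I_n -> R) (t : 'I_n)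
  (q : nat) : nat * R :=
  if (insub q : option 'I_n) is Some v then (val (answer e t v), w v)
  else (n, 0).

(* Input encoding.  Nat memory: M[0] = n, M[1] = r, adjacency matrix at
   M[2 + n*i + j] (1 if ij is an edge, else 0), partition labels at
   M[2 + n*n + i]; all other cells 0.  Real memory: X[i] = w i for i < n,
   0 elsewhere.  Program counter 0, query cost 0. *)
Definition init (R : realType) n (e : rel 'I_n) (w : 'I_n -> R)
  (part : 'I_n -> 'I_n) (r : 'I_n) : config R :=
  let adj (a b : nat) : nat :=
    if (insub a : option 'I_n) is Some x then
      if (insub b : option 'I_n) is Some y then nat_of_bool (e x y) else 0%N
    else 0%N in
  let lab (a : nat) : nat :=
    if (insub a : option 'I_n) is Some x then val (part x) else 0%N in
  let M := fun i : nat =>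
    if i == 0%N then n else if i == 1%N then val r
    else if (i < 2 + n * n)%N then adj ((i - 2) %/ n)%N ((i - 2) %% n)%N
    else if (i < 2 + n * n + n)%N then lab (i - 2 - n * n)%N
    else 0%N in
  let X := fun i : nat =>
    if (insub i : option 'I_n) is Some x then w x else 0 in
  Config 0 M X 0.

(* Submission.v *)
(* Idea. Round the weights, relative to the largest one, up to integers in 1..15n; this costs a factor
   at most 16/15. Let C be the rounded cost of a decision tree. The path from the root to the target
   meets at most k classes, and the strategy always queries inside the class of the candidate closest
   to the root, so it suffices to spend at most 15C/2 inside each class.

   Inside a class, let bet v be the least power of two that is at least the weight of v. A labelling E
   with E v a multiple of bet v reserves for v the time interval [E v - bet v, E v); v is queried when
   it has the largest label, in the spirit of edge ranking. The labels are computed greedily from the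
   leaves up, each one as small as possible, and an exchange argument (lexicographic dominance) bounds
   them by every valid labelling. The costs-to-go in the decision tree give a valid labelling of a
   down-monotonic class. In an up-monotonic class E v <= 2C + 5 bet v, by induction over the sets of
   vertices with equal bet: such a set is labelled block by block, from the costs-to-go where the
   decision tree has a vertex of the set, and by a centroid otherwise. Following the labels costs at
   most 6C plus a multiple of the largest bet of the current set.

   That last term is negligible once the vertices with bet v > C/48 are gone, and at most 96 queries
   achieve this. Hence the strategy minimises over 96 queries of exact game tree search followed by
   the labelled search from the best root. It is a function of the candidate set alone, which makes
   it polynomial for this constant depth.

   To run it on the machine, sets and vectors are coded as single natural numbers in base N, where N
   is of order n^2. Expressions with loops of length N are then enough, and they compile to code of
   polynomial running time. *)

(* The labels have to be found without knowing a good decision tree. Feasibility of a label looks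
   only strictly below its vertex, so least feasible labels can be computed bottom-up and then
   compared with the labels read off any decision tree. Powers of two make the comparison work: in
   the sets compared, all interval ends below [p] are multiples of [bet p], so what [p] sees is
   constant on blocks of length [bet p].

   The obstacle in an up-monotonic class is the light vertices below heavy ones: no room is reserved
   for them at the heavy scale. Only their total weight in view is limited, to [2 * bet p]; a block
   then costs one heavy query plus this weight, three units in all, which turns labels near [2 * C]
   into [6 * C].

   Costs-to-go are doubled in [c], so that an interval of length [2 * w v] exceeds [bet v]. An exact
   query of a heavy vertex lowers the largest doubled cost-to-go of heavy vertices, at most [2 * C],
   by more than [C / 48]: hence 96 rounds. They cost at most [C], the light rest adds
   [24 * C / 48 = C / 2] to [6 * C], and [15 / 2 * 16 / 15 = 8]. *)
Require Import Defs.
From HB Require Import structures.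
From mathcomp Require Import all_boot all_order all_algebra.
From mathcomp Require Import reals.
From mathcomp Require Import zify ring lra.
From Stdlib Require List.
Import Order.TTheory GRing.Theory Num.Theory.

Set Implicit Arguments.
Unset Strict Implicit.
Unset Printing Implicit Defensive.

(** * Trees described by their answers *)

Section TreeAnswers.
Variables (n : nat) (e : rel 'I_n).
Hypothesis treeE : is_tree e.

Definition ans (q t : 'I_n) : 'I_n := answer e t q.

Let avoid (q : 'I_n) := restr e (~: [set q]).

Let e_irr : irreflexive e. Proof. by have [] := treeE. Qed.
Let e_sym : symmetric e. Proof. by have [] := treeE. Qed.
Let e_con x y : connect e x y. Proof. by have [] := treeE. Qed.
Let e_br x y : e x y -> ~~ connect (drop_edge e x y) x y. Proof. have [_ _ _ h] := treeE; exact: h. Qed.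

Let avoidE q x y : avoid q x y = [&& e x y, x != q & y != q].
Proof. by rewrite /avoid /restr !inE. Qed.

Lemma restr_connect_sym A : connect_sym (restr e A).
Proof. by apply: sym_connect_sym => x y; rewrite /restr e_sym [(x \in A) && _]andbC. Qed.

Let avoid_sym q : connect_sym (avoid q) := restr_connect_sym _.

Lemma path_last_avoid q x p : x != q -> path e x p -> q \notin p -> connect (avoid q) x (last x p).
Proof.
move=> xq pth nq; apply/connectP; exists p => //.
elim: p x xq pth nq => //= y p IH x xq /andP[exy pth]; rewrite inE negb_or => /andP[nqy nq].
have yq : y != q by rewrite eq_sym.
by rewrite avoidE exy xq yq /= IH.
Qed.

Lemma neighbour_towards q t : q != t -> exists2 u, e q u & connect (avoid q) u t.
Proof.
move=> qt; have /connectP[p0 pth0 lst0] := e_con q t.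
case: (shortenP pth0) lst0 => p pth up _ lst.
case: p pth up lst => [|u p] /=; first by move=> _ _ ?; subst; rewrite eqxx in qt.
move=> /andP[equ pth] /andP[]; rewrite inE negb_or => /andP[qu qp] _ ->.
by exists u => //; apply: path_last_avoid => //; rewrite eq_sym.
Qed.

Lemma ansP q t : q != t -> e q (ans q t) /\ connect (avoid q) (ans q t) t.
Proof.
move=> qt; rewrite /ans /answer (negbTE qt).
case: pickP => [u /andP[-> ->] //|no].
by have [u equ ut] := neighbour_towards qt; move: (no u); rewrite equ ut.
Qed.

Lemma ans_self q : ans q q = q. Proof. by rewrite /ans /answer eqxx. Qed.

Lemma avoid_drop q u x y : connect (avoid q) x y -> connect (drop_edge e q u) x y.
Proof.
apply: connect_sub => a b; rewrite avoidE => /and3P[eab aq bq].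
by apply: connect1; rewrite /drop_edge eab (negbTE aq) (negbTE bq) andbF.
Qed.

Lemma avoid_drop' q u x y : connect (avoid u) x y -> connect (drop_edge e q u) x y.
Proof.
apply: connect_sub => a b; rewrite avoidE => /and3P[eab aq bq].
by apply: connect1; rewrite /drop_edge eab (negbTE aq) (negbTE bq) andbF.
Qed.

Lemma edge_neq x y : e x y -> x != y.
Proof. by apply: contraTneq => ->; rewrite e_irr. Qed.

(** Two distinct neighbours of [q] joined off [q] would bypass the edge from [q] to [u], which is a
    bridge. *)
Lemma neighbour_uniq q u v : e q u -> e q v -> connect (avoid q) u v -> u = v.
Proof.
move=> equ eqv uv; apply/eqP; apply: contraT => nuv.
have := e_br equ; rewrite -[_ q u]negbK => /negP []; apply/negPn.
apply: (@connect_trans _ _ v).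
  apply: connect1; rewrite /drop_edge eqv eqxx /= eq_sym (negbTE nuv) /=.
  by rewrite (negbTE (edge_neq equ)).
apply: avoid_drop; by rewrite avoid_sym.
Qed.

Lemma ans_eqP q x y : q != x -> q != y -> (ans q x == ans q y) = connect (avoid q) x y.
Proof.
move=> qx qy; have [ex cx] := ansP qx; have [ey cy] := ansP qy.
apply/eqP/idP => [h|h].
  by apply: connect_trans cy; rewrite -h avoid_sym.
apply: (neighbour_uniq ex ey); apply: (connect_trans cx); apply: (connect_trans h).
by rewrite avoid_sym.
Qed.

Lemma ans_edge q u : e q u -> ans q u = u.
Proof.
move=> equ; have qu := edge_neq equ; have [e1 c1] := ansP qu.
exact: (neighbour_uniq e1 equ c1).
Qed.

Lemma ans_neq q t : q != t -> ans q t != q.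
Proof. by move=> qt; have [h _] := ansP qt; rewrite eq_sym; exact: edge_neq. Qed.

(** If the simple path from [x] to [r] went through [z], its initial segment from [x] to [z] would
    miss [r], and [r] could not separate [x] from [z]. Antisymmetry of the rooted order rests on
    this fact. *)
Lemma ans_cross r x z : ans r x != ans r z -> r != z -> ans z x = ans z r.
Proof.
move=> h rz.
have [xz|xz] := eqVneq x z; first by rewrite xz eqxx in h.
have [->//|xr] := eqVneq x r.
apply/eqP; rewrite ans_eqP // 1?eq_sym //.
have /connectP[p0 pth0 lst0] := e_con x r.
case: (shortenP pth0) lst0 => p pth up _ lst.
case: (boolP (z \in p)) => zp; last by rewrite lst; apply: path_last_avoid.
have : r != last x (take (index z p).+1 p).
  have sz : (index z p < size p)%N by rewrite index_mem.
  by rewrite (last_nth z) size_takel //= nth_take // nth_index.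
move=> lr; move: h; rewrite ans_eqP // 1?eq_sym //.
have -> : z = last x (take (index z p).+1 p).
  have sz : (index z p < size p)%N by rewrite index_mem.
  by rewrite (last_nth z) size_takel //= nth_take // nth_index.
have sz : (index z p < size p)%N by rewrite index_mem.
case/negP; apply: path_last_avoid => //.
  by rewrite -[p](cat_take_drop (index z p).+1) cat_path in pth; case/andP: pth.
move: lst up; rewrite -{1 2}[p](cat_take_drop (index z p).+1) last_cat /= cat_uniq.
set p1 := take _ _; set p2 := drop _ _ => lst /and4P[_ _ dis _].
case E: p2 lst dis => [|b p2'] /= lst dis.
  by move: lr; rewrite -/p1 lst eqxx.
have : r \in b :: p2' by rewrite lst mem_last.
move=> rin; apply: contra dis => rp1.
move: rin; rewrite inE => /orP[/eqP<-|rin]; first by rewrite rp1.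
by apply/orP; right; apply/hasP; exists r.
Qed.

Lemma ans_idem q t : ans q (ans q t) = ans q t.
Proof.
have [->|qt] := eqVneq q t; first by rewrite !ans_self.
by apply: ans_edge; case: (ansP qt).
Qed.

Lemma ans_nb q t z : q != t -> z != q -> z != ans q t -> ans z q = ans z (ans q t).
Proof.
move=> qt zq zu; apply/eqP; rewrite ans_eqP //; apply: connect1; rewrite avoidE.
by rewrite (proj1 (ansP qt)) eq_sym zq eq_sym zu.
Qed.

Lemma ans_back q t : q != t -> ans (ans q t) q = q.
Proof. by move=> qt; apply: ans_edge; rewrite e_sym; case: (ansP qt). Qed.

(** If the answer at the neighbour [u] pointed back to [q], the target would be joined to both ends
    of the bridge without using it. *)
Lemma ans_fwd q t : q != t -> ans (ans q t) t != q.
Proof.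
move=> qt; have [equ cut] := ansP qt; set u := ans q t in equ cut *.
have uq : u != q by rewrite eq_sym; apply: edge_neq.
have [<-|ut] := eqVneq u t; first by rewrite ans_self.
apply/negP => /eqP h; have [eu cu] := ansP ut; rewrite h in cu.
have := e_br equ; rewrite -[connect _ q u]negbK => /negP []; apply/negPn.
apply: (@connect_trans _ _ t); first exact: avoid_drop'.
by apply: avoid_drop; rewrite avoid_sym.
Qed.

Lemma ans_edgeE x y : e x y = (x != y) && (ans x y == y).
Proof.
apply/idP/andP => [h|[xy /eqP <-]]; last by case: (ansP xy).
by rewrite (edge_neq h) (ans_edge h).
Qed.

Lemma onpathE x y v : onpath e x y v = (ans v x != ans v y) || ((v == x) && (v == y)).
Proof.
rewrite /onpath; have [->|vx] := eqVneq v x.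
  have [->|xy] := eqVneq x y; first by rewrite /= orbT.
  by rewrite ans_self [x == _]eq_sym (ans_neq xy).
have [vy|vy] := eqVneq v y; first by rewrite vy in vx *; rewrite ans_self ans_neq.
by rewrite /= ans_eqP // orbF.
Qed.

End TreeAnswers.

(* [a q t] is the answer to the query [q] for the target [t]. *)
Record tree_answers (V : finType) (a : V -> V -> V) : Prop := TreeAnswers {
  ta_self : forall q, a q q = q;
  ta_neq : forall q t, q != t -> a q t != q;
  ta_cross : forall r x z, a r x != a r z -> r != z -> a z x = a z r;
  ta_idem : forall q t, a q (a q t) = a q t;
  ta_nb : forall q t z, q != t -> z != q -> z != a q t -> a z q = a z (a q t);
  ta_back : forall q t, q != t -> a (a q t) q = q;
  ta_fwd : forall q t, q != t -> a (a q t) t != q }.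

(** * Paths, convex sets and rooted subtrees, from the answers alone *)

Section Paths.
Variables (V : finType) (a : V -> V -> V).
Hypothesis aT : tree_answers a.

(* [z] lies on the path from [x] to [y]. *)
Definition pth (x y z : V) := (a z x != a z y) || ((z == x) && (z == y)).

Definition convex (X : {set V}) := forall x y z, x \in X -> y \in X -> pth x y z -> z \in X.

Lemma pth_l x y : pth x y x.
Proof.
rewrite /pth eqxx /=; have [->|xy] := eqVneq x y; first by rewrite orbT.
by rewrite (ta_self aT) orbF eq_sym (ta_neq aT).
Qed.

Lemma pthC x y z : pth x y z = pth y x z.
Proof. by rewrite /pth eq_sym [(z == x) && _]andbC. Qed.

Lemma pth_r x y : pth x y y. Proof. by rewrite pthC pth_l. Qed.

Lemma pthxx x z : pth x x z = (z == x).
Proof. by rewrite /pth eqxx andbb. Qed.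

Lemma pth_tri w x y z : pth x y z -> pth x w z || pth w y z.
Proof.
case/orP => [h|/andP[/eqP-> _]]; last by rewrite pth_l.
rewrite /pth; case: (a z x =P a z w) => [e1|//]; case: (a z w =P a z y) => [e2|]; last by rewrite /= orbT.
by rewrite e1 e2 eqxx in h.
Qed.

Lemma pth_anti x z r : pth x z r -> pth x r z -> r = z.
Proof.
case/orP => [h1|/andP[_ /eqP//]]; case/orP => [h2|/andP[_ /eqP//]].
apply/eqP; apply: contraT => rz; by rewrite (ta_cross aT h1 rz) eqxx in h2.
Qed.

Lemma pth_sub x y z r : pth x y z -> pth x z r -> pth x y r.
Proof.
move=> h1 h2; have [->//|rz] := eqVneq r z.
have [->|rx] := eqVneq r x; first exact: pth_l.
rewrite /pth; case: (a r x =P a r y) => //= exy.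
have h3 : a r x != a r z by move: h2; rewrite /pth (negbTE rx) orbF.
have h4 : a r y != a r z by rewrite -exy.
have := h1; rewrite /pth (ta_cross aT h3 rz) (ta_cross aT h4 rz) eqxx /= => /andP[/eqP zx _].
by rewrite zx eqxx in h3.
Qed.

Lemma pth_ans q t : pth q t (a q t).
Proof.
have [->|qt] := eqVneq q t; first by rewrite (ta_self aT) pth_l.
by rewrite /pth (ta_back aT qt) eq_sym (ta_fwd aT qt).
Qed.

Lemma side_pth q x y : q != x -> (a q x == a q y) = ~~ pth x y q.
Proof. by move=> qx; rewrite /pth (negbTE qx) orbF negbK. Qed.

Lemma convex_side X q u : convex X -> q != u -> convex [set x in X | a q x == u].
Proof.
move=> cX qu x y z; rewrite !inE => /andP[xX /eqP xu] /andP[yX /eqP yu] h.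
rewrite (cX _ _ _ xX yX h) /=.
have qx : q != x by apply: contraNneq qu => qx; rewrite -xu -qx (ta_self aT).
have nq : ~~ pth x y q by rewrite -side_pth // xu yu.
have [zq|zq] := eqVneq q z; first by rewrite zq h in nq.
rewrite -xu eq_sym side_pth //; apply: contra nq => h2; exact: pth_sub h h2.
Qed.

Lemma convexT : convex [set: V].
Proof. by move=> x y z; rewrite !inE. Qed.

Section Rooted.
Variables (X : {set V}) (rho : V).
Hypotheses (cX : convex X) (rX : rho \in X).

Definition par (v : V) := a v rho.
Definition sub (v : V) : {set V} := [set x in X | pth rho x v].
Definition ch (v : V) : {set V} := [set c in X | (c != rho) && (par c == v)].

Lemma subX v x : x \in sub v -> x \in X. Proof. by rewrite inE => /andP[]. Qed.
Lemma subX' v x : x \in sub v -> v \in X.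
Proof. by rewrite inE => /andP[xX]; apply: cX. Qed.
Lemma sub_refl v : v \in X -> v \in sub v. Proof. by rewrite inE pth_r => ->. Qed.
Lemma sub_trans y x z : y \in sub x -> z \in sub y -> z \in sub x.
Proof. by rewrite !inE => /andP[yX h] /andP[-> h2]; apply: pth_sub h2 h. Qed.
Lemma sub_anti x y : x \in sub y -> y \in sub x -> x = y.
Proof. by rewrite !inE => /andP[_ h1] /andP[_ h2]; apply: pth_anti h2 h1. Qed.
Lemma sub_rho x : (x \in sub rho) = (x \in X). Proof. by rewrite inE pth_l andbT. Qed.
Lemma sub_sub x y : y \in sub x -> sub y \subset sub x.
Proof. by move=> h; apply/subsetP => z; apply: sub_trans. Qed.

(** Turns path membership below [v] into two subtree memberships, the form used in inductions along
    the rooted tree. *)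
Lemma sub_pthE v x z : x \in sub v -> pth v x z = (z \in sub v) && (x \in sub z).
Proof.
move=> xv; have xX := subX xv; have vX := subX' xv.
apply/idP/andP => [h|[zv xz]].
  have h2 : pth rho x z.
    by move: xv; rewrite inE => /andP[_ hv]; move: hv h; rewrite pthC [pth v x z]pthC [pth rho x z]pthC; exact: pth_sub.
  have zX : z \in X by exact: cX h2.
  split; last by rewrite inE xX.
  rewrite inE zX /=; move: xv; rewrite inE => /andP[_ /(pth_tri z)] /orP[//|h3].
  rewrite pthC in h3; rewrite pthC in h; by rewrite (pth_anti h3 h) pth_r.
move: xz; rewrite inE => /andP[_ /(pth_tri v)] /orP[h|//].
by move: zv; rewrite inE => /andP[_ h2]; rewrite (pth_anti h h2) pth_l.
Qed.

Lemma sub_chain x y z : x \in sub y -> x \in sub z -> (z \in sub y) || (y \in sub z).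
Proof.
move=> xy xz; have yX := subX' xy; have zX := subX' xz.
move: (xy); rewrite inE => /andP[_ /(pth_tri z)] /orP[h|h].
  by rewrite inE zX h.
by move: h; rewrite (sub_pthE y xz) => /andP[-> _]; rewrite orbT.
Qed.

Lemma par_X v : v \in X -> par v \in X.
Proof. by move=> vX; apply: (cX vX rX); apply: pth_ans. Qed.

Lemma par_neq v : v != rho -> par v != v. Proof. exact: (ta_neq aT). Qed.

Lemma par_sub v : v \in X -> v \in sub (par v).
Proof. by move=> vX; rewrite inE vX pthC pth_ans. Qed.

Lemma sub_par v y : v != rho -> v \in sub y -> v != y -> par v \in sub y.
Proof.
move=> vr vy nvy; rewrite inE (par_X (subX vy)) /=.
have [->|yu] := eqVneq y (par v); first exact: pth_r.
move: vy; rewrite inE => /andP[_]; rewrite /pth [y == v]eq_sym (negbTE nvy) andbF orbF.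
by rewrite (ta_nb aT vr _ yu) 1?eq_sym // => ->.
Qed.

Lemma ch_X v c : c \in ch v -> c \in X. Proof. by rewrite inE => /andP[]. Qed.
Lemma ch_sub v c : c \in ch v -> c \in sub v.
Proof. by rewrite inE => /and3P[cX' _ /eqP<-]; apply: par_sub. Qed.
Lemma ch_neq v c : c \in ch v -> c != v.
Proof. by rewrite inE => /and3P[_ cr /eqP<-]; rewrite eq_sym par_neq. Qed.
Lemma ch_par v c : c \in ch v -> par c = v.
Proof. by rewrite inE => /and3P[_ _ /eqP]. Qed.
Lemma ch_rho v c : c \in ch v -> c != rho.
Proof. by rewrite inE => /and3P[]. Qed.
Lemma ch_notin v c : c \in ch v -> v \notin sub c.
Proof. by move=> h; apply: contra (ch_neq h) => h2; rewrite (sub_anti h2 (ch_sub h)). Qed.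

Lemma child_of v x : x \in sub v -> x != v -> (a v x \in ch v) && (x \in sub (a v x)).
Proof.
move=> xv nxv; have xX := subX xv; have vX := subX' xv.
have vx : v != x by rewrite eq_sym.
set c := a v x; have cXX : c \in X by apply: (cX vX xX); apply: pth_ans.
have cv : c != v by apply: (ta_neq aT).
have sp : (v == rho) || (a v rho != c).
  by move: xv; rewrite inE => /andP[_]; rewrite /pth (negbTE vx) andbF orbF orbC => ->.
have pc : par c = v.
  rewrite /par; case/orP: sp => [/eqP vr|sp]; first by rewrite -vr (ta_back aT).
  rewrite -[RHS](ta_back aT vx) -/c; apply/eqP; apply: contraT => h.
  by have := ta_cross aT h cv; rewrite (ta_idem aT) => h2; rewrite h2 eqxx in sp.
have cr : c != rho.
  apply: contraTneq sp => cr; rewrite negb_or negbK -{1}cr eq_sym cv /=.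
  by rewrite -cr (ta_idem aT).
rewrite inE cXX cr pc eqxx /= inE xX /= /pth.
have -> : a c rho = v by exact: pc.
by rewrite eq_sym (ta_fwd aT vx).
Qed.

Lemma ch_uniq v c d x : c \in ch v -> d \in ch v -> x \in sub c -> x \in sub d -> c = d.
Proof.
move=> hc hd xc xd; apply/eqP; apply: contraT => ncd.
case/orP: (sub_chain xc xd) => h.
  have := sub_par (ch_rho hd) h; rewrite eq_sym ncd => /(_ isT).
  by rewrite (ch_par hd) (negbTE (ch_notin hc)).
have := sub_par (ch_rho hc) h ncd.
by rewrite (ch_par hc) (negbTE (ch_notin hd)).
Qed.

Lemma ans_child v c x : c \in ch v -> x \in sub c -> a v x = c.
Proof.
move=> hc xc; have xv := sub_trans (ch_sub hc) xc.
have nx : x != v by apply: contraTneq xc => ->; apply: ch_notin.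
by have /andP[h1 h2] := child_of xv nx; apply: ch_uniq h1 hc h2 xc.
Qed.

Lemma sub_ch_card v c : c \in ch v -> #|sub c| < #|sub v|.
Proof.
move=> h; apply: proper_card; apply/properP; split; first exact: sub_sub (ch_sub h).
by exists v; [apply: sub_refl; rewrite -(ch_par h); apply: par_X; exact: ch_X h | exact: ch_notin].
Qed.

Lemma big_sub (v : V) (P : pred V) (F : V -> nat) : v \in X ->
  \sum_(x in sub v | P x) F x =
  (if P v then F v else 0) + \sum_(c in ch v) \sum_(x in sub c | P x) F x.
Proof.
move=> vX; rewrite (bigID (pred1 v)) /=; congr (_ + _).
  case: (boolP (P v)) => Pv.
    rewrite (eq_bigl (pred1 v)) ?big_pred1_eq // => x /=.
    by case: eqP => [->|_]; rewrite ?andbF // Pv !andbT; apply: sub_refl.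
  by rewrite big1 // => x /andP[/andP[_ Px] /eqP xv]; rewrite xv (negbTE Pv) in Px.
rewrite (partition_big (a v) (fun c => c \in ch v)) /=.
  apply: eq_bigr => c hc; apply: eq_bigl => x.
  case: (boolP (x \in sub c)) => xc /=.
    rewrite (sub_trans (ch_sub hc) xc) (ans_child hc xc) eqxx andbT.
    have -> : x != v by apply: contraTneq xc => ->; apply: ch_notin.
    by rewrite !andbT.
  apply/negbTE; apply: contra xc => /andP[/andP[/andP[xv _] nx] /eqP <-].
  by case/andP: (child_of xv nx).
by move=> x /andP[/andP[xv _] nx]; case/andP: (child_of xv nx).
Qed.

Lemma sub_ind (P : V -> Prop) :
  (forall v, v \in X -> (forall c, c \in ch v -> P c) -> P v) -> forall v, v \in X -> P v.
Proof.
move=> H v; have [m] := ubnP #|sub v|; elim: m v => // m IH v hm vX.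
apply: H => // c hc; apply: IH; last exact: ch_X hc.
exact: leq_trans (sub_ch_card hc) _.
Qed.

(** The smallest subtree containing both vertices works: if its top missed the path, both would lie
    below the same child. *)
Lemma lca_ex x y : x \in X -> y \in X ->
  exists m, [/\ x \in sub m, y \in sub m & pth x y m].
Proof.
move=> xX yX.
have ex : exists m, (x \in sub m) && (y \in sub m) by exists rho; rewrite !sub_rho xX.
have [m /andP[xm ym] hm] := arg_minnP (P := fun m => (x \in sub m) && (y \in sub m)) (fun m => #|sub m|) (xchooseP ex).
exists m; split=> //.
have [mx|mx] := eqVneq m x; first by rewrite mx pth_l.
have [my|my] := eqVneq m y; first by rewrite my pth_r.
apply: contraT => h; rewrite -side_pth // in h.
have /andP[h1 h2] : (a m x \in ch m) && (x \in sub (a m x)) by apply: child_of; rewrite // eq_sym.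
have /andP[_ h3] : (a m y \in ch m) && (y \in sub (a m y)) by apply: child_of; rewrite // eq_sym.
rewrite -(eqP h) in h3.
have := hm (a m x); rewrite h2 h3 => /(_ isT); by rewrite leqNgt sub_ch_card.
Qed.

(** Take the vertex of [Y] with the largest subtree. The join of it with any other vertex of [Y] is
    in [Y] by convexity, so it cannot have a larger subtree. *)
Lemma top_ex (Y : {set V}) : Y \subset X -> convex Y -> Y != set0 ->
  exists2 q, q \in Y & forall v, v \in Y -> v \in sub q.
Proof.
move=> YX cY /set0Pn[y0 y0Y].
have [q qY hq] := arg_maxnP (P := fun q => q \in Y) (fun q => #|sub q|) y0Y.
exists q => // v vY; have [m [qm vm pm]] := lca_ex (subsetP YX _ qY) (subsetP YX _ vY).
have mY := cY _ _ _ qY vY pm.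
suff : q = m by move->.
have qX := subsetP YX _ qY; have mX := subsetP YX _ mY.
apply: sub_anti => //; have /eqP -> : sub q == sub m; last exact: sub_refl.
by rewrite eqEcard sub_sub //; apply: hq.
Qed.

End Rooted.
End Paths.
Arguments sub_refl [V a] _ [X rho v].
Arguments par_sub [V a] _ [X rho v].

(** * Greedy labels *)

(* Plain [lia] is slow with so many hypotheses in the context. *)
Ltac slia :=
  repeat match goal with
  | H : ?T |- _ => lazymatch T with
    | is_true (leq _ _) => fail
    | is_true (andb (leq _ _) (leq _ _)) => fail
    | leq _ _ = _ => fail
    | @eq ?A _ _ => tryif unify A nat then fail else clear H
    | is_true (~~ leq _ _) => fail
    | nat => fail
    | _ => clear H
    end
  end; lia.

Section Labels.
Variables (V : finType) (a : V -> V -> V) (X : {set V}) (rho : V).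
Variables (bet w : V -> nat) (N : nat).
Notation sub := (sub a X rho).
Notation ch := (ch a X rho).
Notation par := (par a rho).

(* The label [f x] reserves the interval [iv f x]. From [p], at time [t], one sees the vertices [x] below
   [p] with no label above [t] strictly in between. Among them [cnt] counts the intervals that contain
   [t] and belong to vertices at least as heavy as [p], up to rounding; [raw] is the weight of the
   lighter ones still to be queried. *)
Definition btw (p x z : V) := [&& z \in sub p, x \in sub z, z != p & z != x].
Definition seen (f : V -> nat) (p x : V) (t : nat) := [forall z, btw p x z ==> (f z <= t)].
Definition iv (f : V -> nat) (x : V) (t : nat) := (f x - bet x <= t < f x).
Definition cnt (f : V -> nat) (p : V) (t : nat) :=
  \sum_(x in sub p | [&& x != p, bet p <= bet x, iv f x t & seen f p x t]) 1.
Definition raw (f : V -> nat) (p : V) (t : nat) :=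
  \sum_(x in sub p | [&& x != p, bet x < bet p, t < f x & seen f p x t]) w x.
(* [p] is the top of a maximal set of vertices of equal rounded weight, when weights are monotone. *)
Definition lr (p : V) := (p == rho) || (bet p < bet (par p)).
(** The first demand keeps the interval of [p] clear of the visible intervals at least as heavy. The
    second allows at most one of them after [p], and none if [p] tops its set, which forces the top
    to carry the largest label of the set. The third limits the lighter weight left in view; it is
    what pays for the lighter vertices in the search. *)
Definition okt (f : V -> nat) (p : V) (e t : nat) : bool :=
  [&& (e - bet p <= t < e) ==> (cnt f p t == 0),
      (e <= t) ==> (cnt f p t <= ~~ lr p) &
      (e <= t) ==> (raw f p t <= (if lr p then w p else 2 * bet p))].
Definition feas (f : V -> nat) (p : V) (e : nat) : bool :=
  [&& e < N, 0 < e, bet p %| e & [forall t : 'I_N, okt f p e t]].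
(* [N] is the junk label of a vertex that has no feasible label. *)
Definition greedy (E : V -> nat) := forall p, p \in X ->
  (forall e, feas E p e -> feas E p (E p) /\ E p <= e) /\
  ((forall e, ~~ feas E p e) -> E p = N).

Lemma feasP f p e : reflect [/\ e < N, 0 < e, bet p %| e & forall t, t < N -> okt f p e t] (feas f p e).
Proof.
apply: (iffP and4P) => [[-> -> -> /forallP h]|[-> -> -> h]]; split=> //.
  by move=> t tN; exact: (h (Ordinal tN)).
by apply/forallP => t; apply: h.
Qed.

Lemma greedyP E p e : greedy E -> p \in X -> feas E p e -> feas E p (E p) /\ E p <= e.
Proof. by move=> h /h[h1 _] /h1. Qed.

(** * Exchange argument: greedy labels against an arbitrary feasible labelling *)

Section Dominance.
Hypotheses (aT : tree_answers a) (cX : convex a X) (rX : rho \in X).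
Variable S : {set V}.
Hypothesis SX : S \subset X.
Hypothesis cS : convex a S.
Hypothesis bS : forall p x, p \in S -> x \in sub p -> (bet p <= bet x) = (x \in S).
Hypothesis dS : forall p x, p \in S -> x \in S -> x \in sub p -> bet p %| bet x.
Hypothesis b0 : forall v, 0 < bet v.

(* [cnt] and [raw] as seen from above [p], so that [p] itself can be counted and can hide others. *)
Definition seenI (f : V -> nat) (p x : V) (t : nat) :=
  [forall z, [&& z \in sub p, x \in sub z & z != x] ==> (f z <= t)].
Definition vis (f : V -> nat) (p : V) (t : nat) :=
  \sum_(x in sub p | [&& x \in S, iv f x t & seenI f p x t]) 1.
Definition lit (f : V -> nat) (p : V) (t : nat) :=
  \sum_(x in sub p | [&& x \notin S, t < f x & seenI f p x t]) w x.

Lemma seenIP f p x t : reflect (forall z, z \in sub p -> x \in sub z -> z != x -> f z <= t) (seenI f p x t).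
Proof.
apply: (iffP forallP) => h z; last by apply/implyP => /and3P[*]; apply: h.
by move=> *; apply: (implyP (h z)); apply/and3P.
Qed.
Lemma seenP f p x t : reflect (forall z, btw p x z -> f z <= t) (seen f p x t).
Proof. by apply: (iffP forallP) => h z; apply/implyP; apply: h. Qed.

Lemma seen_ch f p c x t : c \in ch p -> x \in sub c -> seen f p x t = seenI f c x t.
Proof.
move=> hc xc; apply/seenP/seenIP => h z.
  move=> zc xz nzx; apply: h; rewrite /btw xz nzx (sub_trans aT (ch_sub aT hc) zc) /=.
  by rewrite andbT; apply: contraTneq zc => ->; apply: ch_notin hc.
move=> /and4P[zp xz nzp nzx]; apply: h => //.
have /andP[h1 h2] := child_of aT cX rX zp nzp.
have -> // : c = a p z.
by apply: (ch_uniq aT cX rX hc h1 xc); apply: (sub_trans aT h2 xz).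
Qed.

Lemma seenI_ch f p c x t : c \in ch p -> x \in sub c -> seenI f p x t = (f p <= t) && seenI f c x t.
Proof.
move=> hc xc; have xp := sub_trans aT (ch_sub aT hc) xc.
have npx : p != x by apply: contraTneq xc => <-; apply: ch_notin hc.
have pX : p \in X by exact: (subX' cX rX (ch_sub aT hc)).
apply/seenIP/andP => [h|[h1 /seenIP h2] z zp xz nzx].
  split; first exact: (h _ (sub_refl aT pX) xp npx).
  by apply/seenIP => z zc; apply: h; apply: (sub_trans aT (ch_sub aT hc)).
have [->//|nzp] := eqVneq z p; apply: h2 => //.
have /andP[h3 h4] := child_of aT cX rX zp nzp.
have -> // : c = a p z.
by apply: (ch_uniq aT cX rX hc h3 xc); apply: (sub_trans aT h4 xz).
Qed.

Lemma seenI_refl f p t : seenI f p p t.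
Proof. by apply/seenIP => z zp pz; rewrite (sub_anti aT zp pz) eqxx. Qed.

Lemma cntE f p t : p \in S -> cnt f p t = \sum_(c in ch p) vis f c t.
Proof.
move=> pS; have pX := subsetP SX _ pS.
rewrite /cnt (big_sub aT cX rX _ _ pX) eqxx add0n.
apply: eq_bigr => c hc; apply: eq_bigl => x.
case: (boolP (x \in sub c)) => xc //=.
rewrite (seen_ch _ _ hc xc) (bS pS (sub_trans aT (ch_sub aT hc) xc)).
suff -> : x != p by []. by apply: contraTneq xc => ->; apply: ch_notin hc.
Qed.

Lemma rawE f p t : p \in S -> raw f p t = \sum_(c in ch p) lit f c t.
Proof.
move=> pS; have pX := subsetP SX _ pS.
rewrite /raw (big_sub aT cX rX _ _ pX) eqxx add0n.
apply: eq_bigr => c hc; apply: eq_bigl => x.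
case: (boolP (x \in sub c)) => xc //=.
rewrite (seen_ch _ _ hc xc) ltnNge (bS pS (sub_trans aT (ch_sub aT hc) xc)).
suff -> : x != p by []. by apply: contraTneq xc => ->; apply: ch_notin hc.
Qed.

(** [p] hides everything below it until its own label has passed, whence the factor [f p <= t]. *)
Lemma visE f p t : p \in S -> vis f p t = iv f p t + (f p <= t) * cnt f p t.
Proof.
move=> pS; have pX := subsetP SX _ pS.
rewrite (cntE _ _ pS) /vis (big_sub aT cX rX _ _ pX) pS seenI_refl !andbT /=.
have -> : (if iv f p t then 1 else 0) = iv f p t :> nat by case: (iv f p t).
congr (_ + _).
case: (boolP (f p <= t)) => h; rewrite ?mul1n ?mul0n.
  apply: eq_bigr => c hc; apply: eq_bigl => x.
  by case: (boolP (x \in sub c)) => xc //=; rewrite (seenI_ch _ _ hc xc) h.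
rewrite big1 // => c hc; rewrite big1 // => x /andP[xc /and3P[_ _]].
by rewrite (seenI_ch _ _ hc xc) (negbTE h).
Qed.

Lemma litE f p t : p \in S -> lit f p t = (f p <= t) * raw f p t.
Proof.
move=> pS; have pX := subsetP SX _ pS.
rewrite (rawE _ _ pS) /lit (big_sub aT cX rX _ _ pX) pS /= add0n.
case: (boolP (f p <= t)) => h; rewrite ?mul1n ?mul0n.
  apply: eq_bigr => c hc; apply: eq_bigl => x.
  by case: (boolP (x \in sub c)) => xc //=; rewrite (seenI_ch _ _ hc xc) h.
rewrite big1 // => c hc; rewrite big1 // => x /andP[xc /and3P[_ _]].
by rewrite (seenI_ch _ _ hc xc) (negbTE h).
Qed.

Lemma iv_ge f p t : iv f p t -> (f p <= t) = false.
Proof. by rewrite /iv => /andP[_]; rewrite ltnNge => /negbTE. Qed.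

Lemma vis_le1 f p t : p \in S -> feas f p (f p) -> t < N -> vis f p t <= 1.
Proof.
move=> pS /feasP[_ _ _ h] tN; rewrite visE //.
case: (boolP (iv f p t)) => [/iv_ge ->//|_]; rewrite add0n.
case: (boolP (f p <= t)) => h2; rewrite ?mul1n //.
have /and3P[_ /implyP/(_ h2) h3 _] := h t tN; apply: leq_trans h3 _; by case: lr.
Qed.

Lemma notin_S_sub c p x : c \in ch p -> p \in S -> c \notin S -> x \in sub c -> x \notin S.
Proof.
move=> hc pS ncS xc; apply: contra ncS => xS.
have xp := sub_trans aT (ch_sub aT hc) xc.
by apply: (cS pS xS); rewrite (sub_pthE aT cX rX c xp) (ch_sub aT hc).
Qed.

Lemma vis0 c p f t : c \in ch p -> p \in S -> c \notin S -> vis f c t = 0.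
Proof.
move=> hc pS ncS; rewrite /vis big1 // => x /andP[xc /andP[xS _]].
by rewrite (negbTE (notin_S_sub hc pS ncS xc)) in xS.
Qed.

Lemma lit_eq c p f E t : c \in ch p -> p \in S -> c \notin S -> (forall x, x \notin S -> f x = E x) ->
  lit f c t = lit E c t.
Proof.
move=> hc pS ncS fE; apply: eq_bigl => x; case: (boolP (x \in sub c)) => xc //=.
have nx := notin_S_sub hc pS ncS xc; rewrite nx fE //=; congr (_ && _).
apply/seenIP/seenIP => h z zc xz nzx; have := h z zc xz nzx; rewrite fE //;
  exact: (notin_S_sub hc pS ncS zc).
Qed.

Lemma le_divE m d t : 0 < d -> d %| m -> (m <= t) = (m %/ d <= t %/ d).
Proof. by move=> d0 dm; rewrite -[in LHS](divnK dm) -leq_divRL. Qed.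

(** All interval ends of vertices of [S] below [p] are multiples of [bet p], so visibility can
    change only there. *)
Lemma vis_block f p t t' : p \in S -> (forall x, x \in S -> x \in sub p -> bet x %| f x) ->
  forall c, c \in ch p -> t %/ bet p = t' %/ bet p -> vis f c t = vis f c t'.
Proof.
move=> pS h c hc ett.
have D x : x \in S -> x \in sub c -> bet p %| f x /\ bet p %| f x - bet x.
  move=> xS xc; have xp := sub_trans aT (ch_sub aT hc) xc.
  have h1 := dS pS xS xp; have h2 := dvdn_trans h1 (h _ xS xp).
  by rewrite dvdn_sub.
have L m : bet p %| m -> (m <= t) = (m <= t') by move=> dm; rewrite !(le_divE _ (b0 p) dm) ett.
apply: eq_bigl => x; case: (boolP (x \in sub c)) => xc //=; case: (boolP (x \in S)) => xS //=.
have [d1 d2] := D _ xS xc; rewrite /iv L // !ltnNge L //; congr (_ && _).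
have xp := sub_trans aT (ch_sub aT hc) xc.
apply/seenIP/seenIP => k z zc xz nzx; have := k z zc xz nzx; rewrite L //;
 by case: (D z) => //; apply: (cS pS xS); rewrite (sub_pthE aT cX rX z xp) (sub_trans aT (ch_sub aT hc) zc).
Qed.

(** Lexicographic comparison read from late times to early ones: the profiles agree from [s] on, and
    just before [s] only [f] is busy. The value [s = 0] stands for agreement at all times. *)
Definition below (E f : V -> nat) (c : V) (s : nat) :=
  [/\ (forall t, s <= t < N -> vis E c t = vis f c t /\ lit E c t <= lit f c t) &
   (0 < s -> [/\ s <= N, vis E c s.-1 = 0 & vis f c s.-1 = 1])].

(** The threshold is lowered past the times at which [f] is idle as well, until [f] is busy or time
    0 is reached. *)
Lemma below_shrink E f c s0 : s0 <= N -> (forall t, t < N -> vis f c t <= 1) ->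
  (forall t, s0 <= t < N -> vis E c t = vis f c t /\ lit E c t <= lit f c t) ->
  (forall t, t < s0 -> vis E c t = 0 /\ lit E c t = 0) -> exists s, below E f c s.
Proof.
elim: s0 => [|s0 IH] sN h1 h2 h3; first by exists 0; split.
have [v1|v1] := eqVneq (vis f c s0) 1.
  by exists s0.+1; split=> // _; have [] := h3 s0 (ltnSn _).
apply: IH => //; [exact: ltnW | move=> t /andP[st tN] | by move=> t ts; apply: h3; apply: ltnW].
have [ts|ts] := eqVneq t s0; last by apply: h2; rewrite tN andbT ltn_neqAle eq_sym ts.
have [-> ->] := h3 t ltac:(by rewrite ts); split=> //.
by have := h1 t tN; rewrite ts; case: (vis f c s0) v1 => [|[]].
Qed.

(** Induction from the leaves up, with [s] the largest threshold of the children. Either the label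
    that [f] gives to [p] is feasible for [E] too, or [s] itself is; in both cases greediness keeps
    [E p] low enough for the comparison to persist at [p]. *)
Lemma dominance E f p : greedy E -> (forall x, x \notin S -> f x = E x) ->
  p \in S -> (forall x, x \in S -> x \in sub p -> feas f x (f x)) ->
  (forall x, x \in S -> x \in sub p -> feas E x (E x)) /\ exists s, below E f p s.
Proof.
move=> gE fE pS; have := subsetP SX _ pS; move: p pS => p0 pS0 pX0.
move: p0 pX0 pS0; apply: (sub_ind aT cX rX) => p pX IH pS hf.
have IHc c : c \in ch p -> (forall x, x \in S -> x \in sub c -> feas E x (E x)) /\ exists s, below E f c s.
  move=> hc; case: (boolP (c \in S)) => cSS.
    by apply: IH => // x xS xc; apply: hf => //; apply: (sub_trans aT (ch_sub aT hc)).
  split=> [x xS xc|]; first by have := notin_S_sub hc pS cSS xc; rewrite xS.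
  by exists 0; split=> // t _; rewrite !(vis0 _ _ hc) // (lit_eq _ hc pS cSS fE).
have dE x : x \in S -> x \in sub p -> x != p -> feas E x (E x).
  move=> xS xp nxp; have /andP[h1 h2] := child_of aT cX rX xp nxp.
  by have [h _] := IHc _ h1; apply: h.
have dvE x : x \in S -> x \in sub p -> x != p -> bet x %| E x.
  by move=> xS xp nxp; have /feasP[] := dE x xS xp nxp.
have dvf x : x \in S -> x \in sub p -> bet x %| f x.
  by move=> xS xp; have /feasP[] := hf x xS xp.

have [sc hsc] : exists sc, forall c, c \in ch p -> below E f c (sc c).
  apply: (@fin_all_exists V (fun _ => nat) (fun c s => c \in ch p -> below E f c s)) => c.
  by case: (boolP (c \in ch p)) => hc; [have [_ [s h]] := IHc _ hc; exists s | exists 0].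
have /feasP[bN bpos bdv hok] := hf p pS (sub_refl aT pX).
set b := f p in bN bpos bdv hok *.
pose s := \max_(c in ch p) sc c.
have scs c : c \in ch p -> sc c <= s by move=> hc; apply: (leq_bigmax_cond (F := sc)).
have abv c t : c \in ch p -> s <= t < N -> vis E c t = vis f c t /\ lit E c t <= lit f c t.
  move=> hc /andP[st tN]; have [h _] := hsc c hc; apply: h.
  by rewrite tN andbT (leq_trans (scs c hc) st).
have cabv t : s <= t < N -> cnt E p t = cnt f p t.
  by move=> h; rewrite !cntE //; apply: eq_bigr => c hc; have [] := abv c t hc h.
have rabv t : s <= t < N -> raw E p t <= raw f p t.
  by move=> h; rewrite !rawE //; apply: leq_sum => c hc; have [] := abv c t hc h.
have fle1 t : t < N -> vis f p t <= 1 by apply: vis_le1 => //; apply: hf => //; apply: (sub_refl aT).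
have bp0 := b0 p.
have bb : bet p <= b by apply: dvdn_leq.
have fin : feas E p (E p) -> forall x, x \in S -> x \in sub p -> feas E x (E x).
  by move=> h x xS xp; have [->//|] := eqVneq x p; apply: dE.
have block e : E p <= e -> bet p %| e -> feas E p (E p) -> E p != e -> E p <= e - bet p.
  move=> h1 /dvdnP[k ek] /feasP[_ _ /dvdnP[m em] _] h2.
  have hlt : E p < e by rewrite ltn_neqAle h2.
  have hmk : m < k by rewrite -(ltn_pmul2r bp0) -ek -em.
  by rewrite em ek -[X in _ - X]mul1n -mulnBl leq_pmul2r //; slia.
(* From time [s] on, [p] sees the same heavy intervals in [E] as in [f] and no more light weight. If
   [s] is at most [b], the label [b] is therefore feasible for [E]. *)
have [sb|bs] := leqP s b.
  have sb' : s <= b - bet p.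
    have [//|h] := leqP s (b - bet p).
    have s0 : 0 < s by slia.
    have [c hc es] : exists2 c, c \in ch p & sc c = s.
      case: (boolP [exists c in ch p, sc c == s]) => [/existsP[c /andP[h1 /eqP h2]]|/existsP no]; first by exists c.
      have : s <= s.-1.
        apply/bigmax_leqP => c hc; have := scs c hc; rewrite leq_eqVlt => /orP[/eqP h1|]; last slia.
        by case: no; exists c; rewrite hc h1 eqxx.
      slia.
    have [_ /(_ _)] := hsc c hc; rewrite es => /(_ s0)[sN e0 e1].
    have sN' : s.-1 < N by slia.
    have /and3P[/implyP k _ _] := hok _ sN'.
    have := k ltac:(slia); rewrite cntE // sum_nat_eq0 => /forallP/(_ c); rewrite hc e1; by [].
  have fb : feas E p b.
    apply/feasP; split=> // t tN; have /and3P[k1 k2 k3] := hok t tN; apply/and3P; split; apply/implyP => ht.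
    - by rewrite cabv ?(implyP k1) //; slia.
    - by rewrite cabv ?(implyP k2) //; slia.
    - by apply: leq_trans (implyP k3 ht); apply: rabv; slia.
  have [fE' leb] := greedyP gE pX fb.
  split; first exact: fin.
  (* With equal labels all earlier differences are hidden by [p], so the profiles agree at all
     times. With a smaller label of [E], only [f] is busy at [b - 1]. *)
  have [eb|neb] := eqVneq (E p) b.
    exists 0; split=> // t /andP[_ tN]; rewrite !visE // !litE // eb -/b.
    have -> : iv E p t = iv f p t by rewrite /iv eb.
    case: (leqP b t) => ht; rewrite ?mul0n ?mul1n; last by [].
    by rewrite cabv ?rabv //; slia.
  have Eb := block b leb bdv fE' neb.
  exists b; split=> [t /andP[bt tN]|_].
    have i1 : iv E p t = false by rewrite /iv; slia.
    have i2 : iv f p t = false by rewrite /iv -/b; slia.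
    rewrite !visE // !litE // i1 i2 -/b bt (leq_trans leb bt) !mul1n.
    by rewrite cabv ?rabv //; slia.
  have tN : b.-1 < N by slia.
  have /and3P[/implyP k _ _] := hok _ tN; have /eqP k0 := k ltac:(slia).
  split; [slia| |].
    have i1 : iv E p b.-1 = false by rewrite /iv; slia.
    by rewrite visE // i1 cabv ?k0 ?muln0 //; slia.
  have i2 : iv f p b.-1 = true by rewrite /iv -/b; slia.
  have i3 : (b <= b.-1) = false by slia.
  by rewrite visE // i2 -/b i3.
(* Here the threshold lies after the interval of [p] in [f]. At time [s - 1] only one child is busy
   in [f], and it is idle in [E]; so [E] has a gap there. *)
have [c0 hc0 es] : exists2 c, c \in ch p & sc c = s.
  case: (boolP [exists c in ch p, sc c == s]) => [/existsP[c /andP[h1 /eqP h2]]|/existsP no]; first by exists c.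
  have : s <= s.-1.
    apply/bigmax_leqP => c hc; have := scs c hc; rewrite leq_eqVlt => /orP[/eqP h1|]; last slia.
    by case: no; exists c; rewrite hc h1 eqxx.
  slia.
have s0 : 0 < s by slia.
have [_ /(_ _)] := hsc c0 hc0; rewrite es => /(_ s0)[sN e0 e1].
have sN' : s.-1 < N by slia.
have bs' : b <= s.-1 by slia.
have /and3P[_ /implyP/(_ bs') k2 _] := hok _ sN'.
have c1 : cnt f p s.-1 <= 1 by apply: leq_trans k2 _; case: lr.
have oth c : c \in ch p -> c != c0 -> vis f c s.-1 = 0.
  move=> hc nc; move: c1; rewrite cntE // (bigD1 c0) //= e1 (bigD1 c) ?hc //=; slia.
have oE c : c \in ch p -> vis E c s.-1 = 0.
  move=> hc; have [->//|nc] := eqVneq c c0.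
  have [h1 h2] := hsc c hc; have := scs c hc; rewrite leq_eqVlt => /orP[/eqP h|h].
    by have [|_] := h2; rewrite ?h //; slia.
  by have [|-> _] := h1 s.-1; [slia | exact: oth].
have cE0 : cnt E p s.-1 = 0 by rewrite cntE // big1.
have cf1 : cnt f p s.-1 = 1.
  rewrite cntE // (bigD1 c0) //= e1 big1 // => c /andP[hc nc]; exact: oth.
(* [z] ends the block of length [bet p] around [s - 1]. Visibility is constant on the block while
   the labellings agree from [s] on, so [z = s], and the block before [s] is free for [E]. *)
pose z := (s.-1 %/ bet p).+1 * bet p.
have zs : s.-1 < z by rewrite /z ltn_ceil.
have zblk t : z - bet p <= t < z -> t %/ bet p = s.-1 %/ bet p.
  move=> /andP[h1 h2]; apply/eqP; rewrite eqn_leq; apply/andP; split.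
    by rewrite -ltnS ltn_divLR.
  by rewrite leq_divRL //; move: h1; rewrite /z mulSn; slia.
have zN : z < N.
  have : 0 < vis f c0 s.-1 by rewrite e1.
  rewrite /vis lt0n sum_nat_eq0 negb_forall => /existsP[x]; rewrite negb_imply => /andP[/andP[xc /and3P[xS hiv _]] _].
  have xp := sub_trans aT (ch_sub aT hc0) xc.
  have /feasP[fN _ _ _] := hf x xS xp; apply: leq_ltn_trans fN.
  have dd : bet p %| f x := dvdn_trans (dS pS xS xp) (dvf x xS xp).
  rewrite /z -(divnK dd) leq_pmul2r // ltn_divLR // divnK //; by case/andP: hiv.
have dvE' x : x \in S -> x \in sub c0 -> bet x %| E x.
  move=> xS xc; apply: dvE => //; first exact: (sub_trans aT (ch_sub aT hc0)).
  by apply: contraTneq xc => ->; apply: ch_notin hc0.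
have visblk g c t : (forall x, x \in S -> x \in sub p -> x != p -> bet x %| g x) -> c \in ch p -> z - bet p <= t < z -> vis g c t = vis g c s.-1.
  move=> hg hc ht.
  (* [p] gets the dummy label 0, since divisibility of [E p] is not yet known; visibility from a
     child does not involve [p]. *)
  pose g' x := if x == p then 0 else g x.
  have eg t' : vis g c t' = vis g' c t'.
    have ng x : x \in sub c -> g' x = g x.
      by move=> xc; rewrite /g'; case: eqP => // xp; move: xc; rewrite xp (negbTE (ch_notin aT hc)).
    apply: eq_bigl => x; case: (boolP (x \in sub c)) => xc //=; rewrite /iv ng //; congr [&& _, _ & _].
    by apply/seenIP/seenIP => k y yc xy nyx; have := k y yc xy nyx; rewrite ng.
  rewrite !eg; apply: (vis_block pS) => //; last exact: zblk.
  by move=> x xS xp; rewrite /g'; case: eqP => [_|/eqP]; [rewrite dvdn0 | exact: hg].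
have zeq : z = s.
  have [zs'|] := leqP z s; first slia.
  move=> sz; have h : s <= z.-1 < N by slia.
  have hz : z - bet p <= z.-1 < z by slia.
  have [h1 _] := abv c0 _ hc0 h.
  rewrite (visblk E) // (visblk f) // in h1; first by rewrite e0 e1 in h1.
  by move=> x xS xp _; apply: dvf.
have cntEblk t : s - bet p <= t < s -> cnt E p t = 0.
  move=> ht; rewrite cntE // big1 // => c hc; rewrite (visblk E) ?zeq //; exact: oE.
have cntfblk t : s - bet p <= t < s -> cnt f p t = 1.
  move=> ht; rewrite -cf1 !cntE //; apply: eq_bigr => c hc; rewrite (visblk f) ?zeq //.
  by move=> x xS xp _; apply: dvf.
have dvs : bet p %| s by rewrite -zeq dvdn_mull.
have bsb : b <= s - bet p.
  case/dvdnP: dvs bs => k -> ; case/dvdnP: bdv => m ->; rewrite ltn_pmul2r // => mk.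
  by rewrite -[X in _ - X]mul1n -mulnBl leq_pmul2r //; slia.
have fs : feas E p s.
  apply/feasP; split=> //; first by rewrite -zeq.
  move=> t tN; have /and3P[k1 k2' k3] := hok t tN; apply/and3P; split; apply/implyP => ht.
  - by rewrite cntEblk.
  - by rewrite cabv ?(implyP k2') //; slia.
  - by apply: leq_trans (implyP k3 _); [apply: rabv|]; slia.
have [fE' les] := greedyP gE pX fs.
split; first exact: fin.
have bes : bet p <= s by apply: dvdn_leq.
(* If [E p = s], then [p] fills in [E] the block that a child fills in [f]: agreement extends one
   block further down, and [E] shows nothing before it. *)
have [eb|neb] := eqVneq (E p) s.
  apply: (@below_shrink _ _ _ (s - bet p)) => //; first by slia.
    move=> t /andP[h1 tN]; rewrite !visE // !litE // eb -/b.
    have -> : iv f p t = false by rewrite /iv -/b; slia.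
    have -> : b <= t by slia.
    case: (leqP s t) => ht.
      have -> : iv E p t = false by rewrite /iv eb; slia.
      by rewrite !mul1n cabv ?rabv //; slia.
    have -> : iv E p t = true by rewrite /iv eb; slia.
    by rewrite cntfblk //; slia.
  move=> t ht; rewrite visE // litE // eb.
  have -> : iv E p t = false by rewrite /iv eb; slia.
  by have -> : (s <= t) = false by slia.
have Es := block s les dvs fE' neb.
exists s; split=> [t /andP[st tN]|_].
  have i1 : iv E p t = false by rewrite /iv; slia.
  have i2 : iv f p t = false by rewrite /iv -/b; slia.
  have i3 : b <= t by slia.
  rewrite !visE // !litE // i1 i2 -/b i3 (leq_trans les st) !mul1n.
  by rewrite cabv ?rabv //; slia.
split=> //.
  have i1 : iv E p s.-1 = false by rewrite /iv; slia.
  by rewrite visE // i1 cE0 muln0.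
have i2 : iv f p s.-1 = false by rewrite /iv -/b; slia.
by rewrite visE // i2 -/b bs' cf1.
Qed.

End Dominance.
End Labels.

(** * Reserved intervals are separated by larger labels *)

Section Separation.
Variables (V : finType) (a : V -> V -> V) (X : {set V}) (rho : V).
Variables (bet w : V -> nat) (N : nat).
Notation sub := (sub a X rho).
Notation ch := (ch a X rho).
Notation par := (par a rho).
Notation seen := (seen a X rho).
Notation cnt := (cnt a X rho bet).
Notation raw := (raw a X rho bet w).
Notation lr := (lr a rho bet).
Notation feas := (feas a X rho bet w N).
Hypotheses (aT : tree_answers a) (cX : convex a X) (rX : rho \in X).
Hypothesis b0 : forall v, 0 < bet v.
Variable S : {set V}.
Hypothesis SX : S \subset X.
Hypothesis cS : convex a S.
Hypothesis bS : forall p x, p \in S -> x \in sub p -> (bet p <= bet x) = (x \in S).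
Variable f : V -> nat.
Hypothesis fS : forall x, x \in S -> feas f x (f x).

Lemma feas_gt0 x : x \in S -> 0 < f x. Proof. by move/fS/feasP; case. Qed.
Lemma feas_ltN x : x \in S -> f x < N. Proof. by move/fS/feasP; case. Qed.
Lemma feas_ok x t : x \in S -> t < N -> okt a X rho bet w f x (f x) t.
Proof. by move=> xS; move/feasP: (fS xS) => [_ _ _]; apply. Qed.

Lemma cnt_ge1 p x t : p \in S -> x \in S -> x \in sub p -> x != p -> iv bet f x t ->
  seen f p x t -> 0 < cnt f p t.
Proof.
move=> pS xS xp nxp h1 h2; rewrite /Submission.cnt (bigD1 x) //=.
by rewrite xp nxp (bS pS xp) xS h1 h2.
Qed.

(** Without a separator both intervals are visible from the join of [x] and [y]. If the join is one
    of them, the first demand of [okt] fails; otherwise two intervals are in view and the second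
    fails. *)
Lemma separated x y t : x \in S -> y \in S -> x != y -> t < N -> iv bet f x t -> iv bet f y t ->
  exists z, [/\ pth a x y z, z != x, z != y & t < f z].
Proof.
move=> xS yS nxy tN ix iy; have [xX yX] := (subsetP SX _ xS, subsetP SX _ yS).
case: (boolP [exists z, [&& pth a x y z, z != x, z != y & t < f z]]) => [/existsP[z /and4P[*]]|/existsP no].
  by exists z.
have no' z : pth a x y z -> z != x -> z != y -> f z <= t.
  by move=> h1 h2 h3; rewrite leqNgt; apply/negP => h4; apply: no; exists z; apply/and4P.
have [m [xm ym pm]] := lca_ex aT cX rX xX yX.
have mS := cS xS yS pm.
have btwp u v z : z \in sub u -> v \in sub z -> pth a u v z.
  by move=> h1 h2; rewrite (sub_pthE aT cX rX) ?h1 ?h2 //; apply: (sub_trans aT h1).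
have seenm u v : u \in sub m -> pth a u v m -> (forall z, pth a u v z -> z != u -> z != v -> f z <= t) -> v \notin sub u -> seen f m u t.
  move=> um puv h nv; apply/seenP => z /and4P[zm uz nzm nzu].
  have pz : pth a u v z by apply: (pth_sub aT puv); rewrite pthC; apply: btwp.
  apply: h => //; apply: contra nv => /eqP zv; rewrite zv in uz zm nzm.
  case/negP: nzm; apply/eqP; apply: (pth_anti aT (x := u)); last exact: puv.
  by rewrite pthC; apply: btwp.
have ok0 u v : u \in S -> v \in S -> v \in sub u -> v != u -> iv bet f u t -> iv bet f v t ->
    (forall z, pth a u v z -> z != u -> z != v -> f z <= t) -> False.
  move=> uS vS vu nvu iu iv' h.
  have := feas_ok uS tN; rewrite /okt; have -> : f u - bet u <= t < f u by exact: iu.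
  case/and3P; rewrite implyTb => /eqP c0 _ _.
  have : 0 < cnt f u t; last by rewrite c0.
  apply: (cnt_ge1 uS vS vu nvu iv'); apply/seenP => z /and4P[zu vz nzu nzv].
  by apply: h => //; apply: btwp.
case: (boolP (y \in sub x)) => yx.
  by exfalso; apply: (ok0 x y) => //; rewrite eq_sym.
case: (boolP (x \in sub y)) => xy.
  by exfalso; apply: (ok0 y x) => // z; rewrite pthC => h1 h2 h3; apply: no'.
have nmx : m != x by apply: contraNneq yx => <-.
have nmy : m != y by apply: contraNneq xy => <-.
have fm : f m <= t by apply: no'.
have /and3P[_ + _] := feas_ok mS tN; rewrite fm implyTb => c1.
have : 1 < cnt f m t; last by rewrite ltnNge (leq_trans c1) //; case: lr.
rewrite /Submission.cnt (bigD1 x) /=; last first.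
  rewrite xm eq_sym nmx (bS mS xm) xS ix /=; apply: (seenm x y) => //.
rewrite (bigD1 y) //= ym eq_sym nmy (bS mS ym) yS iy eq_sym nxy andbT /=.
apply: (seenm y x) => // [|z]; first by rewrite pthC.
by rewrite pthC => h1 h2 h3; apply: no'.
Qed.

(** Among the violating vertices take the one closest to [v]. At its last unit of time a separator
    from [v] would be a violator still closer. *)
Lemma max_separated (Y : {set V}) v x : Y \subset S -> convex a Y -> v \in Y -> (forall u, u \in Y -> f u <= f v) ->
  x \in Y -> x != v -> f x <= f v - bet v.
Proof.
move=> YS cY vY hv xY nxv; rewrite leqNgt; apply/negP => h.
pose Q x := [&& x \in Y, x != v & f v - bet v < f x].
have Qx : Q x by rewrite /Q xY nxv.
have [y /and3P[yY nyv hy] hm] := arg_minnP (P := Q) (fun x => #|[set z | pth a v x z]|) Qx.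
have [vS yS] := (subsetP YS _ vY, subsetP YS _ yY).
have fy := hv y yY; have fy0 := feas_gt0 yS; have fvN := feas_ltN vS; have byp := b0 y.
have [||||z [pz nzv nzy tz]] := @separated v y (f y).-1 vS yS; rewrite /iv; try slia.
  by rewrite eq_sym.
have zY := cY _ _ _ vY yY pz.
have := hm z; rewrite /Q zY nzv /=; have -> : f v - bet v < f z by slia.
move=> /(_ isT); rewrite leqNgt => /negP; apply; apply: proper_card; apply/properP; split.
  by apply/subsetP => u; rewrite !inE; apply: (pth_sub aT).
exists y; first by rewrite inE pth_r.
rewrite inE; apply: contra nzy => h1; have := pth_anti aT h1 pz => /eqP; by rewrite eq_sym.
Qed.

(** Among the vertices of largest label below [p] take a topmost one. Its last unit of time is
    visible from [p], so the demands on a top push it before the interval of [p]. *)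
Lemma root_max p x : p \in S -> lr p -> x \in S -> x \in sub p -> x != p -> f x <= f p - bet p.
Proof.
move=> pS lp xS xp nxp.
pose Q x := [&& x \in S, x \in sub p & x != p].
have Qx : Q x by rewrite /Q xS xp.
have [y0 y0Q hm0] := arg_maxnP (P := Q) f Qx.
pose Q' x := Q x && (f x == f y0).
have Qy0 : Q' y0 by rewrite /Q' y0Q eqxx.
have [y /andP[/and3P[yS yp nyp] /eqP fy] hm] := arg_maxnP (P := Q') (fun x => #|sub x|) Qy0.
apply: (leq_trans (hm0 x Qx)); rewrite /= -fy.
have fy0 := feas_gt0 yS; have fyN := feas_ltN yS; have byp := b0 y.
have c1 : 0 < cnt f p (f y).-1.
  apply: (cnt_ge1 pS yS yp nyp); rewrite /iv; first slia.
  apply/seenP => z /and4P[zp yz nzp nzy].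
  have zS : z \in S by apply: (cS pS yS); rewrite (sub_pthE aT cX rX) ?zp ?yz.
  have Qz : Q z by rewrite /Q zS zp.
  have h1 : f z <= f y0 := hm0 z Qz.
  have [h2|h2] := eqVneq (f z) (f y0); last first.
    have h3 : f z < f y0 by rewrite ltn_neqAle h2.
    by slia.
  have := hm z; rewrite /Q' Qz h2 eqxx => /(_ isT) /=.
  rewrite leqNgt => /negP[]; apply: proper_card; apply/properP; split; first exact: (sub_sub aT).
  exists z; first exact: (sub_refl aT (subX zp)).
  by apply: contra nzy => zy; apply/eqP; apply: (sub_anti aT zy).
have := feas_ok pS (t := (f y).-1) ltac:(slia).
rewrite leqNgt => /and3P[h1 h2 _]; apply/negP => h.
case: (leqP (f p) (f y).-1) => h3.
  by move: h2; rewrite h3 lp /= => h4; slia.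
move: h1; have -> : f p - bet p <= (f y).-1 < f p by slia.
by rewrite implyTb => /eqP h4; slia.
Qed.

End Separation.

(** * Searching by labels *)

(* The rounded-up quotient m / d, when it is at most N; a sum is easy to evaluate on the machine. *)
Definition cdv (N m d : nat) := \sum_(k < N) (k * d < m).

Lemma cdv_le N m d k : k < N -> (cdv N m d <= k) = (m <= k * d).
Proof.
move=> kN; apply/idP/idP => [|h].
  apply: contraTT; rewrite -!ltnNge => h.
  have <- : \sum_(i < N | i < k.+1) 1 = k.+1.
    by rewrite -(big_ord_widen N (fun=> 1) kN) sum_nat_const card_ord muln1.
  rewrite /cdv [leqRHS](bigID (fun i : 'I_N => i < k.+1)) /=; apply: leq_trans (leq_addr _ _).
  apply: leq_sum => i ik; have : i * d <= k * d by rewrite leq_mul2r -ltnS ik orbT.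
  by move=> h2; rewrite (leq_ltn_trans h2 h).
have <- : \sum_(i < N | i < k) 1 = k.
  by rewrite -(big_ord_widen N (fun=> 1) (ltnW kN)) sum_nat_const card_ord muln1.
rewrite [leqRHS]big_mkcond /=; apply: leq_sum => i _; case: (ltnP i k) => [_|ki]; first by case: (_ < m).
rewrite ltnNge; have -> // : m <= i * d.
by apply: (leq_trans h); rewrite leq_mul2r ki orbT.
Qed.

Section Search.
Variables (V : finType) (a : V -> V -> V) (w : V -> nat).

(** The condition [q != t] empties the candidate set once the target has been queried, and this ends
    the search. *)
Definition cut (Y : {set V}) (q t : V) := [set y in Y | (q != t) && (a q y == a q t)].

Fixpoint simc (R : {set V} -> V) (k : nat) (Y : {set V}) (t : V) : nat :=
  if k is k'.+1 then if Y == set0 then 0 else w (R Y) + simc R k' (cut Y (R Y) t) t else 0.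

Lemma simc0 R k t : simc R k set0 t = 0.
Proof. by case: k => //= k; rewrite eqxx. Qed.

End Search.

Section Cost.
Variables (V : finType) (a : V -> V -> V) (X : {set V}) (rho : V).
Variables (bet w : V -> nat) (N : nat).
Notation sub := (sub a X rho).
Notation ch := (ch a X rho).
Notation par := (par a rho).
Notation feas := (feas a X rho bet w N).
Hypotheses (aT : tree_answers a) (cX : convex a X) (rX : rho \in X).
Variable lv : V -> nat.
Hypothesis pw : forall v, bet v = 2 ^ lv v.
Hypothesis wb : forall v, w v <= bet v.
Variables (E : V -> nat) (R : {set V} -> V).
Hypothesis fE : forall x, x \in X -> feas E x (E x).

Definition istop (Y : {set V}) (q : V) := q \in Y /\ forall v, v \in Y -> v \in sub q.

(** Labels are first rounded up to multiples of [bet q], with [q] the top of the candidates. Within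
    one block heavier vertices go first, and exact labels only break ties. *)
Definition keyle (q u v : V) :=
  (cdv N (E u) (bet q) < cdv N (E v) (bet q)) ||
  ((cdv N (E u) (bet q) == cdv N (E v) (bet q)) &&
   ((bet u < bet v) || ((bet u == bet v) && (E u <= E v)))).

Hypothesis HR : forall (Y : {set V}) q, Y \subset X -> convex a Y -> istop Y q ->
  R Y \in Y /\ forall u, u \in Y -> keyle q u (R Y).

Let b0 v : 0 < bet v. Proof. by rewrite pw expn_gt0. Qed.

Lemma bet_dv u v : bet u <= bet v -> bet u %| bet v.
Proof. by rewrite !pw leq_exp2l // => h; apply: dvdn_exp2l. Qed.
Lemma bet_half u v : bet u < bet v -> 2 * bet u <= bet v.
Proof. by rewrite !pw ltn_exp2l // => h; rewrite -expnS leq_exp2l. Qed.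

Let E0 x : x \in X -> 0 < E x. Proof. by move/fE/feasP; case. Qed.
Let EN x : x \in X -> E x < N. Proof. by move/fE/feasP; case. Qed.
Let Edv x : x \in X -> bet x %| E x. Proof. by move/fE/feasP; case. Qed.

Lemma cut_cases (Y : {set V}) q v t : Y \subset X -> convex a Y -> istop Y q -> v \in Y ->
  [\/ cut a Y v t = set0,
      [/\ v != q, istop (cut a Y v t) q & forall y, y \in cut a Y v t -> y \in Y /\ y \notin sub v] |
      exists c, [/\ c \in ch v, istop (cut a Y v t) c & cut a Y v t \subset Y]].
Proof.
move=> YX cY [qY hq] vY; have vX := subsetP YX _ vY.
have [->|] := eqVneq (cut a Y v t) set0; first by constructor.
case/set0Pn => x; rewrite inE => /and3P[xY nvt /eqP ext].
have nvx : v != x by apply: contraNneq (ta_neq aT nvt) => vx; rewrite -ext -vx (ta_self aT).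
have xX := subsetP YX _ xY.
have vq := hq v vY.
have side y : y \in Y -> v != y -> (y \in sub v) = (v == rho) || (a v y != a v rho).
  move=> yY nvy; rewrite inE (subsetP YX _ yY) /= /pth (negbTE nvy) andbF orbF.
  by case: (v =P rho) => [<-|_] /=; rewrite ?(ta_self aT) eq_sym ?(ta_neq aT nvy).
case: (boolP (x \in sub v)) => xv; last first.
  have nvr : v != rho by apply: contraNneq xv => ->; rewrite sub_rho.
  have ar : a v x = a v rho.
    by move: xv; rewrite side // (negbTE nvr) /= negbK => /eqP.
  have nvq : v != q.
    by apply: contraNneq xv => ->; apply: hq.
  constructor 2; split=> //.
    have nqv : q \notin sub v.
      by apply: contra nvq => h; apply/eqP; apply: (sub_anti aT vq h).
    split; last by move=> y; rewrite inE => /andP[yY _]; apply: hq.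
    rewrite inE qY nvt -ext ar /=; move: nqv; rewrite side // (negbTE nvr) /= negbK.
    by move->.
  move=> y; rewrite inE => /and3P[yY _ /eqP eyt]; split=> //.
  have nvy : v != y by apply: contraNneq (ta_neq aT nvt) => vy; rewrite -eyt -vy (ta_self aT).
  by rewrite side // (negbTE nvr) /= negbK eyt -ext ar.
have nxv : x != v by rewrite eq_sym.
have /andP[h1 h2] := child_of aT cX rX xv nxv.
constructor 3; exists (a v x); split=> //; last by apply/subsetP => y; rewrite inE => /andP[].
split.
  rewrite inE nvt (ta_idem aT) ext eqxx !andbT -ext.
  by apply: (cY _ _ _ vY xY); apply: pth_ans.
move=> y; rewrite inE => /and3P[yY _ /eqP eyt].
have nvy : v != y by apply: contraNneq (ta_neq aT nvt) => vy; rewrite -eyt -vy (ta_self aT).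
have yv : y \in sub v.
  rewrite side //; move: xv; rewrite side // => /orP[->//|h]; by rewrite eyt -ext h orbT.
have nyv : y != v by rewrite eq_sym.
have /andP[_ ] := child_of aT cX rX yv nyv; by rewrite eyt -ext.
Qed.

Lemma convex_cut Y v t : convex a Y -> convex a (cut a Y v t).
Proof.
move=> cY; have [->|nvt] := eqVneq v t.
  by move=> x y z; rewrite inE eqxx andbF.
have -> : cut a Y v t = [set y in Y | a v y == a v t] by apply/setP => y; rewrite !inE nvt.
by apply: convex_side => //; rewrite eq_sym (ta_neq aT).
Qed.

Lemma cut_sub Y v t : cut a Y v t \subset Y.
Proof. by apply/subsetP => y; rewrite inE => /andP[]. Qed.

(** * Cost of the labelled search in a down-monotonic class *)

Section Down.
Hypothesis Hdown : forall v x, x \in sub v -> bet v <= bet x.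

(** The bound on the labels is the potential: querying [v] costs at most [bet v], and by separation
    the labels left are at most [E v - bet v]. *)
Lemma down_cost k (Y : {set V}) t m : Y \subset X -> convex a Y -> (forall v, v \in Y -> E v <= m) ->
  simc a w R k Y t <= m.
Proof.
elim: k Y m => //= k IH Y m YX cY hm; case: ifPn => // Y0.
have [q qY hq] := top_ex aT cX rX YX cY Y0.
have [vY hv] := HR YX cY (conj qY hq); set v := R Y in vY hv *.
have vX := subsetP YX _ vY.
have bS p x : p \in X -> x \in sub p -> (bet p <= bet x) = (x \in X).
  by move=> pX xp; rewrite Hdown // (subX xp).
(* Here [bet q] is the smallest power in [Y] and divides every label, so rounding to blocks changes
   nothing and the rule takes a largest label. *)
have vmax u : u \in Y -> E u <= E v.
  move=> uY; have uX := subsetP YX _ uY.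
  have dq x : x \in Y -> bet q %| E x.
    by move=> xY; apply: dvdn_trans (Edv (subsetP YX _ xY)); apply: bet_dv; apply: Hdown; apply: hq.
  have hle : cdv N (E u) (bet q) <= cdv N (E v) (bet q).
    by case/orP: (hv u uY) => [/ltnW //|/andP[/eqP -> _]].
  have kN : E v %/ bet q < N by apply: leq_ltn_trans (leq_div _ _) (EN vX).
  have h1 : cdv N (E v) (bet q) <= E v %/ bet q by rewrite cdv_le // divnK ?dq.
  by have := leq_trans hle h1; rewrite cdv_le // divnK ?dq.
have sep := max_separated aT cX rX b0 (subxx X) cX bS fE YX cY vY vmax.
apply: (@leq_trans (bet v + (E v - bet v))).
  apply: leq_add => //; apply: IH.
  - exact: subset_trans (cut_sub _ _ _) YX.
  - exact: convex_cut.
  - move=> u; rewrite inE => /and3P[uY nvt /eqP h]; apply: sep => //.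
    by apply: contraNneq (ta_neq aT nvt) => uv; rewrite -h uv (ta_self aT).
rewrite subnKC ?hm //; apply: dvdn_leq; [exact: E0 | exact: Edv].
Qed.

End Down.

(** * Cost of the labelled search in an up-monotonic class *)

Section Up.
Hypothesis Hup : forall v x, x \in sub v -> bet x <= bet v.

Definition layer (q : V) := [set x in sub q | bet x == bet q].
Lemma layerE q x : (x \in layer q) = (x \in sub q) && (bet x == bet q).
Proof. by rewrite in_set. Qed.

Lemma sub_convex q : convex a (sub q).
Proof.
move=> x y z xq yq pz; case/orP: (pth_tri aT q pz) => h.
  by move: h; rewrite pthC (sub_pthE aT cX rX _ xq) => /andP[].
by move: h; rewrite (sub_pthE aT cX rX _ yq) => /andP[].
Qed.

Lemma layer_X q : layer q \subset X.
Proof. by apply/subsetP => x; rewrite layerE => /andP[/subX]. Qed.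

Lemma layer_refl q : q \in X -> q \in layer q.
Proof. by move=> qX; rewrite layerE (sub_refl aT qX) eqxx. Qed.

Lemma layer_convex q : convex a (layer q).
Proof.
move=> x y z; rewrite !layerE => /andP[xq /eqP bx] /andP[yq /eqP by_] pz.
have zq := sub_convex xq yq pz; rewrite zq /= eqn_leq Hup //=.
have [h|h] : x \in sub z \/ y \in sub z.
  case/orP: (pth_tri aT q pz) => h.
    by left; move: h; rewrite pthC (sub_pthE aT cX rX _ xq) => /andP[].
  by right; move: h; rewrite (sub_pthE aT cX rX _ yq) => /andP[].
by rewrite -bx Hup. by rewrite -by_ Hup.
Qed.

Lemma layer_bS q p x : p \in layer q -> x \in sub p -> (bet p <= bet x) = (x \in layer q).
Proof.
rewrite !layerE => /andP[pq /eqP bp] xp; rewrite (sub_trans aT pq xp) /= bp.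
by rewrite [RHS]eqn_leq (Hup (sub_trans aT pq xp)).
Qed.

(** Of the vertices whose labels stick out above [m], only the highest count: one that lies below
    another is handled after descending there. Their total weight [pot] is the price of getting down
    to level [m] at the present top. *)
Definition topraised (Y : {set V}) (m : nat) (y : V) :=
  (m < E y) && [forall x in Y, (y \in sub x) && (x != y) ==> (E x <= m)].
Definition pot (Y : {set V}) (m : nat) := \sum_(y in Y | topraised Y m y) w y.

Lemma topraisedP (Y : {set V}) m y : reflect (m < E y /\ forall x, x \in Y -> y \in sub x -> x != y -> E x <= m)
  (topraised Y m y).
Proof.
apply: (iffP andP) => [[-> /forallP h]|[-> h]]; split=> //.
  by move=> x xY yx nxy; apply: (implyP (implyP (h x) xY)); rewrite yx.
by apply/forallP => x; apply/implyP => xY; apply/implyP => /andP[]; apply: h.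
Qed.

(** No raised vertex is as heavy as [q], and the topmost raised ones are seen from [q]; the third
    demand of [okt] bounds their weight. *)
Lemma pot_raw (Y : {set V}) q m : Y \subset X -> convex a Y -> istop Y q -> m < N -> 
  (forall v, v \in Y -> bet v = bet q -> E v <= m) -> pot Y m <= 2 * bet q.
Proof.
move=> YX cY [qY hq] mN hK; have qX := subsetP YX _ qY.
have Eq : E q <= m by apply: hK.
have /feasP[_ _ _ /(_ m mN)] := fE qX; rewrite /okt Eq !implyTb => /and3P[_ _ h].
apply: leq_trans (_ : 2 * bet q >= _); last exact: leqnn.
apply: leq_trans (_ : Submission.raw a X rho bet w E q m <= _); last first.
  apply: leq_trans h _; case: ifP => // _; apply: leq_trans (wb q) _; by rewrite leq_pmull.
rewrite /pot /Submission.raw big_mkcond [leqRHS]big_mkcond /=; apply: leq_sum => y _.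
case: ifP => // /andP[yY /topraisedP[h1 h2]]; rewrite hq //=.
have nyq : y != q by apply: contraTneq h1 => ->; rewrite -leqNgt.
rewrite nyq h1 /= ltn_neqAle Hup ?hq // andbT.
case: eqP => [e|_] /=; first by have := hK y yY e; rewrite leqNgt h1.
suff -> : seen a X rho E q y m by [].
apply/seenP => z /and4P[zq yz nzq nzy]; apply: h2 => //.
by apply: (cY _ _ _ qY yY); rewrite (sub_pthE aT cX rX) ?zq ?yz ?hq.
Qed.

(** The second bound serves when only lighter vertices stick out above [m], by at most one block. A
    block costs one vertex of the top weight and a potential of at most [2 * bet q], hence [3 * m].
    Descending to a lighter set may raise [m] by one block but halves the power, and 6 solves
    [x = 3 + x / 2]. *)
Lemma up_cost12 t k m :
  (forall (Y : {set V}) q, Y \subset X -> convex a Y -> istop Y q -> bet q %| m -> m < N ->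
     (forall v, v \in Y -> E v <= m) -> simc a w R k Y t <= 3 * m + 6 * bet q) /\
  (forall (Y : {set V}) q, Y \subset X -> convex a Y -> istop Y q -> bet q %| m -> m + bet q < N ->
     (forall v, v \in Y -> E v <= m + bet q) -> (forall v, v \in Y -> bet v = bet q -> E v <= m) ->
     simc a w R k Y t <= pot Y m + 3 * m + 6 * bet q).
Proof.
elim: k m => [|k IHk] m; first by split.
elim/ltn_ind: m => m IHm.
have S1 (Y : {set V}) q : Y \subset X -> convex a Y -> istop Y q -> bet q %| m -> m < N ->
     (forall v, v \in Y -> E v <= m) -> simc a w R k.+1 Y t <= 3 * m + 6 * bet q.
  move=> YX cY tq dq mN hm; have [qY hq] := tq; have qX := subsetP YX _ qY.
  have m0 : 0 < m by apply: leq_trans (hm q qY); apply: E0.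
  have qm : bet q <= m by apply: dvdn_leq.
  have dq' : bet q %| m - bet q by rewrite dvdn_sub.
  have bq0 := b0 q.
  have Kle v : v \in Y -> bet v = bet q -> E v != m -> E v <= m - bet q.
    move=> vY bv ne; have := hm v vY; have := Edv (subsetP YX _ vY); rewrite bv.
    case/dvdnP => i ei; case/dvdnP: dq => j ej; rewrite ei ej leq_pmul2r // => ij.
    have : i != j by apply: contraNneq ne => ij'; rewrite ei ej ij'.
    rewrite -[X in _ - X]mul1n -mulnBl leq_pmul2r //; lia.
  (* If a vertex as heavy as [q] has label [m], the rule takes such a vertex: no label lies in a
     later block, and within the block the heaviest go first. *)
  case: (boolP [exists p in Y, (bet p == bet q) && (E p == m)]) => [/existsP[p /and3P[pY /eqP bp /eqP Ep]]|/existsP no].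
    have [vY hv] := HR YX cY tq; rewrite /=.
    have -> : (Y == set0) = false by apply/negbTE/set0Pn; exists q.
    set v := R Y in vY hv *; have vX := subsetP YX _ vY.
    have mdN : m %/ bet q < N by apply: leq_ltn_trans (leq_div _ _) mN.
    have cdm x : x \in Y -> cdv N (E x) (bet q) <= m %/ bet q by move=> xY; rewrite cdv_le // divnK // hm.
    have bv : bet v = bet q.
      apply/eqP; rewrite eqn_leq Hup ?hq //=; have := hv p pY; case/orP => [h|/andP[_ /orP[h|/andP[/eqP<- _]]]].
      - have := leq_trans h (cdm v vY); rewrite ltnNge => /negP[].
        rewrite leqNgt; apply/negP => h2; have : cdv N (E p) (bet q) <= (m %/ bet q).-1 by slia.
        rewrite cdv_le ?Ep; last by slia.
        case/dvdnP: dq h2 => j ->; rewrite mulnK // leq_pmul2r //; have := m0; case: j => //= j _ _; slia.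
      - by rewrite -bp ltnW.
      - by rewrite bp.
    have Ev : E v = m.
      apply/eqP; apply: contraT => ne; have h := Kle v vY bv ne.
      have c1 : cdv N (E v) (bet q) <= (m - bet q) %/ bet q.
        by rewrite cdv_le ?divnK //; apply: leq_ltn_trans (leq_div _ _) _; slia.
      have : cdv N (E p) (bet q) <= (m - bet q) %/ bet q.
        apply: leq_trans c1; case/orP: (hv p pY) => [/ltnW//|/andP[/eqP-> _]//].
      rewrite cdv_le ?divnK // ?Ep; first by slia.
      by apply: leq_ltn_trans (leq_div _ _) _; slia.
    have wv : w v <= bet q by rewrite -bv.
    have YpX : cut a Y v t \subset X := subset_trans (cut_sub _ _ _) YX.
    have cYp := convex_cut (v := v) (t := t) cY.
    have vK : v \in layer q by rewrite layerE hq //= bv.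
    have sep x : x \in cut a Y v t -> bet x = bet q -> E x <= m - bet q.
      move=> xc bx; have xY := subsetP (cut_sub Y v t) _ xc.
      have nxv : x != v.
        move: xc; rewrite inE => /and3P[_ nvt /eqP h].
        by apply: contraNneq (ta_neq aT nvt) => xv; rewrite -h xv (ta_self aT).
      have fK z : z \in layer q -> feas E z (E z) by move=> /(subsetP (layer_X q)); apply: fE.
      rewrite -Ev -bv.
      apply: (max_separated aT cX rX b0 (layer_X q) (@layer_convex q) (@layer_bS q) fK (Y := Y :&: layer q)).
      - exact: subsetIr.
      - move=> x1 y1 z1; rewrite !in_setI => /andP[xY1 xK1] /andP[yY1 yK1] h.
        by rewrite (cY _ _ _ xY1 yY1 h) (layer_convex xK1 yK1 h).
      - by rewrite in_setI vY vK.
      - by move=> u; rewrite in_setI => /andP[uY _]; rewrite Ev hm.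
      - by rewrite in_setI xY layerE hq //= bx.
      - by [].
    have K2 c : istop (cut a Y v t) c -> bet c = bet q ->
        simc a w R k (cut a Y v t) t <= 2 * bet q + 3 * (m - bet q) + 6 * bet q.
      move=> tc bc; have [_ h] := IHk (m - bet q).
      have := h _ c YpX cYp tc; rewrite bc subnK // => /(_ dq' mN).
      have h1 u : u \in cut a Y v t -> E u <= m by move=> uc; apply: hm; apply: (subsetP (cut_sub Y v t)).
      have := pot_raw YpX cYp tc (m := m - bet q) ltac:(slia); rewrite bc => /(_ sep).
      by move=> h2 /(_ h1 sep); slia.
    case: (cut_cases t YX cY tq vY) => [->|[nvq tq' _]|[c [hc tc _]]].
    - by rewrite simc0; slia.
    - by have := K2 q tq' erefl; slia.
    - have bcv : bet c <= bet q by rewrite -bv; apply: Hup; apply: (ch_sub aT hc).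
      have [bc|bc] := eqVneq (bet c) (bet q); first by have := K2 c tc bc; slia.
      have bc2 : 2 * bet c <= bet q by apply: bet_half; rewrite ltn_neqAle bc.
      have [h _] := IHk m; have := h _ c YpX cYp tc.
      move=> /(_ (dvdn_trans (bet_dv bcv) dq) mN) /(_ (fun u uc => hm u (subsetP (cut_sub Y v t) _ uc))).
      slia.
  have hK v : v \in Y -> bet v = bet q -> E v <= m - bet q.
    move=> vY bv; apply: Kle => //; apply/eqP => Ev; apply: no; exists v.
    by rewrite vY bv Ev !eqxx.
  (* No query is spent here, only [m] drops; this is why an induction on [m] is nested inside the
     one on the fuel. *)
  have [_ h] := IHm (m - bet q) ltac:(slia).
  apply: leq_trans (h Y q YX cY tq dq' _ _ hK) _; rewrite ?subnK //.
  have := pot_raw YX cY tq (m := m - bet q) ltac:(slia) hK; slia.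
split=> // Y q YX cY tq dq mN hm hK; have [qY hq] := tq; have qX := subsetP YX _ qY.
have bq0 := b0 q.
case: (boolP [exists y in Y, m < E y]) => [/existsP[y0 /andP[y0Y Ey0]]|/existsP no]; last first.
  have := S1 Y q YX cY tq dq; rewrite -[pot _ _ + _ + _]addnA => h.
  apply: leq_trans (h _ _) (leq_addl _ _); first by slia.
  by move=> v vY; rewrite leqNgt; apply/negP => Ev; apply: no; exists v; rewrite vY.
have [vY hv] := HR YX cY tq; rewrite [simc _ _ _ _ _ _]/=.
have -> : (Y == set0) = false by apply/negbTE/set0Pn; exists q.
set v := R Y in vY hv *; have vX := subsetP YX _ vY; have vq := hq v vY.
have mdN : m %/ bet q < N by apply: leq_ltn_trans (leq_div _ _) _; slia.
have mdN' : (m %/ bet q).+1 < N.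
  apply: leq_ltn_trans mN; rewrite -{2}(divnK dq); have := leq_pmulr (m %/ bet q) bq0; slia.
have hi x : m < E x -> m %/ bet q < cdv N (E x) (bet q) by move=> h; rewrite ltnNge cdv_le // divnK // -ltnNge.
have lo x : x \in Y -> cdv N (E x) (bet q) <= (m %/ bet q).+1.
  by move=> xY; rewrite cdv_le // mulSn divnK // addnC hm.
have cdv_v : cdv N (E v) (bet q) = (m %/ bet q).+1.
  apply/eqP; rewrite eqn_leq lo //=; apply: leq_trans (hi _ Ey0) _.
  by case/orP: (hv y0 y0Y) => [/ltnW//|/andP[/eqP-> _]].
have Ev : m < E v.
  by have := cdv_le (E v) (bet q) mdN; rewrite cdv_v divnK // ltnn => h; rewrite ltnNge -h.
have vmax x : x \in Y -> m < E x -> (bet x < bet v) || ((bet x == bet v) && (E x <= E v)).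
  move=> xY Ex; have := hv x xY; rewrite /keyle cdv_v.
  have -> : cdv N (E x) (bet q) = (m %/ bet q).+1 by apply/eqP; rewrite eqn_leq lo //= hi.
  by rewrite ltnn eqxx.
have bvq : bet v < bet q.
  rewrite ltn_neqAle Hup // andbT; apply/eqP => bv; have := hK v vY bv; by rewrite leqNgt Ev.
have nvq : v != q by apply: contraTneq bvq => ->; rewrite ltnn.
(* Let [u] be the highest vertex of [Y] above [v] with the same rounded weight. It tops its set, so
   its label is the largest there and the rule would have preferred it: [v] is [u], hence a topmost
   raised vertex. *)
pose Q x := [&& x \in Y, v \in sub x & bet x == bet v].
have Qv : Q v by rewrite /Q vY eqxx (sub_refl aT vX).
have [u /and3P[uY vu /eqP bu] humax] := arg_maxnP (P := Q) (fun x => #|sub x|) Qv.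
have uX := subsetP YX _ uY.
have Qsub x y : y \in sub x -> x \in X -> x != y -> #|sub y| < #|sub x|.
  move=> yx xX nxy; apply: proper_card; apply/properP; split; first exact: (sub_sub aT).
  exists x; first exact: (sub_refl aT xX).
  by apply: contra nxy => h; apply/eqP; apply: (sub_anti aT h).
have lru : lr a rho bet u.
  rewrite /lr; have [//|nur] := eqVneq u rho; rewrite /=.
  have nuq : u != q by apply: contraTneq bvq => <-; rewrite bu ltnn.
  have pq : par u \in sub q by apply: (sub_par aT cX rX) => //; apply: hq.
  have pu := par_sub aT (rho := rho) uX.
  have pY : par u \in Y.
    by apply: (cY _ _ _ qY uY); rewrite (sub_pthE aT cX rX) ?pq ?pu ?hq.
  rewrite ltn_neqAle Hup // andbT; apply/eqP => bpu.
  have := humax (par u); rewrite /Q pY (sub_trans aT pu vu) -bpu bu eqxx => /(_ isT) /=.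
  by rewrite leqNgt Qsub ?(subsetP YX) // par_neq.
have vu' : v = u.
  apply/eqP; apply: contraT => nvu.
  have fK z : z \in layer u -> feas E z (E z) by move=> /(subsetP (layer_X u)); apply: fE.
  have vKu : v \in layer u by rewrite layerE vu bu eqxx.
  have := root_max aT cX rX b0 (@layer_convex u) (@layer_bS u) fK (layer_refl uX) lru vKu vu nvu.
  have bu0 := b0 u; have Eu0 := E0 uX => h.
  have Eu : m < E u by slia.
  have := vmax u uY Eu; rewrite bu ltnn eqxx /= => h2; slia.
have tv : topraised Y m v.
  apply/topraisedP; split=> // x xY vx nxv; rewrite leqNgt; apply/negP => Ex.
  have := vmax x xY Ex; rewrite ltnNge Hup //= => /andP[/eqP bx _].
  have := humax x; rewrite /Q xY vx bx eqxx => /(_ isT) /=.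
  by rewrite leqNgt -vu' Qsub // (subsetP YX).
have wP : w v <= pot Y m by rewrite /pot (bigD1 v) /= ?vY //= leq_addr.
have YpX : cut a Y v t \subset X := subset_trans (cut_sub _ _ _) YX.
have cYp := convex_cut (v := v) (t := t) cY.
case: (cut_cases t YX cY tq vY) => [->|[_ tq' hnv]|[c [hc tc _]]].
- by rewrite simc0; slia.
- have [_ h] := IHk m.
  have := h _ q YpX cYp tq' dq mN (fun u uc => hm u (subsetP (cut_sub Y v t) _ uc)) (fun u uc => hK u (subsetP (cut_sub Y v t) _ uc)).
  suff : w v + pot (cut a Y v t) m <= pot Y m by slia.
  rewrite /pot [leqRHS](bigD1 v) /= ?vY // leq_add2l big_mkcond [leqRHS]big_mkcond /=.
  apply: leq_sum => y _; case: ifP => // /andP[yc /topraisedP[h1 h2]].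
  have [yY nyv] := hnv y yc.
  have -> : y != v by apply: contraNneq nyv => ->; apply: (sub_refl aT vX).
  suff -> : topraised Y m y by rewrite yY.
  apply/topraisedP; split=> // x xY yx nxy; apply: h2 => //.
  move: yc; rewrite !inE => /and3P[_ nvt /eqP h3]; rewrite xY nvt -h3 side_pth //=; last first.
    by apply: contraNneq nyv => ->.
  by rewrite (sub_pthE aT cX rX v yx) (negbTE nyv) andbF.
(* Below [v] the labels are bounded only by [m + bet q]. The extra [3 * bet q] is paid by the halved
   power, and [w v] by the potential. *)
- have bcv : bet c <= bet v by apply: Hup; apply: (ch_sub aT hc).
  have bvh := bet_half bvq.
  have [h _] := IHk (m + bet q).
  have := h _ c YpX cYp tc.
  have -> : bet c %| m + bet q.
    by apply: (dvdn_trans (bet_dv (leq_trans bcv (ltnW bvq)))); rewrite dvdn_add.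
  move=> /(_ isT mN) /(_ (fun u uc => hm u (subsetP (cut_sub Y v t) _ uc))).
  slia.
Qed.

End Up.
End Cost.

(** * Labels from a decision tree *)

Section Lower.
Variables (V : finType) (a : V -> V -> V) (X : {set V}) (rho : V).
Variables (bet w : V -> nat) (N : nat).
Notation sub := (sub a X rho).
Notation ch := (ch a X rho).
Notation par := (par a rho).
Notation seen := (seen a X rho).
Notation cnt := (cnt a X rho bet).
Notation raw := (raw a X rho bet w).
Notation lr := (lr a rho bet).
Notation feas := (feas a X rho bet w N).
Hypotheses (aT : tree_answers a) (cX : convex a X) (rX : rho \in X).
Variable lv : V -> nat.
Hypothesis pw : forall v, bet v = 2 ^ lv v.
Hypothesis wb : forall v, w v <= bet v < 2 * w v.
Variable E : V -> nat.
Hypothesis gE : greedy a X rho bet w N E.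

Let b0 v : 0 < bet v. Proof. by rewrite pw expn_gt0. Qed.
Let wle v : w v <= bet v. Proof. by case/andP: (wb v). Qed.

Lemma path_below p x y z : x \in sub p -> y \in sub p -> pth a x y z -> z != x -> z != y ->
  [\/ z = p, btw a X rho p x z | btw a X rho p y z].
Proof.
move=> xp yp pz nzx nzy; have [->|nzp] := eqVneq z p; first by constructor 1.
case/orP: (pth_tri aT p pz) => h.
  by constructor 2; move: h; rewrite pthC (sub_pthE aT cX rX _ xp) /btw nzp nzx => /andP[-> ->].
by constructor 3; move: h; rewrite (sub_pthE aT cX rX _ yp) /btw nzp nzy => /andP[-> ->].
Qed.

Section Intro.
Variable S : {set V}.
Hypothesis SX : S \subset X.
Hypothesis cS : convex a S.
Hypothesis bS : forall p x, p \in S -> x \in sub p -> (bet p <= bet x) = (x \in S).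
Variable f : V -> nat.
Hypothesis sepf : forall x y t, x \in S -> y \in S -> x != y -> iv bet f x t -> iv bet f y t ->
  exists z, [/\ pth a x y z, z != x, z != y & t < f z].

(** Separation is the converse of [separated]: two intervals with a larger label in between are
    never in view together, which gives the counting demands. *)
Lemma feas_intro p : p \in S -> f p < N -> 0 < f p -> bet p %| f p ->
  (lr p -> forall x, x \in S -> x \in sub p -> x != p -> f x <= f p - bet p) ->
  (forall t, t < N -> f p <= t -> raw f p t <= (if lr p then w p else 2 * bet p)) ->
  feas f p (f p).
Proof.
move=> pS fN f0 fd hlr hraw; apply/feasP; split=> // t tN; apply/and3P; split; apply/implyP => ht.
- rewrite /Submission.cnt sum1_card; apply/eqP; apply: eq_card0 => x; apply/negbTE.
  rewrite unfold_in; apply/negP => /andP[xp /and4P[nxp bx ix /seenP sx]].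
  have xS : x \in S by rewrite -(bS pS xp).
  have [|z [pz nzp nzx tz]] := sepf pS xS _ ht ix; first by rewrite eq_sym.
  have : f z <= t; last by rewrite leqNgt tz.
  apply: sx; move: pz; rewrite (sub_pthE aT cX rX _ xp) /btw => /andP[-> ->]; by rewrite nzp nzx.
- case: (boolP (lr p)) => lp /=.
    rewrite /Submission.cnt big1 // => x /andP[xp /and4P[nxp bx ix _]].
    have xS : x \in S by rewrite -(bS pS xp).
    have := hlr lp x xS xp nxp; case/andP: ix => _ h1 h2; slia.
  rewrite /Submission.cnt sum1_card; apply/card_le1_eqP => x y.
  rewrite !unfold_in => /andP[xp /and4P[nxp bx ix /seenP sx]] /andP[yp /and4P[nyp by_ iy /seenP sy]].
  apply/eqP; apply: contraT => nxy.
  have xS : x \in S by rewrite -(bS pS xp).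
  have yS : y \in S by rewrite -(bS pS yp).
  have [z [pz nzx nzy tz]] := sepf yS xS nxy iy ix.
  suff : f z <= t by rewrite leqNgt tz.
  by case: (path_below yp xp pz nzx nzy) => [->//|/sy|/sx].
- exact: hraw.
Qed.
End Intro.

(** After a top nothing of [S] is visible. If [E u] were larger than [f u], then at time [E u - 1]
    the labelling [E] would be busy and [f] idle, against the lexicographic comparison. *)
Lemma root_le (S : {set V}) f u s : u \in S -> S \subset X -> convex a S ->
  (forall p x, p \in S -> x \in sub p -> (bet p <= bet x) = (x \in S)) ->
  lr u -> feas E u (E u) -> feas f u (f u) -> below a X rho bet w N S E f u s -> E u <= f u.
Proof.
move=> uS SX cS bS lu fEu ffu [h1 h2]; rewrite leqNgt; apply/negP => lt.
have visE g t := visE aT cX rX SX bS g t uS.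
have bu := b0 u.
have /feasP[EN E0 _ _] := fEu; have /feasP[fN f0 _ hf] := ffu.
have z t : f u <= t -> t < N -> Submission.vis a X rho bet S f u t = 0.
  move=> ft tN; have /and3P[_ + _] := hf t tN; rewrite ft lu implyTb leqn0 => /eqP c0.
  by rewrite visE c0 muln0 addn0 /iv ltnNge ft andbF.
have o : Submission.vis a X rho bet S E u (E u).-1 = 1.
  have i1 : iv bet E u (E u).-1 by rewrite /iv; slia.
  have i2 : (E u <= (E u).-1) = false by slia.
  by rewrite visE i1 i2.
have [sle|slt] := leqP s (E u).-1.
  have [] := h1 (E u).-1; first by slia.
  by rewrite o z //; slia.
have [|sN _] := h2; first by slia.
by rewrite z //; slia.
Qed.

Variables (c : V -> nat) (C2 : nat).
(** The intended [c] is twice the cost-to-go in a decision tree, and [z] is the first vertex of the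
    path that this tree queries. Doubling makes [2 * w z] exceed [bet z]. *)
Hypothesis Gv : forall x y, x \in X -> y \in X -> exists z, [/\ pth a x y z,
   (x = z \/ c x + 2 * w z <= c z) & (y = z \/ c y + 2 * w z <= c z)].
Hypothesis c_ell : forall x, x \in X -> 2 * w x <= c x.
Hypothesis cC : forall x, x \in X -> c x <= C2.

(** * Bound on the greedy labels of a down-monotonic class *)

Section DownBound.
Hypothesis Hdown : forall v x, x \in sub v -> bet v <= bet x.
Hypothesis NC : 2 * C2 + bet rho < N.

Lemma down_bound : (forall x, x \in X -> feas E x (E x)) /\ forall x, x \in X -> E x <= 2 * C2 + bet rho.
Proof.
(* This is four times the cost-to-go, rounded down to a multiple of [bet v]: the gap [4 * w z]
   exceeds [2 * bet z], so a gap of [bet z] survives rounding. The root goes above all other labels,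
   as the demands on a top require. *)
pose f v := if v \in X then (if v == rho then (2 * C2 %/ bet rho).+1 * bet rho else (2 * c v %/ bet v) * bet v) else E v.
have frho : f rho = (2 * C2 %/ bet rho).+1 * bet rho by rewrite /f rX eqxx.
have fx x : x \in X -> x != rho -> f x = (2 * c x %/ bet x) * bet x by move=> xX nx; rewrite /f xX (negbTE nx).
have bS p x : p \in X -> x \in sub p -> (bet p <= bet x) = (x \in X).
  by move=> pX xp; rewrite Hdown // (subX xp).
have lrE p : p \in X -> lr p -> p = rho.
  move=> pX /orP[/eqP //|]; rewrite ltnNge Hdown //; exact: (par_sub aT pX).
have dvb u v : bet u <= bet v -> bet u %| bet v := @bet_dv V bet lv pw u v.
have flo x : x \in X -> x != rho -> 2 * c x < f x + bet x.
  by move=> xX nx; rewrite fx // addnC -mulSn ltn_ceil.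
have fhi x : x \in X -> x != rho -> f x <= 2 * c x.
  by move=> xX nx; rewrite fx // leq_trunc_div.
have frx x : x \in X -> x != rho -> f x <= f rho - bet rho.
  move=> xX nx; rewrite frho mulSn addKn.
  have d : bet rho %| f x by rewrite fx // dvdn_mull // dvb // Hdown // sub_rho.
  rewrite -(divnK d) leq_mul2r; apply/orP; right; apply: leq_div2r.
  apply: leq_trans (fhi x xX nx) _; by rewrite leq_mul2l cC.
have sepf x y t : x \in X -> y \in X -> x != y -> iv bet f x t -> iv bet f y t ->
    exists z, [/\ pth a x y z, z != x, z != y & t < f z].
  move=> xX yX nxy ix iy.
  have nr : (x != rho) && (y != rho).
    case: (eqVneq x rho) => [xr|nx] /=.
      have nyr : y != rho by rewrite -xr eq_sym.
      have := frx y yX nyr; move: ix iy; rewrite xr /iv => /andP[i1 i2] /andP[i3 i4]; slia.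
    case: (eqVneq y rho) => [yr|//].
    have := frx x xX nx; move: ix iy; rewrite yr /iv => /andP[i1 i2] /andP[i3 i4]; slia.
  case/andP: nr => nx ny.
  have [z [pz h1 h2]] := Gv xX yX; have zX := cX xX yX pz.
  have key u v : u \in X -> v \in X -> u != rho -> v != rho -> c u + 2 * w v <= c v -> f u < f v - bet v.
    move=> uX vX nu nv h; have := fhi u uX nu; have := flo v vX nv; have /andP[_ h3] := wb v; slia.
  case/andP: ix => ix1 ix2; case/andP: iy => iy1 iy2.
  have [zx|nzx] := eqVneq z x.
    exfalso; case: h2 => [yz|h2]; first by rewrite yz zx eqxx in nxy.
    rewrite zx in h2; have := key y x yX xX ny nx h2; slia.
  have [zy|nzy] := eqVneq z y.
    exfalso; case: h1 => [xz|h1]; first by rewrite xz zy eqxx in nxy.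
    rewrite zy in h1; have := key x y xX yX nx ny h1; slia.
  have [zr|nzr] := eqVneq z rho.
    exists rho; rewrite -zr; split=> //; have := frx x xX nx; rewrite zr; have := b0 rho; slia.
  exists z; split=> //; case: h1 => [xz|h1]; first by rewrite xz eqxx in nzx.
  have := key x z xX zX nx nzr h1; slia.
have ff x : x \in X -> feas f x (f x).
  move=> xX; apply: (feas_intro bS sepf xX).
  - have [->|nx] := eqVneq x rho; first by rewrite frho mulSn; have := leq_trunc_div (2 * C2) (bet rho); slia.
    have := fhi x xX nx; have := cC xX; slia.
  - have [->|nx] := eqVneq x rho; first by rewrite frho mulSn; have := b0 rho; slia.
    have := flo x xX nx; have := c_ell xX; have /andP[_ h3] := wb x; slia.
  - have [->|nx] := eqVneq x rho; first by rewrite frho dvdn_mull.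
    by rewrite fx // dvdn_mull.
  - by move=> /(lrE _ xX) -> y yX _ ny; apply: frx.
  - move=> t tN ft; rewrite /Submission.raw big1 // => y /andP[yx /and4P[_ + _ _]].
    by rewrite ltnNge Hdown.
have fE' x : x \notin X -> f x = E x by move=> nx; rewrite /f (negbTE nx).
have dS p x : p \in X -> x \in X -> x \in sub p -> bet p %| bet x by move=> _ _ h; apply: dvb; apply: Hdown.
have [hfe [s hs]] := dominance aT cX rX (subxx X) cX bS dS b0 gE fE' rX (fun x xX _ => ff x xX).
have fEx x : x \in X -> feas E x (E x) by move=> xX; apply: hfe => //; rewrite sub_rho.
have lrr : lr rho by rewrite /lr eqxx.
split=> // x xX.
have Er : E rho <= f rho := root_le rX (subxx X) cX bS lrr (fEx _ rX) (ff _ rX) hs.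
have Ex : E x <= E rho.
  have [->//|nx] := eqVneq x rho.
  apply: leq_trans (leq_subr (bet rho) _).
  by apply: (root_max aT cX rX b0 cX bS fEx rX lrr xX _ nx); rewrite sub_rho.
apply: (leq_trans Ex); apply: (leq_trans Er); rewrite frho mulSn addnC leq_add2r leq_trunc_div //.
Qed.
End DownBound.

End Lower.

(** * Weighted centroids *)

Section Centroid.
Variables (V : finType) (a : V -> V -> V) (X : {set V}) (rho : V).
Hypotheses (aT : tree_answers a) (cX : convex a X) (rX : rho \in X).

Implicit Types Y Z : {set V}.

Definition comp (Y : {set V}) (p v : V) := [set y in Y | (v != p) && (a p y == v)].

Lemma comp_sub Y p v : comp Y p v \subset Y.
Proof. by apply/subsetP => y; rewrite inE => /andP[]. Qed.

Lemma convex_comp Y p v : convex a Y -> convex a (comp Y p v).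
Proof.
move=> cY; have [->|nvp] := eqVneq v p; first by move=> x y z; rewrite inE eqxx andbF.
have -> : comp Y p v = [set y in Y | a p y == v] by apply/setP => y; rewrite !inE nvp.
by apply: convex_side => //; rewrite eq_sym.
Qed.

Lemma comp_cut Y p x v : x \in comp Y p v -> comp Y p v = cut a Y p x.
Proof.
rewrite inE => /and3P[xY nvp /eqP e]; have npx : p != x.
  by apply: contraNneq nvp => px; rewrite -e -px (ta_self aT).
by apply/setP => y; rewrite !inE nvp npx e.
Qed.

Lemma notin_comp Y p v : p \notin comp Y p v.
Proof. by rewrite inE (ta_self aT) eq_sym andNb andbF. Qed.

Lemma mem_comp Y p y : y \in Y -> y != p -> y \in comp Y p (a p y).
Proof. by move=> yY nyp; rewrite inE yY eqxx (ta_neq aT) // eq_sym. Qed.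

(** Take a vertex with the smallest subtree among those whose subtree carries at least half of the
    weight. Components below it carry less than half by minimality, and the one above at most the
    complement. *)
Lemma centroid (Y : {set V}) (g : V -> nat) : Y \subset X -> convex a Y -> Y != set0 ->
  exists2 p, p \in Y & forall v, 2 * \sum_(x in comp Y p v) g x <= \sum_(x in Y) g x.
Proof.
move=> YX cY Y0; have [q qY hq] := top_ex aT cX rX YX cY Y0.
set W := \sum_(x in Y) g x.
pose B p := \sum_(x in Y | x \in sub a X rho p) g x.
have Bq : B q = W by rewrite /B; apply: eq_bigl => x; case: (boolP (x \in Y)) => // /hq ->.
pose Q p := (p \in Y) && (W <= 2 * B p).
have Qq : Q q by rewrite /Q qY Bq leq_pmull.
have [p /andP[pY Wp] hm] := arg_minnP (P := Q) (fun p => #|sub a X rho p|) Qq.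
exists p => // v; have [->|] := eqVneq (comp Y p v) set0; first by rewrite big_set0 muln0.
case/set0Pn => x xc; rewrite (comp_cut xc).
case: (cut_cases aT cX rX x YX cY (conj qY hq) pY) => [->|[npq [_ _] hn]|[d [hd [dc hdc] _]]].
- by rewrite big_set0 muln0.
- have : \sum_(x0 in cut a Y p x) g x0 + B p <= W.
    rewrite /W [leqRHS](bigID (fun y => y \in sub a X rho p)) /= addnC leq_add2l.
    rewrite big_mkcond [leqRHS]big_mkcond /=; apply: leq_sum => y _.
    by case: ifP => // yc; have [-> ->] := hn y yc.
  by move=> h; lia.
- have h : ~~ Q d.
    apply/negP => /hm; rewrite leqNgt => /negP; apply; exact: (sub_ch_card aT cX rX hd).
  have dY : d \in Y by move: dc; rewrite inE => /andP[].
  move: h; rewrite /Q dY /= -ltnNge => h; apply: leq_trans (ltnW h).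
  rewrite leq_mul2l /= /B big_mkcond [leqRHS]big_mkcond /=; apply: leq_sum => y _.
  case: ifP => // yc; have /= -> := hdc y yc; by move: yc; rewrite inE => /andP[->].
Qed.

End Centroid.

Lemma count_window n lo hi : \sum_(t < n) (lo < t <= hi : nat) = minn hi n.-1 - lo.
Proof.
elim: n => [|n IH]; first by rewrite big_ord0; lia.
by rewrite big_ord_recr /= IH; case: ltnP => h1; case: leqP => h2 /=; lia.
Qed.

(** * Bound on the greedy labels of an up-monotonic class *)

Section UpBound.
Variables (V : finType) (a : V -> V -> V) (X : {set V}) (rho : V).
Variables (bet w : V -> nat) (N : nat).
Notation sub := (sub a X rho).
Notation ch := (ch a X rho).
Notation par := (par a rho).
Notation seen := (seen a X rho).
Notation raw := (raw a X rho bet w).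
Notation lr := (lr a rho bet).
Notation feas := (feas a X rho bet w N).
Notation layer := (layer a X rho bet).
Notation comp := (comp a).
Hypotheses (aT : tree_answers a) (cX : convex a X) (rX : rho \in X).
Variable lv : V -> nat.
Hypothesis pw : forall v, bet v = 2 ^ lv v.
Hypothesis wb : forall v, w v <= bet v < 2 * w v.
Variable E : V -> nat.
Hypothesis gE : greedy a X rho bet w N E.
Notation pot := (pot a X rho w E).
Let b0 v : 0 < bet v. Proof. by rewrite pw expn_gt0. Qed.
Let wle v : w v <= bet v. Proof. by case/andP: (wb v). Qed.
Variables (c : V -> nat) (C2 : nat).
Hypothesis Gv : forall x y, x \in X -> y \in X -> exists z, [/\ pth a x y z,
   (x = z \/ c x + 2 * w z <= c z) & (y = z \/ c y + 2 * w z <= c z)].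
Hypothesis c_ell : forall x, x \in X -> 2 * w x <= c x.
Hypothesis cC : forall x, x \in X -> c x <= C2.
Hypothesis Hup : forall v x, x \in sub v -> bet x <= bet v.

(* The label of a decision tree places [x] on an interval of twice its weight. *)
Definition occupies (x : V) (t : nat) := c x - 2 * w x < t <= c x.
Definition occ (v : V) (t : nat) :=
  [exists x in sub v, occupies x t && [forall y, [&& y \in sub v, x \in sub y & y != x] ==> (c y < t)]].
(** The counterpart of [pot] for the decision tree: time after [m] visibly spent below [v]. The
    induction over sets of equal power proves [pot (sub u) (m + 6 * bet u) <= G u m]. *)
Definition G (v : V) (m : nat) := \sum_(t < C2.+1 | m < t) occ v t.

Lemma occP v t : reflect (exists x, [/\ x \in sub v, occupies x t &
   forall y, y \in sub v -> x \in sub y -> y != x -> c y < t]) (occ v t).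
Proof.
apply: (iffP existsP) => [[x /and3P[xv ox /forallP h]]|[x [xv ox h]]]; exists x.
  by split=> // y yv xy nyx; apply: (implyP (h y)); rewrite yv xy.
by rewrite xv ox; apply/forallP => y; apply/implyP => /and3P[]; apply: h.
Qed.

Lemma G_anti v m m' : m <= m' -> G v m' <= G v m.
Proof.
move=> h; rewrite /G big_mkcond [leqRHS]big_mkcond /=; apply: leq_sum => t _.
by case: ifP => // h2; rewrite (leq_ltn_trans h h2).
Qed.

Lemma sep_c x y t : x \in X -> y \in X -> x != y -> occupies x t -> occupies y t ->
  exists z, [/\ pth a x y z, z != x, z != y & t + 2 * w z <= c z].
Proof.
move=> xX yX nxy /andP[ox1 ox2] /andP[oy1 oy2]; have [z [pz h1 h2]] := Gv xX yX.
have [zx|nzx] := eqVneq z x.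
  exfalso; case: h2 => [yz|h2]; first by rewrite yz zx eqxx in nxy.
  by rewrite zx in h2; slia.
have [zy|nzy] := eqVneq z y.
  exfalso; case: h1 => [xz|h1]; first by rewrite xz zy eqxx in nxy.
  by rewrite zy in h1; slia.
exists z; split=> //; case: h1 => [xz|h1]; first by rewrite xz eqxx in nzx.
by slia.
Qed.

(* An occupant of a subtree hanging at [x1] is separated from an outside occupant above [x1]. *)
Lemma sep_leg x1 d y1 y2 t : d \in ch x1 -> y1 \in sub d -> occupies y1 t ->
  (forall y, y \in sub d -> y1 \in sub y -> y != y1 -> c y < t) ->
  y2 \in X -> y2 \notin sub d -> occupies y2 t ->
  exists z, [/\ pth a x1 y2 z, z != y2 & t + 2 * w z <= c z].
Proof.
move=> hd y1d o1 h1 y2X ny2 o2.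
have y1X := subX y1d; have y1x := sub_trans aT (ch_sub aT hd) y1d.
have n12 : y1 != y2 by apply: contraNneq ny2 => <-.
have [z [pz nz1 nz2 hz]] := sep_c y1X y2X n12 o1 o2.
exists z; split=> //; case/orP: (pth_tri aT x1 pz) => // h.
move: h; rewrite pthC (sub_pthE aT cX rX _ y1x) => /andP[zx y1z].
have [->|nzx] := eqVneq z x1; first exact: (pth_l aT).
have /andP[h2 h3] := child_of aT cX rX zx nzx.
have e : a x1 z = d by apply: (ch_uniq aT cX rX h2 hd (sub_trans aT h3 y1z) y1d).
rewrite e in h3; have := h1 z h3 y1z nz1; slia.
Qed.

Section Layer.
Variable u : V.
Hypothesis uX : u \in X.
Let K := layer u.
(* The legs start at the tops of the lighter subtrees hanging off the set [K] of vertices of rounded weight [bet u]. *)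
Definition isleg (d : V) := (d \in X) && ((d != rho) && (bet d < bet u)).
Definition legs (Y : {set V}) := [set d in X | isleg d && (par d \in Y)].
Definition H (Y : {set V}) (m : nat) := \sum_(d in legs Y) G d m.

Lemma legsE (Y : {set V}) d : d \in legs Y -> [/\ d \in ch (par d), par d \in Y & bet d < bet u].
Proof. by rewrite inE => /and3P[dX /and3P[_ nd bd] pY]; split=> //; rewrite inE dX nd eqxx. Qed.

Lemma ch_legs (Y : {set V}) x d : x \in Y -> d \in ch x -> bet d < bet u -> d \in legs Y.
Proof.
move=> xY hd bd; rewrite inE /isleg (ch_X hd) (ch_rho hd) bd /=; by rewrite (ch_par hd).
Qed.

Lemma legs_sub (Y Z : {set V}) : Y \subset Z -> legs Y \subset legs Z.
Proof.
by move=> YZ; apply/subsetP => d; rewrite !inE => /and3P[-> -> /(subsetP YZ) ->].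
Qed.

Lemma H_sub (Y Z : {set V}) m : Y \subset Z -> H Y m <= H Z m.
Proof.
move=> YZ; rewrite /H big_mkcond [leqRHS]big_mkcond /=; apply: leq_sum => d _.
by case: ifP => // /(subsetP (legs_sub YZ)) ->.
Qed.

Lemma H_anti (Y : {set V}) m m' : m <= m' -> H Y m' <= H Y m.
Proof. by move=> h; apply: leq_sum => d _; apply: G_anti. Qed.

Lemma H_weight (Y : {set V}) m : H Y m = \sum_(x in Y) \sum_(d | isleg d && (par d == x)) G d m.
Proof.
rewrite /H (partition_big par (fun x => x \in Y)) /=; last by move=> d /legsE[].
apply: eq_bigr => x xY; apply: eq_bigl => d; rewrite inE.
case: (eqVneq (par d) x) => [->|]; rewrite ?andbF // xY !andbT.
by rewrite /isleg; case: (d \in X).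
Qed.

(** The occupants of the two legs have a separator with a late label. Visibility inside each leg
    keeps it out of both legs, so it lies on the path between their attachment points, hence in
    [Y]. *)
Lemma legs_excl (Y : {set V}) d1 d2 t : Y \subset K -> convex a Y -> d1 \in legs Y -> d2 \in legs Y ->
  d1 != d2 -> occ d1 t -> occ d2 t -> exists2 z, z \in Y & t + 2 * w z <= c z.
Proof.
move=> YK cY hd1 hd2 nd /occP[y1 [y1d o1 h1]] /occP[y2 [y2d o2 h2]].
have [c1 p1 b1] := legsE hd1; have [c2 p2 b2] := legsE hd2.
have y2X := subX y2d; have y2x := sub_trans aT (ch_sub aT c2) y2d.
have ny : y2 \notin sub d1.
  apply/negP => h; case/orP: (sub_chain aT cX rX h y2d) => h3.
    have nd' : d2 != d1 by rewrite eq_sym.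
    have h4 := sub_par aT cX rX (ch_rho c2) h3 nd'.
    have e1 : par d2 \in layer u by apply: (subsetP YK).
    move: e1; rewrite layerE => /andP[_ /eqP e1]; have := Hup h4; rewrite e1; slia.
  have h4 := sub_par aT cX rX (ch_rho c1) h3 nd.
  have e1 : par d1 \in layer u by apply: (subsetP YK).
  move: e1; rewrite layerE => /andP[_ /eqP e1]; have := Hup h4; rewrite e1; slia.
have [z [pz nz hz]] := sep_leg c1 y1d o1 h1 y2X ny o2.
exists z => //; case/orP: (pth_tri aT (par d2) pz) => h; first exact: (cY _ _ _ p1 p2 h).
move: h; rewrite (sub_pthE aT cX rX _ y2x) => /andP[zx y2z].
have [->//|nzx] := eqVneq z (par d2).
have /andP[h4 h3] := child_of aT cX rX zx nzx.
have e : a (par d2) z = d2 by apply: (ch_uniq aT cX rX h4 c2 (sub_trans aT h3 y2z) y2d).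
rewrite e in h3; have := h2 z h3 y2z nz; slia.
Qed.

(** If [p] were busy as well, [sep_leg] would give another vertex [z] of [Y] with [c z] beyond [t].
    But [c p] is the maximum, so [c z] is at most [c p - 2 * w p], which is below [t]. *)
Lemma leg_free (Y : {set V}) d p t : Y \subset K -> convex a Y -> d \in legs Y -> p \in Y ->
  (forall q, q \in Y -> c q <= c p) -> occ d t -> ~~ occupies p t.
Proof.
move=> YK cY hd pY hp /occP[y1 [y1d o1 h1]]; apply/negP => op.
have [c1 p1 b1] := legsE hd.
have pK : p \in layer u by apply: (subsetP YK).
have pX : p \in X by exact: (subsetP (layer_X a X rho bet u) _ pK).
have np : p \notin sub d.
  apply/negP => /Hup; move: pK; rewrite layerE => /andP[_ /eqP ->]; slia.
have [z [pz nz hz]] := sep_leg c1 y1d o1 h1 pX np op.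
have := hp z (cY _ _ _ p1 pY pz).
have [z2 [pz2 e1 e2]] := Gv (subsetP (layer_X a X rho bet u) _ (subsetP YK _ (cY _ _ _ p1 pY pz))) pX.
case/andP: op => op1 op2 h.
have z2Y : z2 \in Y by apply: (cY z p) => //; apply: cY pz.
have := hp z2 z2Y; have := wb z2; case: e2 => [e2|e2]; last by slia.
subst z2; case: e1 => [e1|e1]; first by rewrite e1 eqxx in nz.
by slia.
Qed.

(** Each time in the window [(al', al]] is used by at most one leg, since a second would need a
    vertex of [Y] with [c] beyond [al' + bet u]. Up to [c p] no leg is in view, because [p] itself
    is busy. *)
Lemma inflow (Y : {set V}) p al al' : Y \subset K -> convex a Y -> p \in Y ->
  (forall q, q \in Y -> c q <= c p) -> al' <= al -> c p <= al -> c p <= al' + bet u ->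
  H Y al' <= H Y al + (al - maxn al' (c p)).
Proof.
move=> YK cY pY hp alal cpal cpal'.
pose F t := \sum_(d in legs Y) (occ d t : nat).
have HE m : H Y m = \sum_(t < C2.+1 | m < t) F t by rewrite /H /G exchange_big.
have bk q : q \in Y -> bet q = bet u by move/(subsetP YK); rewrite layerE => /andP[_ /eqP].
have FE t : F t = #|[set d in legs Y | occ d t]|.
  by rewrite /F -big_mkcondr -sum1_card; apply: eq_bigl => d; rewrite [RHS]in_set.
have F1 t : al' < t -> F t <= 1.
  move=> ht; rewrite FE; apply/card_le1_eqP => d1 d2.
  rewrite !in_set => /andP[h1 o1] /andP[h2 o2]; apply/eqP; apply: contraT => nd.
  have h1' : d1 \in legs Y by rewrite in_set.
  have h2' : d2 \in legs Y by rewrite in_set.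
  have nd' : d1 != d2 by rewrite eq_sym.
  have [z zY hz] := legs_excl YK cY h1' h2' nd' o1 o2.
  have := hp z zY; have := wb z; rewrite bk // => /andP[_ hw] hz'; slia.
have F0 t : al' < t -> t <= c p -> F t = 0.
  move=> ht1 ht2; rewrite FE; apply/eqP; rewrite cards_eq0; apply/eqP/setP => d.
  rewrite !in_set; apply/negbTE/negP => /andP[hd od].
  have hd' : d \in legs Y by rewrite in_set.
  have /negP := leg_free YK cY hd' pY hp od; apply; rewrite /occupies ht2 andbT.
  have := wb p; rewrite bk // => /andP[_ hw]; slia.
have cntle n m b : \sum_(t < n) (m < t <= b : nat) <= minn b n.-1 - m.
  elim: n => [|n IH]; first by rewrite big_ord0.
  rewrite big_ord_recr /=; case: (boolP (m < n <= b)) => h; last by rewrite addn0; apply: leq_trans IH _; slia.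
  by rewrite -[nat_of_bool true]/1; apply: leq_trans (leq_add IH (leqnn 1)) _; slia.
rewrite !HE (bigID (fun t : 'I_C2.+1 => al < t)) /=; apply: leq_add.
  rewrite big_mkcond [leqRHS]big_mkcond /=; apply: leq_sum => t _.
  by case: (al < t); rewrite ?andbF // andbT (leq_trans _ (leqnn _)) //; case: ifP.
apply: leq_trans (_ : \sum_(t < C2.+1) (maxn al' (c p) < t <= al : nat) <= _); last first.
  by apply: leq_trans (cntle _ _ _) _; slia.
rewrite big_mkcond /=; apply: leq_sum => t _; case: ifP => // /andP[h1 h2].
rewrite -leqNgt in h2; rewrite h2 andbT gtn_max h1 /=.
by case: (ltnP (c p) t) => h3; [exact: F1 | rewrite F0].
Qed.

(* Top-down construction of slots: in each block follow [c] if it has a vertex of the layer there,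
   and otherwise split the hanging subtrees that [c] has already visited at a centroid. *)
Lemma build z (Y : {set V}) al : Y \subset K -> convex a Y -> al <= z * bet u -> z * bet u < al + bet u ->
  (forall p, p \in Y -> c p <= al) -> H Y al <= bet u + (z * bet u - al) ->
  exists s : V -> nat, [/\ forall p, p \in Y -> 0 < s p <= z,
    forall p q, p \in Y -> q \in Y -> p != q -> s p = s q -> exists2 r, pth a p q r & s p < s r &
    forall i p, 0 < i <= z -> p \in Y ->
      H [set x in Y | [forall r, pth a p x r ==> (s r < i)]] (i.-1 * bet u) <= 2 * bet u].
Proof.
elim: z Y al => [|z IH] Y al YK cY h1 h2 hc hH.
  exists (fun=> 0); suff Y0 p : p \notin Y by split=> [p pY|p q pY|i p _ pY]; case/negP: (Y0 p).
  apply/negP => pY; have := hc p pY; have pX := subsetP (layer_X a X rho bet u) _ (subsetP YK _ pY).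
  have := c_ell pX; have := wb p; have := b0 p; slia.
have [Y0|Y0] := eqVneq Y set0.
  exists (fun=> 0); rewrite Y0; split=> [p|p q|i p _]; by rewrite inE.
have [p0 p0Y hp0] : exists2 p0, p0 \in Y & forall q, q \in Y -> c q <= c p0.
  by case/set0Pn: Y0 => y yY; have [p0 h3 h4] := arg_maxnP (P := fun p => p \in Y) c yY; exists p0.
have bk q : q \in Y -> bet q = bet u by move/(subsetP YK); rewrite layerE => /andP[_ /eqP].
have YX : Y \subset X := subset_trans YK (layer_X a X rho bet u).
have bu0 := b0 u.
have [p [al' [pY a1 a2 hcq hHq]]] : exists p al', [/\ p \in Y, al' <= z * bet u, z * bet u < al' + bet u,
    (forall v q, q \in comp Y p v -> c q <= al') &
    (forall v, H (comp Y p v) al' <= bet u + (z * bet u - al'))].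
  (* If no vertex of [Y] has its [c] in the present block, [H] has grown to at most [2 * bet u] at
     the start of the block. Removing a centroid halves it and restores the budget. *)
  case: (leqP (c p0) (z * bet u)) => cp.
    pose g x := \sum_(d | isleg d && (par d == x)) G d (z * bet u).
    have [p pY hp] := centroid aT cX rX g YX cY Y0.
    exists p, (z * bet u); split=> //; first by slia.
      by move=> v q /(subsetP (comp_sub a Y p v)) qY; apply: leq_trans (hp0 q qY) cp.
    move=> v; have := hp v; rewrite -!H_weight.
    have := inflow (al := al) (al' := z * bet u) YK cY p0Y hp0; rewrite mulSn in h1 h2 hH.
    move=> h3 h4; have := h3 ltac:(slia) (hc p0 p0Y) ltac:(slia).
    by slia.
  have p0X := subsetP YX _ p0Y; have cl := c_ell p0X; have /andP[_ wp] := wb p0; rewrite bk // in wp.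
  (* [p0] takes the slot. Since [2 * w p0] exceeds [bet u], all other values of [c] are at most
     [c p0 - bet u], and no leg comes into view in that last stretch of length [bet u]; so the
     budget shifts along with [al]. *)
  exists p0, (c p0 - bet u); split=> //.
  - by have := hc p0 p0Y; rewrite mulSn in h1; slia.
  - by slia.
  - move=> v q qc; have qY := subsetP (comp_sub a Y p0 v) _ qc.
    have nq : q != p0 by apply: contraTneq qc => ->; apply: (notin_comp aT).
    have [z2 [pz e1 e2]] := Gv (subsetP YX _ qY) p0X.
    have := hp0 z2 (cY _ _ _ qY p0Y pz); have := wb z2; rewrite (bk z2 (cY _ _ _ qY p0Y pz)) => wz hz2.
    case: e2 => [e2|e2]; last by slia.
    by subst z2; case: e1 => [e1|e1]; [rewrite e1 eqxx in nq | slia].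
  - move=> v; apply: leq_trans (H_sub _ (comp_sub a Y p0 v)) _.
    have := inflow (al := al) (al' := c p0 - bet u) YK cY p0Y hp0.
    have := hc p0 p0Y; rewrite mulSn in h1 h2 hH; move=> h3 h4; have := h4 ltac:(slia) h3 ltac:(slia); slia.
have step v : exists sv : V -> nat,
    [/\ forall p1, p1 \in comp Y p v -> 0 < sv p1 <= z,
    forall p1 q, p1 \in comp Y p v -> q \in comp Y p v -> p1 != q -> sv p1 = sv q ->
      exists2 r, pth a p1 q r & sv p1 < sv r &
    forall i p1, 0 < i <= z -> p1 \in comp Y p v ->
      H [set x in comp Y p v | [forall r, pth a p1 x r ==> (sv r < i)]] (i.-1 * bet u) <= 2 * bet u].
  apply: (IH _ al') => //; [exact: subset_trans (comp_sub _ _ _ _) YK | exact: (convex_comp aT) | exact: hcq].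
have [S hS] := fin_all_exists step.
pose s x := if x == p then z.+1 else S (a p x) x.
have sp : s p = z.+1 by rewrite /s eqxx.
have sc v x : x \in comp Y p v -> s x = S v x.
  move=> xc; have nx : x != p by apply: contraTneq xc => ->; apply: (notin_comp aT).
  by move: xc; rewrite inE /s (negbTE nx) => /and3P[_ _ /eqP ->].
have slt x : x \in Y -> x != p -> 0 < s x <= z.
  move=> xY nx; have xc := mem_comp aT xY nx; rewrite (sc _ _ xc); by have [h3 _ _] := hS (a p x); apply: h3.
exists s; split.
- move=> x xY; have [->|nx] := eqVneq x p; first by rewrite sp ltnSn.
  by have /andP[-> h3] := slt x xY nx; rewrite leqW.
- move=> x y xY yY nxy exy.
  have [xp|nxp] := eqVneq x p.
    by have := slt y yY ltac:(by rewrite -xp eq_sym); rewrite -exy xp sp ltnn andbF.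
  have [yp|nyp] := eqVneq y p.
    by have := slt x xY nxp; rewrite exy yp sp ltnn andbF.
  have [eq|ne] := eqVneq (a p x) (a p y); last first.
    exists p; first by rewrite /pth ne.
    by rewrite sp ltnS; case/andP: (slt x xY nxp).
  have xc := mem_comp aT xY nxp; have yc := mem_comp aT yY nyp; rewrite -eq in yc.
  have [_ h3 _] := hS (a p x); rewrite (sc _ _ xc) (sc _ _ yc) in exy.
  have [r pr hr] := h3 x y xc yc nxy exy; exists r => //.
  by rewrite (sc _ _ xc) (sc _ _ (convex_comp aT cY xc yc pr)).
- move=> i x /andP[i0 iz] xY.
  have [xp|nxp] := eqVneq x p.
    have -> : [set x0 in Y | [forall r, pth a x x0 r ==> (s r < i)]] = set0; last first.
      by rewrite /H big1 // => d; rewrite !inE !andbF.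
    apply/setP => y; rewrite !inE; apply/negP => /andP[_ /forallP/(_ p)]; rewrite xp (pth_l aT) sp /=.
    by rewrite ltnNge iz.
  set Z := [set x0 in Y | _].
  have Zc : Z \subset comp Y p (a p x).
    apply/subsetP => y; rewrite inE => /andP[yY /forallP hy].
    have np : ~~ pth a x y p by apply/negP => h; have := hy p; rewrite h sp /= ltnNge iz.
    have npx : p != x by rewrite eq_sym.
    by rewrite inE yY (ta_neq aT npx) eq_sym side_pth.
  have xc := mem_comp aT xY nxp.
  move: iz; rewrite leq_eqVlt => /orP[/eqP ->|]; last rewrite ltnS => iz.
    apply: leq_trans (H_sub _ Zc) _; apply: leq_trans (H_anti _ a1) _; have := hHq (a p x); slia.
  have [_ _ h3] := hS (a p x).
  apply: leq_trans (h3 i x _ xc); last by rewrite i0.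
  apply: H_sub; apply/subsetP => y yZ; have yc := subsetP Zc _ yZ.
  rewrite inE yc /=; apply/forallP => r; apply/implyP => pr.
  rewrite -(sc _ _ (convex_comp aT cY xc yc pr)).
  by move: yZ; rewrite inE => /andP[_ /forallP/(_ r)]; rewrite pr.
Qed.

Lemma K_X x : x \in K -> x \in X. Proof. exact: (subsetP (layer_X a X rho bet u)). Qed.
Lemma K_bet x : x \in K -> bet x = bet u. Proof. by rewrite layerE => /andP[_ /eqP]. Qed.
Lemma K_sub x : x \in K -> x \in sub u. Proof. by rewrite layerE => /andP[]. Qed.
Let cK : convex a K := layer_convex aT cX rX Hup (q := u).
Let bK p x : p \in K -> x \in sub p -> (bet p <= bet x) = (x \in K).
Proof. exact: (layer_bS aT Hup). Qed.
Let uK : u \in K. Proof. exact: (layer_refl rho bet aT uX). Qed.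

Lemma max_gap (Y : {set V}) p q : Y \subset K -> convex a Y -> p \in Y -> (forall q, q \in Y -> c q <= c p) ->
  q \in Y -> q != p -> c q + 2 * w p <= c p.
Proof.
move=> YK cY pY hp qY nqp; have YX := subset_trans YK (layer_X a X rho bet u).
have [z [pz e1 e2]] := Gv (subsetP YX _ qY) (subsetP YX _ pY).
have := hp z (cY _ _ _ qY pY pz); have := wb z; case: e2 => [e2|e2]; last by slia.
by subst z; case: e1 => [e1|//]; rewrite e1 eqxx in nqp.
Qed.

Lemma leg_lr d : d \in legs K -> [/\ lr d, d \in sub u, d != u, d \in X & 2 * bet d <= bet u].
Proof.
move=> hd; have [h1 h2 h3] := legsE hd; split; last exact: (bet_half pw h3).
- by rewrite /lr (K_bet h2) h3 orbT.
- exact: (sub_trans aT (K_sub h2) (ch_sub aT h1)).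
- by apply: contraTneq h3 => ->; rewrite ltnn.
- exact: ch_X h1.
Qed.

Lemma lit_leg p d f t : p \in K -> d \in ch p -> bet d < bet u -> (forall x, x \notin K -> f x = E x) ->
  lit a X rho w K f d t = pot (sub d) t.
Proof.
move=> pK hd bd fE; have ndK : d \notin K by rewrite layerE negb_and (ltn_eqF bd) orbT.
have nK x : x \in sub d -> x \notin K := notin_S_sub aT cX rX cK hd pK ndK.
apply: eq_bigl => x; case: (boolP (x \in sub d)) => //= xd; rewrite nK // fE ?nK //=.
rewrite /topraised; congr (_ && _); apply/seenIP/forall_inP => h z.
  by move=> zd; apply/implyP => /andP[xz nxz]; rewrite -fE ?nK //; apply: h => //.
by move=> zd xz nzx; rewrite fE ?nK //; apply: (implyP (h z zd)); rewrite xz.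
Qed.

Definition vis_layer (f : V -> nat) (p : V) (t : nat) :=
  [set x in K | (x \in sub p) && [forall z, [&& z \in sub p, x \in sub z & z != p] ==> (f z <= t)]].

(** The light weight in view is collected leg by leg: it is reached only through vertices of [K]
    whose labels have passed. *)
Lemma raw_legs f p t : p \in K -> (forall x, x \notin K -> f x = E x) ->
  raw f p t <= \sum_(d in legs (vis_layer f p t)) pot (sub d) t.
Proof.
move=> pK0 fE; have := K_X pK0; move: p pK0 => p0 pK0 pX0; move: p0 pX0 pK0; apply: (sub_ind aT cX rX) => p pX IH pK.
rewrite (rawE w aT cX rX (layer_X a X rho bet u) bK f t pK).
have e : \sum_(d in legs (vis_layer f p t)) pot (sub d) t =
         \sum_(d in sub p | d \in legs (vis_layer f p t)) pot (sub d) t.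
  apply: eq_bigl => d; case: (boolP (d \in legs _)); rewrite ?andbF // => hd.
  have [h1 h2 _] := legsE hd; have h3 : par d \in sub p by move: h2; rewrite in_set => /and3P[].
  by rewrite (sub_trans aT h3 (ch_sub aT h1)).
rewrite e (big_sub aT cX rX _ _ pX); apply: leq_trans (leq_addl _ _).
apply: leq_sum => d hd.
have pV : p \in vis_layer f p t.
  rewrite in_set pK (sub_refl aT pX) /=; apply/forallP => z; apply/implyP => /and3P[zp pz].
  by rewrite (sub_anti aT zp pz) eqxx.
case: (boolP (d \in K)) => dK; last first.
  have bd : bet d < bet u.
    move: dK; rewrite layerE (sub_trans aT (K_sub pK) (ch_sub aT hd)) /= => nb.
    by rewrite ltn_neqAle nb Hup // (sub_trans aT (K_sub pK) (ch_sub aT hd)).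
  have dl := ch_legs pV hd bd.
  rewrite (lit_leg _ pK hd bd fE) (bigD1 d) /=; first by rewrite leq_addr.
  by rewrite dl (sub_refl aT (ch_X hd)).
rewrite (litE w aT cX rX (layer_X a X rho bet u) bK f t dK).
case: (leqP (f d) t) => ft; rewrite ?mul0n // mul1n.
apply: leq_trans (IH d hd dK) _.
rewrite big_mkcond [leqRHS]big_mkcond /=; apply: leq_sum => y _; case: ifP => // yl.
have [h1 h2 h3] := legsE yl; move: (h2); rewrite in_set => /and3P[h4 h5 /forallP h6].
rewrite (sub_trans aT h5 (ch_sub aT h1)) /= (ch_legs _ h1 h3) // in_set h4 (sub_trans aT (ch_sub aT hd) h5) /=.
apply/forallP => z; apply/implyP => /and3P[zp yz nzp].
have /andP[h7 h8] := child_of aT cX rX zp nzp.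
have ez : a p z = d by apply: (ch_uniq aT cX rX h7 hd (sub_trans aT h8 yz) h5).
rewrite ez in h8; have [->//|nzd] := eqVneq z d; by apply: (implyP (h6 z)); rewrite h8 yz.
Qed.

(** While [E u] exceeds [t], [u] itself is the only topmost raised vertex. Afterwards everything
    raised is visible from [u], and the third demand for a top applies. *)
Lemma pot_root t : t < N -> lr u -> feas E u (E u) -> (forall x, x \in K -> x != u -> E x <= E u) ->
  pot (sub u) t <= w u /\ (E u <= t -> pot (sub u) t <= raw E u t).
Proof.
move=> tN lu /feasP[_ _ _ /(_ t tN)] ho hK0.
have h2 : E u <= t -> (forall x, x \in K -> x != u -> E x <= t) -> pot (sub u) t <= raw E u t.
  move=> Eu hK; rewrite /Submission.pot /Submission.raw big_mkcond [leqRHS]big_mkcond /=; apply: leq_sum => y _.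
  case: ifP => // /andP[yu /topraisedP[h3 h4]]; rewrite yu h3 /=.
  have nyu : y != u by apply: contraTneq h3 => ->; rewrite -leqNgt.
  have bu : bet y < bet u.
    rewrite ltn_neqAle Hup // andbT; apply/negP => b; have yK : y \in K by rewrite layerE yu.
    by have := hK y yK nyu; rewrite leqNgt h3.
  rewrite nyu bu /=; suff -> : seen E u y t by [].
  by apply/seenP => z /and4P[zu yz nzu nzy]; apply: h4.
case: (leqP (E u) t) => Eu.
  move: ho; rewrite /okt Eu !implyTb lu => /and3P[_ c0 r0].
  have hK x : x \in K -> x != u -> E x <= t.
    by move=> xK nxu; apply: leq_trans (hK0 x xK nxu) Eu.
  split; [apply: leq_trans r0; exact: h2 | by move=> _; apply: h2].
split=> //; rewrite /Submission.pot (bigD1 u) /=; last first.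
  rewrite (sub_refl aT uX) /=; apply/topraisedP; split=> // x xu ux nxu.
  by rewrite (sub_anti aT xu ux) eqxx in nxu.
rewrite big1 ?addn0 // => y /andP[/andP[yu /topraisedP[_ h4]] nyu].
have := h4 u (sub_refl aT uX) yu; rewrite eq_sym nyu => /(_ isT); by rewrite leqNgt Eu.
Qed.

(** The slots of [build] make a feasible labelling, and dominance carries its bound over to [E u].
    Of the five blocks beyond [m1], three are a shift, one is for [u] on top of all slots, and one
    comes from rounding [m1] up. The bound on [H K m1] fits the light weight after [u] into the
    limit [w u]. *)
Lemma base m1 : lr u -> (forall x, x \in K -> c x <= m1) -> H K m1 < w u -> m1 + 5 * bet u < N ->
  (forall d, d \in sub u -> d != u -> lr d -> forall m, m + 6 * bet d < N -> pot (sub d) (m + 6 * bet d) <= G d m) ->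
  (forall x, x \in K -> feas E x (E x)) /\ E u <= m1 + 5 * bet u.
Proof.
move=> lu hm1 hH hN IH; have bu0 := b0 u.
pose Z := (m1 + (bet u).-1) %/ bet u.
have Z1 : m1 <= Z * bet u.
  have := ltn_ceil (m1 + (bet u).-1) bu0; rewrite -/Z mulSn; slia.
have Z2 : Z * bet u < m1 + bet u.
  have := leq_trunc_div (m1 + (bet u).-1) (bet u); rewrite -/Z; slia.
have wu := wle u.
have [s [P1 P2 P3]] := build (subxx K) cK Z1 Z2 hm1 ltac:(slia).
(* The shift by three blocks absorbs the delay in the claim for a leg [d]: it is [6 * bet d], at
   most [3 * bet u]. *)
pose f x := if x \in K then (if x == u then (4 + Z) * bet u else (3 + s x) * bet u) else E x.
have fu : f u = (4 + Z) * bet u by rewrite /f uK eqxx.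
have fx x : x \in K -> x != u -> f x = (3 + s x) * bet u by move=> xK nx; rewrite /f xK (negbTE nx).
have fuK x : x \in K -> x != u -> f x + bet u <= f u.
  move=> xK nx; rewrite fx // fu addnC -mulSn leq_mul2r; case/andP: (P1 x xK) => _ h; apply/orP; right; slia.
have fge x : x \in K -> 4 * bet u <= f x.
  move=> xK; have [->|nx] := eqVneq x u; first by rewrite fu leq_mul2r; apply/orP; right; slia.
  rewrite fx // leq_mul2r; case/andP: (P1 x xK) => h _; apply/orP; right; slia.
have fun_ : f u <= m1 + 5 * bet u by rewrite fu mulnDl; slia.
have lrK p : p \in K -> lr p -> p = u.
  move=> pK lp; apply/eqP; apply: contraT => npu; have pu := K_sub pK.
  case/orP: lp => [/eqP pr|].
    by move: npu; rewrite (sub_anti aT pu) ?eqxx // pr sub_rho.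
  have [pr|npr] := eqVneq p rho.
    by move: npu; rewrite (sub_anti aT pu) ?eqxx // pr sub_rho.
  by rewrite ltnNge (K_bet pK) Hup // (sub_par aT cX rX).
have sepf x y t : x \in K -> y \in K -> x != y -> iv bet f x t -> iv bet f y t ->
    exists z, [/\ pth a x y z, z != x, z != y & t < f z].
  move=> xK yK nxy; rewrite /iv (K_bet xK) (K_bet yK) => /andP[x1 x2] /andP[y1 y2].
  have [xu|nxu] := eqVneq x u.
    have nyu : y != u by rewrite -xu eq_sym.
    have := fuK y yK nyu; rewrite xu in x1 x2; slia.
  have [yu|nyu] := eqVneq y u.
    have := fuK x xK nxu; rewrite yu in y1 y2; slia.
  have sxy : s x = s y.
    move: x1 x2 y1 y2; rewrite !fx // => x1 x2 y1 y2; apply/eqP; rewrite eqn_leq; apply/andP; split;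
    rewrite -ltnS -[_ < _](ltn_add2l 3) addnS -(ltn_pmul2r bu0) mulSn; slia.
  have [r pr hr] := P2 x y xK yK nxy sxy; have rK := cK xK yK pr.
  exists r; split=> //.
  - by apply: contraTneq hr => ->; rewrite ltnn.
  - by apply: contraTneq hr => ->; rewrite sxy ltnn.
  - have [ru|nru] := eqVneq r u; first by have := fuK x xK nxu; rewrite ru; slia.
    apply: leq_trans x2 _; rewrite !fx // leq_mul2r; apply/orP; right; slia.
have fE x : x \notin K -> f x = E x by move=> nx; rewrite /f (negbTE nx).
have rawG p t : p \in K -> t < N -> f p <= t -> raw f p t <= H (vis_layer f p t) (t - 3 * bet u).
  move=> pK tN ft; apply: leq_trans (raw_legs t pK fE) _; apply: leq_sum => d hd.
  have dK : d \in legs K.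
    by apply: (subsetP (legs_sub _) _ hd); apply/subsetP => x; rewrite in_set => /andP[].
  have [ld du ndu dX bd] := leg_lr dK; have ft' := fge p pK.
  have := IH d du ndu ld (t - 6 * bet d); rewrite subnK; last by slia.
  move=> /(_ tN) h; apply: leq_trans h _; apply: G_anti; slia.
have ff p : p \in K -> feas f p (f p).
  move=> pK; have fp := fge p pK; apply: (feas_intro aT cX rX bK sepf pK).
  - have [->|np] := eqVneq p u; first by slia.
    by have := fuK p pK np; slia.
  - by slia.
  - by rewrite (K_bet pK); have [->|np] := eqVneq p u; rewrite ?fu ?fx // dvdn_mull.
  - move=> lp x xK xp nxp; have pu := lrK p pK lp; rewrite pu in nxp *.
    have := fuK x xK nxp; slia.
  - move=> t tN ft; apply: leq_trans (rawG p t pK tN ft) _.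
    have hi : m1 <= t - 3 * bet u -> H (vis_layer f p t) (t - 3 * bet u) <= w u.
      move=> h; apply: ltnW; apply: leq_ltn_trans hH.
      apply: leq_trans (H_anti _ h) _; apply: H_sub; apply/subsetP => x; by rewrite in_set => /andP[].
    have [pu|np] := eqVneq p u.
      by move: hi ft; rewrite pu lu fu mulnDl => hi ft; apply: hi; slia.
    have -> : lr p = false by apply/negP => /(lrK p pK) e; rewrite e eqxx in np.
    rewrite (K_bet pK); case: (leqP (Z * bet u) (t - 3 * bet u)) => hz.
      by have := hi ltac:(slia); slia.
    (* Time [t] lies in block [j], and slots passed by then are at most [j - 3]. So the block bound
       of [build] is used with [i = j - 2]. *)
    pose j := t %/ bet u.
    have j1 : j * bet u <= t by apply: leq_trunc_div.
    have j2 : t < j.+1 * bet u by apply: ltn_ceil.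
    have jp x : x \in K -> x != u -> f x <= t -> 3 + s x <= j.
      by move=> xK nx; rewrite fx // => h; rewrite -ltnS -(ltn_pmul2r bu0); apply: leq_ltn_trans j2.
    have jz : j < 3 + Z.
      rewrite -(ltn_pmul2r bu0); apply: leq_ltn_trans j1 _; rewrite mulnDl; slia.
    have j4 := jp p pK np ft; have /andP[sp1 _] := P1 p pK.
    have := P3 (j - 2) p ltac:(slia) pK.
    apply: leq_trans; apply: leq_trans (H_anti _ (_ : (j - 2).-1 * bet u <= _)) (H_sub _ _).
      have -> : (j - 2).-1 = j - 3 by slia.
      by rewrite mulnBl leq_sub2r.
    apply/subsetP => x xv; rewrite in_set; move: xv; rewrite {1}in_set => /and3P[xK xp /forallP hv].
    rewrite xK /=; apply/forallP => r; apply/implyP; rewrite (sub_pthE aT cX rX _ xp) => /andP[rp xr].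
    have pu := K_sub pK; have rK : r \in K by apply: (cK pK xK); rewrite (sub_pthE aT cX rX _ xp) rp.
    have nru : r != u by apply: contraNneq np => ru; rewrite ru in rp; rewrite (sub_anti aT rp pu).
    have fr : f r <= t.
      have [->//|nrp] := eqVneq r p; by apply: (implyP (hv r)); rewrite rp xr.
    have := jp r rK nru fr; slia.
have dS p x : p \in K -> x \in K -> x \in sub p -> bet p %| bet x.
  by move=> /K_bet -> /K_bet ->.
have [hfe [s0 hs]] := dominance aT cX rX (layer_X a X rho bet u) cK bK dS b0 gE fE uK (fun x xK _ => ff x xK).
have fEx x : x \in K -> feas E x (E x) by move=> xK; apply: hfe => //; apply: K_sub.
split=> //; apply: leq_trans fun_.
exact: (root_le aT cX rX pw uK (layer_X a X rho bet u) cK bK lu (fEx _ uK) (ff _ uK) hs).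
Qed.

(** After [m] at most one leg is in view at a time, and its occupant is visible from [u] too, as all
    vertices of [K] have smaller [c]. *)
Lemma H_occ m : (forall x, x \in K -> c x <= m) -> H K m <= G u m.
Proof.
move=> hm; rewrite /H /G exchange_big /=; apply: leq_sum => t mt.
have -> : \sum_(d in legs K) (occ d t : nat) = #|[set d in legs K | occ d t]|.
  by rewrite -big_mkcondr -sum1_card; apply: eq_bigl => d; rewrite [RHS]in_set.
have c1 : #|[set d in legs K | occ d t]| <= 1.
  apply/card_le1_eqP => d1 d2.
  rewrite {1}in_set => /andP[h1' o1]; rewrite {1}in_set => /andP[h2' o2]; apply/eqP; apply: contraT => nd.
  have nd' : d1 != d2 by rewrite eq_sym.
  have [z zK hz] := legs_excl (subxx K) cK h1' h2' nd' o1 o2.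
  have := hm z zK; slia.
case: (set_0Vmem [set d in legs K | occ d t]) => [->|[d]]; first by rewrite cards0.
rewrite {1}in_set => /andP[hd /occP[y1 [y1d o1 h1]]].
have [hd1 hd2 hd3] := legsE hd; have [_ du _ _ _] := leg_lr hd.
suff -> : occ u t by [].
apply/occP; exists y1; split=> //; first exact: (sub_trans aT du y1d).
move=> y yu y1y ny1; case: (boolP (y \in sub d)) => yd; first exact: h1.
case/orP: (sub_chain aT cX rX y1d y1y) => h; first by rewrite h in yd.
have ndy : d != y by apply: contraNneq yd => <-; apply: (sub_refl aT (subX' cX rX y1d)).
have py := sub_par aT cX rX (ch_rho hd1) h ndy.
suff yK : y \in K by apply: leq_ltn_trans (hm y yK) mt.
by rewrite layerE yu eqn_leq Hup //= -(K_bet hd2) Hup.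
Qed.

Lemma occ_max p m : p \in K -> (forall q, q \in K -> c q <= c p) -> m + bet u <= c p -> bet u <= G u m.
Proof.
move=> pK hp hm; have cp := cC (K_X pK); have wp := wb p; rewrite (K_bet pK) in wp.
have oc t : c p - bet u < t <= c p -> occ u t.
  move=> /andP[t1 t2]; apply/occP; exists p; split; first exact: K_sub.
    by rewrite /occupies t2 andbT; slia.
  move=> y yu py nyp; have yK : y \in K by rewrite layerE yu eqn_leq Hup //= -(K_bet pK) Hup.
  have := max_gap (subxx K) cK pK hp yK nyp; slia.
apply: (@leq_trans (\sum_(t < C2.+1) (c p - bet u < t <= c p : nat))).
  by rewrite count_window /=; slia.
rewrite /G [leqRHS]big_mkcond /=; apply: leq_sum => t _.
case: (boolP (_ < t <= _)) => // h; have := oc t h => -> /=.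
by rewrite ifT //; slia.
Qed.

Hypothesis NC : forall v, C2 + 6 * bet v < N.

(** If some [c] on [K] reaches [m + bet u], or if [H K (m + bet u)] is at least [w u], then [G u m]
    covers [w u], which bounds [pot]. Otherwise [base] with [m1 = m + bet u] gives
    [E u <= m + 6 * bet u], so [pot] is what the legs show, and their claims bound it by [H]. *)
Lemma claim_step : lr u ->
  (forall d, d \in sub u -> d != u -> lr d -> forall m, m + 6 * bet d < N -> pot (sub d) (m + 6 * bet d) <= G d m) ->
  [/\ forall x, x \in K -> feas E x (E x), E u <= C2 + 5 * bet u &
   forall m, m + 6 * bet u < N -> pot (sub u) (m + 6 * bet u) <= G u m].
Proof.
move=> lu IH; have bu0 := b0 u; have wu := wb u.
have H0 : H K C2 < w u.
  have -> : H K C2 = 0; last by slia.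
  rewrite /H big1 // => d _; rewrite /G big1 // => t ht; have := ltn_ord t; slia.
have [fK Eu] := base lu (fun x xK => cC (K_X xK)) H0 ltac:(have := NC u; slia) IH.
split=> // m mN.
have hK0 x : x \in K -> x != u -> E x <= E u.
  move=> xK nx; apply: leq_trans (leq_subr (bet u) _).
  exact: (root_max aT cX rX b0 cK bK fK uK lu xK (K_sub xK) nx).
have [pw1 pw2] := pot_root mN lu (fK u uK) hK0.
have [p pK hp] : exists2 p, p \in K & forall q, q \in K -> c q <= c p.
  by have [p h3 h4] := arg_maxnP (P := fun p => p \in K) c uK; exists p.
case: (leqP (m + bet u) (c p)) => hcp.
  apply: leq_trans pw1 _; apply: leq_trans (occ_max pK hp hcp); slia.
have hm1 x : x \in K -> c x <= m + bet u by move=> /hp h; slia.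
have HG : H K (m + bet u) <= G u m.
  by apply: leq_trans (H_occ hm1) (G_anti _ _); rewrite leq_addr.
case: (leqP (w u) (H K (m + bet u))) => hw; first by apply: leq_trans pw1 (leq_trans hw HG).
have [_ Eu2] := base lu hm1 hw ltac:(slia) IH.
apply: leq_trans (pw2 _) _; first by slia.
apply: leq_trans (raw_legs _ uK (fun x _ => erefl (E x))) _; apply: leq_trans HG.
apply: leq_trans (_ : \sum_(d in legs K) pot (sub d) (m + 6 * bet u) <= _).
  have VK : legs (vis_layer E u (m + 6 * bet u)) \subset legs K.
    by apply: legs_sub; apply/subsetP => x; rewrite in_set => /andP[].
  rewrite big_mkcond [leqRHS]big_mkcond /=; apply: leq_sum => d _.
  by case: ifP => // /(subsetP VK) ->.
apply: leq_sum => d hd; have [ld du ndu dX bd] := leg_lr hd.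
have := IH d du ndu ld (m + 6 * bet u - 6 * bet d); rewrite subnK; last by slia.
move=> /(_ mN) h; apply: leq_trans h _; apply: G_anti; slia.
Qed.

End Layer.

Hypothesis NC : forall v, C2 + 6 * bet v < N.

Lemma claim u : u \in X -> lr u ->
  [/\ forall x, x \in layer u -> feas E x (E x), E u <= C2 + 5 * bet u &
   forall m, m + 6 * bet u < N -> pot (sub u) (m + 6 * bet u) <= G u m].
Proof.
have [k] := ubnP #|sub u|; elim: k u => // k IH u hk uX lu.
apply: (claim_step uX NC lu) => d du ndu ld m.
have hd : #|sub d| < k.
  rewrite -ltnS; apply: leq_trans hk; rewrite ltnS; apply: proper_card; apply/properP.
  split; first exact: (sub_sub aT).
  exists u; first exact: (sub_refl aT uX).
  by apply: contra ndu => h; rewrite (sub_anti aT du h).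
by have [_ _] := IH d hd (subX du) ld; apply.
Qed.

Lemma up_bound x : x \in X -> feas E x (E x) /\ E x <= C2 + 5 * bet x.
Proof.
move=> xX; pose Q u := (x \in sub u) && (bet u == bet x).
have Qx : Q x by rewrite /Q (sub_refl aT xX) eqxx.
have [u /andP[xu /eqP bu] hu] := arg_maxnP (P := Q) (fun u => #|sub u|) Qx.
have uX := subX' cX rX xu.
have lu : lr u.
  rewrite /lr; case: eqVneq => //= nur; rewrite ltn_neqAle Hup ?(par_sub aT) // andbT.
  apply/negP => /eqP e; have pu := par_sub aT (rho := rho) uX.
  have := hu (par u); rewrite /Q (sub_trans aT pu xu) -e bu eqxx => /(_ isT) /=.
  rewrite leqNgt => /negP[]; apply: proper_card; apply/properP; split; first exact: (sub_sub aT).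
  exists (par u); first exact: (sub_refl aT (par_X aT cX rX uX)).
  by apply: contra (par_neq aT nur) => h; apply/eqP; rewrite -(sub_anti aT pu h).
have xK : x \in layer u by rewrite layerE xu bu eqxx.
have [fK Eu _] := claim uX lu.
split; first exact: fK.
rewrite -bu; apply: leq_trans Eu.
have [->//|nxu] := eqVneq x u.
apply: leq_trans (leq_subr (bet u) _).
exact: (root_max aT cX rX b0 (layer_convex aT cX rX Hup (q := u)) (layer_bS aT Hup (q := u)) fK (layer_refl rho bet aT uX) lu xK xu nxu).
Qed.
End UpBound.

(** * Game tree search of bounded depth *)

Section Min.
Variables (I : finType) (N : nat) (P : pred I) (F : I -> nat).
Notation m := (\big[minn/N]_(i | P i) F i).

Lemma bigmin_le i : P i -> m <= F i.
Proof.
move=> Pi; rewrite -big_filter; have : i \in [seq j <- index_enum I | P j] by rewrite mem_filter Pi mem_index_enum.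
elim: [seq j <- index_enum I | P j] => //= j s IH; rewrite inE big_cons geq_min => /orP[/eqP <-|/IH ->].
  by rewrite leqnn.
by rewrite orbT.
Qed.

Lemma bigmin_leN : m <= N.
Proof. by elim/big_rec: _ => // i x _ h; rewrite geq_min h orbT. Qed.

Lemma bigmin_att : m < N -> exists2 i, P i & F i = m.
Proof.
elim/big_rec: _ => [|i x Pi IH]; first by rewrite ltnn.
rewrite /minn; case: ifP => h hN; first by exists i.
exact: IH.
Qed.

Lemma bigmin_ge x : x <= N -> (forall i, P i -> x <= F i) -> x <= m.
Proof. by move=> xN h; elim/big_rec: _ => // i y Pi hy; rewrite leq_min hy h. Qed.
End Min.

Section BruteForce.
Variables (V : finType) (a : V -> V -> V) (bet w : V -> nat) (N : nat) (E : V -> V -> nat).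
Implicit Types Y Z : {set V}.

Definition topof (rho : V) (Y : {set V}) := odflt rho [pick q in Y | [forall v in Y, pth a rho v q]].
Definition rule (rho : V) (Y : {set V}) :=
  odflt rho [pick v in Y | [forall u in Y, keyle bet N (E rho) (topof rho Y) u v]].

(* [d] rounds of exact game tree search, followed by the labelled search from the best root. *)
Fixpoint bf (X : {set V}) (d : nat) (Y : {set V}) : nat :=
  if d is d'.+1 then
    \big[minn/N]_(q in Y) (w q + \max_(t in Y | t != q) bf X d' (cut a Y q t))
  else \big[minn/N]_(rho in X) \max_(t in Y) simc a w (rule rho) N Y t.

Definition bfq X d Y q := w q + \max_(t in Y | t != q) bf X d (cut a Y q t).

Lemma keyle_refl f q u : keyle bet N f q u u.
Proof. by rewrite /keyle !eqxx leqnn !orbT. Qed.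
Lemma keyle_total f q u v : keyle bet N f q u v || keyle bet N f q v u.
Proof. rewrite /keyle; lia. Qed.
Lemma keyle_trans f q v u x : keyle bet N f q u v -> keyle bet N f q v x -> keyle bet N f q u x.
Proof. rewrite /keyle; lia. Qed.

Lemma keyle_max f q Y : Y != set0 -> exists2 v, v \in Y & forall u, u \in Y -> keyle bet N f q u v.
Proof.
case/set0Pn => y yY.
suff [v] : exists2 v, v \in enum Y & forall u, u \in enum Y -> keyle bet N f q u v.
  by rewrite mem_enum => vY h; exists v => // u uY; apply: h; rewrite mem_enum.
have : enum Y != [::] by apply: contraTneq yY => h; rewrite -mem_enum h.
elim: (enum Y) => // x [_ _|x' s IH _]; first by exists x; rewrite ?inE // => u; rewrite inE => /eqP ->; apply: keyle_refl.
have [v vs h] := IH isT.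
case/orP: (keyle_total f q x v) => hx.
  by exists v; [rewrite inE vs orbT | move=> u; rewrite inE => /orP[/eqP ->|/h]].
exists x; first by rewrite inE eqxx.
by move=> u; rewrite inE => /orP[/eqP ->|/h hu]; [apply: keyle_refl | apply: keyle_trans hx].
Qed.

Section Class.
Variables (X : {set V}).
Hypotheses (aT : tree_answers a) (cX : convex a X).

Lemma topof_eq rho Y q : Y \subset X -> istop a X rho Y q -> topof rho Y = q.
Proof.
move=> YX [qY hq]; rewrite /topof; case: pickP => [q' /andP[q'Y /forall_inP h]|/(_ q)].
  have := h q qY => h1; have := hq q' q'Y; rewrite inE => /andP[_ h2] /=; exact: (pth_anti aT h1 h2).
rewrite qY /=; case: forall_inP => // h _; case: h => v vY; by have := hq v vY; rewrite inE => /andP[].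
Qed.

Lemma ruleP rho Y q : Y \subset X -> convex a Y -> istop a X rho Y q ->
  rule rho Y \in Y /\ forall u, u \in Y -> keyle bet N (E rho) q u (rule rho Y).
Proof.
move=> YX cY tq; rewrite /rule (topof_eq YX tq).
case: pickP => [v /andP[vY /forall_inP h]|no] //=.
have [|v vY h] := @keyle_max (E rho) q Y; first by apply/set0Pn; exists q; case: tq.
by have := no v; rewrite vY /=; move/forall_inP: h => ->.
Qed.

Lemma rule_in rho Y : rho \in X -> Y \subset X -> convex a Y -> Y != set0 -> rule rho Y \in Y.
Proof.
move=> rX YX cY Y0; have [q qY hq] := top_ex aT cX rX YX cY Y0.
by have [] := ruleP YX cY (conj qY hq).
Qed.

Lemma notin_cut Y q t : q \notin cut a Y q t.
Proof.
rewrite inE; apply/negP => /and3P[_ nqt /eqP h]; by have := ta_neq aT nqt; rewrite -h (ta_self aT) eqxx.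
Qed.

Lemma mem_cut Y q t : t \in Y -> t != q -> t \in cut a Y q t.
Proof. by move=> tY; rewrite inE tY eqxx eq_sym => ->. Qed.

Lemma cut_eq Y q t t' : t' \in cut a Y q t -> cut a Y q t' = cut a Y q t.
Proof.
move=> h; have nq : q != t' by apply: contraTneq h => <-; apply: notin_cut.
by move: h; rewrite inE => /and3P[_ nqt /eqP e]; apply/setP => y; rewrite !inE nq nqt e.
Qed.

Lemma simc_fuel rho k Y t : rho \in X -> Y \subset X -> convex a Y -> #|Y| <= k ->
  simc a w (rule rho) k.+1 Y t = simc a w (rule rho) k Y t.
Proof.
move=> rX; elim: k Y => [|k IH] Y YX cY hk.
  by move: hk; rewrite leqn0 cards_eq0 /= => ->.
rewrite [LHS]/= [RHS]/=; case: ifP => // /negbT Y0.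
have rY := rule_in rX YX cY Y0; congr (_ + _); apply: IH.
- exact: subset_trans (cut_sub _ _ _ _) YX.
- exact: (convex_cut aT).
- rewrite -ltnS; apply: leq_trans hk; apply: proper_card; apply/properP; split; first exact: cut_sub.
  by exists (rule rho Y) => //; apply: notin_cut.
Qed.

Hypothesis NV : #|V| < N.

Lemma bf_leN d Y : bf X d Y <= N.
Proof. by case: d => [|d] /=; apply: bigmin_leN. Qed.

(** A further exact round can imitate the first query of the strategy it precedes; at depth 0 this
    is the first query of the best labelled search. *)
Lemma bf_mono d Y : Y \subset X -> convex a Y -> Y != set0 -> bf X d.+1 Y <= bf X d Y.
Proof.
elim: d Y => [|d IH] Y YX cY Y0.
  have [hN|hN] := ltnP (bf X 0 Y) N; last by apply: leq_trans (bf_leN 1 Y) hN.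
  have [rho rX e] := bigmin_att hN; rewrite [leqRHS]/= -e.
  have rY := rule_in rX YX cY Y0; set q := rule rho Y in rY.
  have sq t : simc a w (rule rho) N Y t = w q + simc a w (rule rho) N (cut a Y q t) t.
    rewrite -{1}(ltn_predK NV) /= (negbTE Y0) -/q; congr (_ + _).
    rewrite -[in RHS](ltn_predK NV) simc_fuel //.
    - exact: subset_trans (cut_sub _ _ _ _) YX.
    - exact: (convex_cut aT).
    - by apply: leq_trans (max_card _) _; rewrite -ltnS (ltn_predK NV).
  apply: leq_trans (bigmin_le _ _ rY) _; rewrite /=.
  have hw : w q <= \max_(t in Y) simc a w (rule rho) N Y t.
    by apply: leq_trans (leq_bigmax_cond _ rY); rewrite sq leq_addr.
  rewrite -leq_subRL //; apply/bigmax_leqP => t /andP[tY ntq].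
  apply: leq_trans (bigmin_le _ _ rX) _; apply/bigmax_leqP => t' ht'.
  rewrite leq_subRL // -(cut_eq ht') -sq.
  by apply: (leq_bigmax_cond (F := fun t => simc a w (rule rho) N Y t)); move: ht'; rewrite inE => /andP[].
rewrite [leqRHS]/=; apply: bigmin_ge => [|q qY]; first exact: bf_leN.
apply: leq_trans (bigmin_le _ _ qY) _; rewrite leq_add2l.
apply/bigmax_leqP => t /andP[tY ntq].
apply: (@leq_trans (bf X d (cut a Y q t))); last first.
  by apply: (leq_bigmax_cond (F := fun t => bf X d (cut a Y q t))); rewrite tY ntq.
apply: IH; [exact: subset_trans (cut_sub _ _ _ _) YX | exact: (convex_cut aT) |].
by apply/set0Pn; exists t; apply: mem_cut.
Qed.

Lemma bf_mono0 d Y : Y \subset X -> convex a Y -> Y != set0 -> bf X d Y <= bf X 0 Y.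
Proof. by move=> YX cY Y0; elim: d => // d; apply: leq_trans; apply: bf_mono. Qed.

Variable lv : V -> nat.
Hypothesis pw : forall v, bet v = 2 ^ lv v.
Hypothesis wb : forall v, w v <= bet v < 2 * w v.
Hypothesis gE : forall rho, rho \in X -> greedy a X rho bet w N (E rho).
Variables (c : V -> nat) (C : nat).
Hypothesis Gv : forall x y, exists z, [/\ pth a x y z,
   (x = z \/ c x + 2 * w z <= c z) & (y = z \/ c y + 2 * w z <= c z)].
Hypothesis c_ell : forall x, 2 * w x <= c x.
Hypothesis cC : forall x, c x <= 2 * C.
Hypothesis NC : forall v, 16 * C + 6 * bet v < N.
Let b0 v : 0 < bet v. Proof. by rewrite pw expn_gt0. Qed.
Let wle v : w v <= bet v. Proof. by case/andP: (wb v). Qed.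

(** The labels are at most [4 * C + bet rho], and [bet rho < 2 * w rho <= 2 * C]. *)
Lemma bf_down rho d Y : rho \in X -> (forall v x, v \in X -> x \in X -> pth a rho x v -> bet v <= bet x) ->
  Y \subset X -> convex a Y -> Y != set0 -> bf X d Y <= 6 * C.
Proof.
move=> rX hd YX cY Y0; apply: leq_trans (bf_mono0 d YX cY Y0) _.
have Hdown v x : x \in sub a X rho v -> bet v <= bet x.
  by move=> xv; have vX := subX' cX rX xv; move: xv; rewrite inE => /andP[xX]; apply: hd.
have N1 : 2 * (2 * C) + bet rho < N by have := NC rho; slia.
have [fE hE] := down_bound aT cX rX pw wb (gE rX) (fun x y _ _ => Gv x y) (fun x _ => c_ell x) (fun x _ => cC x) Hdown N1.
apply: leq_trans (bigmin_le _ _ rX) _; apply/bigmax_leqP => t tY.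
apply: (@leq_trans (2 * (2 * C) + bet rho)).
  by apply: (down_cost aT cX rX pw wle fE (@ruleP rho) Hdown N t YX cY) => v vY; apply: hE; apply: (subsetP YX).
have := cC rho; have := c_ell rho; have /andP[_] := wb rho; slia.
Qed.

Section UpClass.
Variable rho : V.
Hypothesis rX : rho \in X.
Hypothesis hu : forall v x, v \in X -> x \in X -> pth a rho x v -> bet x <= bet v.

Let Hup v x : x \in sub a X rho v -> bet x <= bet v.
Proof.
by move=> xv; have vX := subX' cX rX xv; move: xv; rewrite inE => /andP[xX]; apply: hu.
Qed.

(** Labels are at most [2 * C + 5 * bet q]. The next multiple of [bet q] is at most
    [m = 2 * C + 6 * bet q], and then [3 * m + 6 * bet q] is [6 * C + 24 * bet q]. *)
Lemma bf_light d Y th : Y \subset X -> convex a Y -> Y != set0 -> (forall v, v \in Y -> bet v <= th) ->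
  bf X d Y <= 6 * C + 24 * th.
Proof.
move=> YX cY Y0 hth; apply: leq_trans (bf_mono0 d YX cY Y0) _.
have N1 v : 2 * C + 6 * bet v < N by have := NC v; slia.
have EB := up_bound aT cX rX pw wb (gE rX) (fun x y _ _ => Gv x y) (fun x _ => c_ell x) (fun x _ => cC x) Hup N1.
have fE x : x \in X -> feas a X rho bet w N (E rho) x (E rho x) by move=> /EB[].
have [q qY hq] := top_ex aT cX rX YX cY Y0.
apply: leq_trans (bigmin_le _ _ rX) _; apply/bigmax_leqP => t tY.
pose m := (2 * C %/ bet q + 6) * bet q.
have m1 : 2 * C + 5 * bet q <= m.
  have := ltn_ceil (2 * C) (b0 q); rewrite /m mulnDl mulSn; slia.
have m2 : m <= 2 * C + 6 * bet q.
  have := leq_trunc_div (2 * C) (bet q); rewrite /m mulnDl; slia.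
have [h _] := up_cost12 aT cX rX pw wle fE (@ruleP rho) Hup t N m.
apply: leq_trans (h Y q YX cY (conj qY hq) _ _ _) _.
- exact: dvdn_mull.
- exact: leq_ltn_trans m2 (N1 q).
- move=> v vY; have [_ h2] := EB v (subsetP YX _ vY); have := Hup (hq v vY); slia.
- have := hth q qY; slia.
Qed.

(** Query the heavy vertex of largest [c]. Heaviness persists along paths between heavy vertices, so
    the values of [c] on the remaining heavy vertices drop by [2 * w q], more than [th]. The exact
    queries thus telescope in [M]. *)
Lemma bf_heavy th d Y M : Y \subset X -> convex a Y -> Y != set0 ->
  (forall v, v \in Y -> th < bet v -> c v <= M) -> M <= d * th.+1 ->
  2 * bf X d Y <= M + 2 * (6 * C + 24 * th).
Proof.
elim: d Y M => [|d IH] Y M YX cY Y0 hM hd.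
  apply: leq_trans (leq_addl _ _); apply: leq_mul => //; apply: bf_light => // v vY.
  rewrite leqNgt; apply/negP => h; have := hM v vY h; have := c_ell v; have := wb v; have := b0 v; slia.
case: (set_0Vmem [set v in Y | th < bet v]) => [h0|[v0]].
  apply: leq_trans (leq_addl _ _); apply: leq_mul => //; apply: bf_light => // v vY.
  rewrite leqNgt; apply/negP => h; have : v \in set0 by rewrite -h0 inE vY.
  by rewrite inE.
rewrite inE => Qv0.
have [q /andP[qY hq] qm] := arg_maxnP (P := fun v => (v \in Y) && (th < bet v)) c Qv0.
have gap x : x \in Y -> th < bet x -> x != q -> c x + 2 * w q <= c q.
  move=> xY hx nxq; have [z [pz e1 e2]] := Gv x q; have zY := cY _ _ _ xY qY pz.
  have hz : th < bet z.
    have zX := subsetP YX _ zY; have qX := subsetP YX _ qY; have xX := subsetP YX _ xY.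
    case/orP: (pth_tri aT rho pz) => h.
      by apply: leq_trans hx _; apply: hu => //; rewrite pthC.
    by apply: leq_trans hq _; apply: hu.
  have := qm z; rewrite zY hz => /(_ isT) /= hcz; have := wb z; have := b0 z.
  case: e2 => [e2|e2]; last by slia.
  by subst z; case: e1 => [e1|e1]; [rewrite e1 eqxx in nxq | slia].
have hcq := hM q qY hq; have wq := wb q; have cq := c_ell q.
apply: leq_trans (_ : 2 * bfq X d Y q <= _).
  by apply: leq_mul => //; apply: bigmin_le.
suff : \max_(t in Y | t != q) bf X d (cut a Y q t) <= (c q - 2 * w q + 2 * (6 * C + 24 * th)) %/ 2.
  rewrite /bfq leq_divRL // => h; slia.
apply/bigmax_leqP => t /andP[tY ntq]; rewrite leq_divRL // mulnC; apply: IH.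
- exact: subset_trans (cut_sub _ _ _ _) YX.
- exact: (convex_cut aT).
- by apply/set0Pn; exists t; apply: mem_cut.
- move=> v vc hv; have vY := subsetP (cut_sub _ _ _ _) _ vc.
  have nv : v != q by apply: contraTneq vc => ->; apply: notin_cut.
  have := gap v vY hv nv; slia.
- move: hd; rewrite mulSn; slia.
Qed.

(** With threshold [C / 48] the bound of [bf_heavy] is [2 * C + 12 * C + 48 * (C / 48)]. *)
Lemma bf_up Y : Y \subset X -> convex a Y -> Y != set0 -> 2 * bf X 96 Y <= 15 * C.
Proof.
move=> YX cY Y0; have h : 2 * C <= 96 * (C %/ 48).+1.
  have := ltn_ceil C (isT : 0 < 48); slia.
apply: leq_trans (bf_heavy YX cY Y0 (fun v _ _ => cC v) h) _.
have := leq_trunc_div C 48; slia.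
Qed.
End UpClass.

End Class.
End BruteForce.

(** * Passing from class to class *)

Section Policy.
Variables (V I : finType) (a : V -> V -> V) (bet w : V -> nat) (N : nat) (E : V -> V -> nat).
Variables (lab : V -> I) (r : V) (D B : nat).
Hypothesis aT : tree_answers a.
Implicit Types Cand : {set V}.

Definition klass (x : V) := [set v | lab v == lab x].
Definition active (Cand : {set V}) := Cand :&: klass (topof a r Cand).
Definition bfc (Cand : {set V}) d Y := bf a bet w N E (klass (topof a r Cand)) d Y.
Definition score (Cand : {set V}) q := bfq a bet w N E (klass (topof a r Cand)) D (active Cand) q.
Definition ncl (x t : V) := #|lab @: [set v | pth a x t v]|.
(* The amortised cost still to be paid; it drops by at least the weight of each query. *)
Definition spent (Cand : {set V}) (t : V) :=
  bfc Cand D (active Cand) + B * (ncl (topof a r Cand) t).-1.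

Hypothesis cK : forall x, convex a (klass x).
Hypothesis NV : #|V| < N.
Hypothesis BN : B < N.
Hypothesis hB : forall x (Y : {set V}), Y \subset klass x -> convex a Y -> Y != set0 -> bf a bet w N E (klass x) D Y <= B.

Lemma klass_refl x : x \in klass x. Proof. by rewrite inE. Qed.
Lemma klass_eq x y : y \in klass x -> klass y = klass x.
Proof. by rewrite inE => /eqP e; apply/setP => v; rewrite !inE e. Qed.

Lemma topofP Cand : convex a Cand -> Cand != set0 ->
  topof a r Cand \in Cand /\ forall v, v \in Cand -> pth a r v (topof a r Cand).
Proof.
move=> cC C0; have [q qC hq] := top_ex aT (@convexT V a) (in_setT r) (subsetT Cand) cC C0.
rewrite (topof_eq aT (subsetT Cand) (conj qC hq)); split=> // v /hq.
by rewrite inE => /andP[].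
Qed.

Lemma active_convex Cand : convex a Cand -> convex a (active Cand).
Proof.
move=> cC x y z; rewrite !in_setI => /andP[x1 x2] /andP[y1 y2] p.
by rewrite (cC x y) // (cK x2 y2 p).
Qed.

Lemma active_n0 Cand : convex a Cand -> Cand != set0 -> active Cand != set0.
Proof.
move=> cC C0; have [h _] := topofP cC C0; apply/set0Pn; exists (topof a r Cand).
by rewrite in_setI h klass_refl.
Qed.

(** The full depth [D] is available again after every query: the best score is a game value of depth
    [D + 1], which [bf_mono] bounds by that of depth [D]. So the strategy needs no round counter. *)
Lemma score_good Cand q : convex a Cand -> Cand != set0 -> q \in active Cand ->
  (forall q', q' \in active Cand -> score Cand q <= score Cand q') ->
  score Cand q <= bfc Cand D (active Cand).
Proof.
move=> cC C0 qA hq; have cA := active_convex cC; have A0 := active_n0 cC C0.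
have AX : active Cand \subset klass (topof a r Cand) by apply: subsetIr.
have h := bf_mono bet w E aT (cK (x := _)) NV D AX cA A0.
have hN := leq_ltn_trans (leq_trans h (hB AX cA A0)) BN.
have [q' q'A e] := bigmin_att hN.
by apply: leq_trans (hq q' q'A) _; rewrite /score /bfq e.
Qed.

(* Here [x] and [y] are the vertices closest to [r] in two nested convex sets containing [t]. *)
Lemma pth_nested x y t : pth a r t x -> pth a r t y -> pth a r y x -> forall v, pth a y t v -> pth a x t v.
Proof.
move=> rx ry ryx v hv.
have h1 : t \in sub a setT r y by rewrite inE inE.
have h2 : t \in sub a setT r x by rewrite inE inE.
have h3 : y \in sub a setT r x by rewrite inE inE.
move: hv; rewrite (sub_pthE aT (@convexT V a) (in_setT r) _ h1) (sub_pthE aT (@convexT V a) (in_setT r) _ h2).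
by move=> /andP[h4 ->]; rewrite (sub_trans aT h3 h4).
Qed.

(** Either the answer stays in the class and the game value drops by the weight of the query, or the
    class is left for good and the path to the target meets one class fewer, which releases [B]. *)
Lemma spent_step Cand q t : convex a Cand -> t \in Cand -> q \in active Cand ->
  score Cand q <= bfc Cand D (active Cand) ->
  w q <= spent Cand t /\ (q != t -> w q + spent (cut a Cand q t) t <= spent Cand t).
Proof.
move=> cC tC qA hq; have C0 : Cand != set0 by apply/set0Pn; exists t.
set X := klass (topof a r Cand); set x0 := topof a r Cand in X *.
have [x0C hx0] := topofP cC C0; rewrite -/x0 in x0C hx0.
have wq : w q <= bfc Cand D (active Cand) by apply: leq_trans hq; apply: leq_addr.
split=> [|nqt]; first by apply: leq_trans wq _; apply: leq_addr.
move: (qA); rewrite in_setI => /andP[qC qX]; rewrite -/x0 -/X in qX.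
set Cand' := cut a Cand q t.
have cC' : convex a Cand' by apply: (convex_cut aT).
have CC : Cand' \subset Cand by apply: cut_sub.
have tC' : t \in Cand' by rewrite inE tC nqt eqxx.
have C'0 : Cand' != set0 by apply/set0Pn; exists t.
have [y0C hy0] := topofP cC' C'0; set y0 := topof a r Cand' in y0C hy0.
have y0C1 := subsetP CC _ y0C.
have nest := pth_nested (hx0 t tC) (hy0 t tC') (hx0 y0 y0C1).
set u := a q t.
have uC : u \in Cand by apply: (cC q t) => //; apply: pth_ans.
have uC' : u \in Cand' by rewrite inE uC nqt (ta_idem aT) eqxx.
have nuq : u != q by apply: (ta_neq aT).
rewrite /spent -/x0 -/y0.
case: (boolP (u \in X)) => uX.
  have y0X : y0 \in X.
    apply: (cK (x := x0) (klass_refl x0) uX).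
    have h3 : u \in sub a setT r x0 by rewrite inE inE hx0.
    rewrite (sub_pthE aT (@convexT V a) (in_setT r) _ h3) !inE hx0 //=; exact: hy0.
  have kX : klass y0 = X by apply: klass_eq.
  have eA : active Cand' = cut a (active Cand) q u.
    rewrite /active -/y0 kX -/x0 -/X /Cand'; apply/setP => y; rewrite !inE [q == u]eq_sym nuq nqt /= (ta_idem aT).
    by rewrite andbAC.
  have uA : u \in active Cand by rewrite in_setI uC.
  have h1 : w q + bfc Cand' D (active Cand') <= bfc Cand D (active Cand).
    apply: leq_trans hq; rewrite /score /bfq leq_add2l eA /bfc -/y0 kX -/x0 -/X.
    by apply: (leq_bigmax_cond (F := fun t => bf a bet w N E X D (cut a (active Cand) q t))); rewrite uA nuq.
  rewrite addnA; apply: leq_add => //; rewrite leq_mul2l; apply/orP; right.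
  rewrite -!subn1; apply: leq_sub2r; apply: subset_leq_card; apply: imsetS.
  by apply/subsetP => v; rewrite !inE; apply: nest.
(* A remaining candidate in the class would put the whole path to [q] there, and with it the answer
   [u]. *)
have disj y : y \in Cand' -> y \notin X.
  rewrite inE => /and3P[yC _ /eqP e]; apply: contra uX => yX; rewrite /u -e.
  by apply: (cK (x := x0) qX yX); apply: pth_ans.
have hcl : ncl y0 t < ncl x0 t.
  apply: proper_card; apply/properP; split.
    by apply: imsetS; apply/subsetP => v; rewrite !inE; apply: nest.
  exists (lab x0); first by apply: imset_f; rewrite inE pth_l.
  apply/imsetP => -[v]; rewrite inE => pv e.
  have := disj v (cC' _ _ _ y0C tC' pv); by rewrite inE -e eqxx.
have ncl0 : 0 < ncl y0 t.
  by apply/card_gt0P; exists (lab y0); apply: imset_f; rewrite inE pth_l.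
have h2 : bfc Cand' D (active Cand') <= B.
  by apply: hB; [apply: subsetIr | apply: active_convex | apply: active_n0].
apply: leq_add => //; apply: (@leq_trans (B + B * (ncl y0 t).-1)); first by rewrite leq_add2r.
by rewrite -mulnS leq_mul2l (ltn_predK ncl0); apply/orP; right; rewrite -ltnS (ltn_predK hcl).
Qed.

Lemma spent_init t : spent setT t <= B * ncl r t.
Proof.
have C0 : [set: V] != set0 by apply/set0Pn; exists r.
have -> : spent setT t = bfc setT D (active setT) + B * (ncl r t).-1.
  rewrite /spent; suff -> : topof a r setT = r by [].
  have [_ h] := topofP (@convexT V a) C0; have := h r (in_setT r); by rewrite pthxx => /eqP.
have h2 : bfc setT D (active setT) <= B.
  by apply: hB; [apply: subsetIr | apply: active_convex; apply: convexT | apply: active_n0; [apply: convexT|]].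
have ncl0 : 0 < ncl r t by apply/card_gt0P; exists (lab r); apply: imset_f; rewrite inE pth_l.
by rewrite -{2}(ltn_predK ncl0) mulnS leq_add2r.
Qed.

End Policy.

(** * Decision trees with integer weights *)

Section Tree.
Variables (n : nat) (e : rel 'I_n).
Hypothesis treeE : is_tree e.
Let aT : tree_answers (ans e).
Proof.
split; [exact: ans_self | exact: (ans_neq treeE) | exact: (ans_cross treeE) | exact: (ans_idem treeE)
 | exact: (ans_nb treeE) | exact: (ans_back treeE) | exact: (ans_fwd treeE)].
Qed.
Definition tree_answersT := aT.

Lemma pth_onpath x y z : pth (ans e) x y z = onpath e x y z.
Proof. by rewrite (onpathE treeE). Qed.

Lemma subtree_convex A : is_subtree e A -> convex (ans e) A.
Proof.
move=> hA x y z xA yA; rewrite pth_onpath /onpath => /or3P[/eqP->//|/eqP->//|].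
apply: contraR => zA; have := hA x y xA yA; apply: connect_sub => u v /and3P[euv uA vA].
apply: connect1; rewrite /restr euv !inE /=; apply/andP; split.
  by apply: contraNneq zA => <-.
by apply: contraNneq zA => <-.
Qed.

Lemma convex_connect A x y : convex (ans e) A -> x \in A -> y \in A -> connect (restr e A) x y.
Proof.
move=> cA; have [k] := ubnP #|[set z | pth (ans e) x y z]|; elim: k x => // k IH x hk xA yA.
have [->|nxy] := eqVneq x y; first exact: connect0.
have uA : ans e x y \in A by apply: (cA x y) => //; apply: (pth_ans aT).
apply: (@connect_trans _ _ (ans e x y)).
  apply: connect1; rewrite /restr xA uA !andbT (ans_edgeE treeE) eq_sym (ta_neq aT nxy) /=.
  by rewrite (ta_idem aT).
apply: IH => //; rewrite -ltnS; apply: leq_trans hk; rewrite ltnS; apply: proper_card; apply/properP; split.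
  apply/subsetP => z; rewrite !inE pthC [pth _ x y z]pthC; apply: (pth_sub aT).
  by rewrite pthC; apply: (pth_ans aT).
exists x; first by rewrite inE pth_l.
by rewrite inE /pth (ta_idem aT) eqxx (negbTE nxy) andbF.
Qed.

Lemma comps_cut S q x : convex (ans e) S -> x \in S :\ q ->
  [set y in S :\ q | connect (restr e (S :\ q)) x y] = cut (ans e) S q x.
Proof.
move=> cS; rewrite !inE => /andP[nxq xS]; have nqx : q != x by rewrite eq_sym.
apply/setP => y; rewrite !inE nqx /=.
have [->|nyq] := eqVneq y q; first by rewrite (ta_self aT) eq_sym (negbTE (ta_neq aT nqx)) andbF.
case: (boolP (y \in S)) => //= yS; have nqy : q != y by rewrite eq_sym.
apply/idP/idP => [h|h].
  rewrite (ans_eqP treeE) // (restr_connect_sym treeE); apply: connect_sub h => u v /and3P[euv uS vS].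
  by move: uS vS; rewrite !inE => /andP[u1 u2] /andP[v1 v2]; apply: connect1; rewrite /restr euv !inE u1.
apply: (@connect_sub _ (restr e (cut (ans e) S q x))) => [u v /and3P[euv]|].
  rewrite !inE => /and3P[uS _ u2] /and3P[vS _ v2]; apply: connect1; rewrite /restr euv !inE uS vS !andbT /=.
  by apply/andP; split; [apply: contraNneq (ta_neq aT nqx) => uq; rewrite -(eqP u2) uq (ta_self aT)
    | apply: contraNneq (ta_neq aT nqx) => uq; rewrite -(eqP v2) uq (ta_self aT)].
apply: convex_connect; first exact: (convex_cut aT).
  by rewrite inE xS nqx eqxx.
by rewrite inE yS nqx.
Qed.

End Tree.

Fixpoint icost n (w : 'I_n -> nat) (D : dtree n) : nat :=
  let: DNode q ch := D in
  w q + (fix go (l : seq (dtree n)) : nat := if l is c :: l' then maxn (icost w c) (go l') else 0%N) ch.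

Lemma icostE n (w : 'I_n -> nat) q ch : icost w (DNode q ch) = (w q + \max_(c <- ch) icost w c)%N.
Proof. by rewrite /=; congr addn; elim: ch => [|c ch IH]; rewrite ?big_nil // big_cons IH. Qed.

Section DecisionTree.
Variables (n : nat) (e : rel 'I_n) (w : 'I_n -> nat).
Hypothesis treeE : is_tree e.
Let aT := tree_answersT treeE.

Lemma In_icost c (ch : seq (dtree n)) : List.In c ch -> (icost w c <= \max_(c <- ch) icost w c)%N.
Proof.
elim: ch => //= d ch IH [->|/IH h]; rewrite big_cons leq_max ?leqnn //.
by rewrite h orbT.
Qed.

Lemma In_map_dverts (A : {set 'I_n}) (ch : seq (dtree n)) :
  A \in map (@dverts n) ch -> exists2 c, List.In c ch & dverts c = A.
Proof.
elim: ch => //= d ch IH; rewrite inE => /orP[/eqP ->|/IH[c h1 h2]]; first by exists d; [left|].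
by exists c; [right|].
Qed.

Lemma In_dverts (c : dtree n) (ch : seq (dtree n)) : List.In c ch -> dverts c \in map (@dverts n) ch.
Proof. by elim: ch => //= d ch IH [->|/IH h]; rewrite inE ?eqxx // h orbT. Qed.

(* Each vertex is labelled with twice the cost of the decision tree from that vertex downwards. *)
Lemma dtree_labels S D : valid_dtree e S D -> convex (ans e) S -> exists c : 'I_n -> nat,
  (forall x y, x \in S -> y \in S -> exists z, [/\ pth (ans e) x y z,
     (x = z \/ c x + 2 * w z <= c z) & (y = z \/ c y + 2 * w z <= c z)]%N) /\
  (forall x, x \in S -> 2 * w x <= c x <= 2 * icost w D)%N.
Proof.
elim=> {S D} S q ch qS hperm hv IH cS.
have comp_child x : x \in S :\ q -> exists2 D, List.In D ch & dverts D = cut (ans e) S q x.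
  move=> xS; apply: In_map_dverts; rewrite (perm_mem hperm) mem_enum -(comps_cut treeE cS xS).
  by apply/imsetP; exists x.
have ex x : exists c : 'I_n -> nat, x \in S :\ q ->
  (forall x1 y, x1 \in cut (ans e) S q x -> y \in cut (ans e) S q x -> exists z, [/\ pth (ans e) x1 y z,
     (x1 = z \/ c x1 + 2 * w z <= c z) & (y = z \/ c y + 2 * w z <= c z)]%N) /\
  (forall x1, x1 \in cut (ans e) S q x -> 2 * w x1 <= c x1 <= 2 * (\max_(c <- ch) icost w c))%N.
  case: (boolP (x \in S :\ q)) => [xS|_]; last by exists (fun=> 0%N).
  have [D Dch eD] := comp_child x xS.
  have [|c [h1 h2]] := IH D Dch; first by rewrite eD; apply: (convex_cut aT).
  exists c => _; rewrite -eD; split=> // x1 x1D; have /andP[-> h] := h2 x1 x1D.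
  by apply: leq_trans h _; rewrite leq_mul2l In_icost.
have [F hF] := fin_all_exists ex.
(* Labels have been chosen for every vertex separately; a fixed representative makes all vertices of
   one component use the same choice. *)
pose rep x := odflt q [pick y in S :\ q | ans e q y == ans e q x].
have repP x : x \in S :\ q -> [/\ rep x \in S :\ q & cut (ans e) S q (rep x) = cut (ans e) S q x].
  move=> xS; rewrite /rep; case: pickP => [y /andP[yS /eqP h]|/(_ x)] /=; last by rewrite xS eqxx.
  split=> //; apply/setP => v; move: xS yS; rewrite !inE h ![q == _]eq_sym => /andP[-> _] /andP[-> _]; by [].
have rep_eq x y : ans e q x = ans e q y -> rep x = rep y by move=> h; rewrite /rep h.
pose c x := if x == q then (2 * icost w (DNode q ch))%N else F (rep x) x.
have cq : c q = (2 * icost w (DNode q ch))%N by rewrite /c eqxx.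
have cx x : x \in S :\ q -> c x = F (rep x) x by rewrite !inE /c => /andP[/negbTE ->].
have xcut x : x \in S :\ q -> x \in cut (ans e) S q x.
  by rewrite !inE => /andP[h ->]; rewrite eq_sym h eqxx.
have bd x : x \in S :\ q -> (2 * w x <= c x <= 2 * (\max_(c <- ch) icost w c))%N.
  move=> xS; have [r1 r2] := repP x xS; rewrite (cx x xS); have [_ h] := hF _ r1.
  by apply: h; rewrite r2 xcut.
exists c; split.
  move=> x y xS yS; have toq x' : x' \in S -> x' = q \/ (c x' + 2 * w q <= c q)%N.
    move=> x'S; have [->|nx] := eqVneq x' q; [by left | right].
    have := bd x'; rewrite !inE nx x'S => /(_ isT) /andP[_ h]; rewrite cq icostE; slia.
  case: (boolP (pth (ans e) x y q)) => pq.
    by exists q; split=> //; apply: toq.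
  have nqx : q != x by apply: contraNneq pq => ->; apply: (pth_l aT).
  have nqy : q != y by apply: contraNneq pq => ->; apply: (pth_r aT).
  have xS' : x \in S :\ q by rewrite !inE eq_sym nqx.
  have yS' : y \in S :\ q by rewrite !inE eq_sym nqy.
  have exy : ans e q x = ans e q y by apply/eqP; rewrite side_pth.
  have [r1 r2] := repP x xS'; have [h _] := hF _ r1.
  have ycut : y \in cut (ans e) S q (rep x) by rewrite r2 inE yS nqx exy eqxx.
  have xcut' : x \in cut (ans e) S q (rep x) by rewrite r2 xcut.
  have [z [pz h1 h2]] := h x y xcut' ycut.
  have zc := convex_cut aT cS xcut' ycut pz; rewrite r2 in zc.
  have nzq : z != q by apply: contraTneq zc => ->; apply: (notin_cut aT).
  move: zc; rewrite inE => /and3P[zS _ /eqP ez].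
  have zS' : z \in S :\ q by rewrite !inE nzq.
  exists z; rewrite !cx // (rep_eq z x ez) (rep_eq y x (esym exy)); by split.
move=> x xS; have [->|nx] := eqVneq x q; first by rewrite cq leqnn andbT icostE leq_mul2l leq_addr orbT.
have /andP[h1 h2] : (2 * w x <= c x <= 2 * (\max_(c <- ch) icost w c))%N by apply: bd; rewrite !inE nx.
by rewrite h1 (leq_trans h2) // icostE leq_mul2l leq_addl orbT.
Qed.

Variables (R : realType) (wr : 'I_n -> R).
Hypothesis wr0 : forall v, (0 <= wr v)%R.

Lemma dcost_go_ge0 (ch : seq (dtree n)) : (0 <= (fix go (l : seq (dtree n)) : R :=
          if l is c :: l' then Num.max (dcost wr c) (go l') else 0) ch)%R.
Proof. by elim: ch => //= c ch IH; rewrite le_max IH orbT. Qed.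

Lemma dcost_node q (ch : seq (dtree n)) : (wr q <= dcost wr (DNode q ch))%R.
Proof. by rewrite /= lerDl dcost_go_ge0. Qed.

Lemma dcost_child q c (ch : seq (dtree n)) : List.In c ch -> (dcost wr c + wr q <= dcost wr (DNode q ch))%R.
Proof.
rewrite [dcost wr (DNode q ch)]/= addrC lerD2l.
by elim: ch => //= d ch IH [->|/IH h]; rewrite le_max ?lexx // h orbT.
Qed.

Lemma cover_children (S : {set 'I_n}) q ch v : q \in S -> perm_eq (map (@dverts n) ch) (enum (comps e (S :\ q))) ->
  v \in S -> v != q -> exists2 c, List.In c ch & v \in dverts c.
Proof.
move=> qS hp vS nv.
pose A := [set y in S :\ q | connect (restr e (S :\ q)) v y].
have vA : v \in A by rewrite !inE nv vS connect0.
have : A \in map (@dverts n) ch.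
  by rewrite (perm_mem hp) mem_enum; apply/imsetP; exists v => //; rewrite !inE nv.
by case/In_map_dverts => c hc ec; exists c; rewrite // ec.
Qed.

Lemma child_subset (S : {set 'I_n}) q ch c : perm_eq (map (@dverts n) ch) (enum (comps e (S :\ q))) ->
  List.In c ch -> dverts c \subset S :\ q.
Proof.
move=> hp /In_dverts; rewrite (perm_mem hp) mem_enum => /imsetP[x _ ->].
by apply/subsetP => y; rewrite inE => /andP[].
Qed.

Lemma dcost_ge S D v : valid_dtree e S D -> v \in S -> (wr v <= dcost wr D)%R.
Proof.
elim=> {S D} S q ch qS hp _ IH vS; have [->|nv] := eqVneq v q; first exact: dcost_node.
have [c cch vc] := cover_children qS hp vS nv.
apply: le_trans (dcost_child q cch); apply: le_trans (IH c cch vc) _; by rewrite lerDl.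
Qed.

(* Rounding up costs at most one unit per vertex of a root-to-leaf path. *)
Lemma icost_dcost S D (al W : R) : valid_dtree e S D -> (0 <= al)%R -> (0 <= W)%R ->
  (forall v, ((w v)%:R * W <= al * wr v + W)%R) ->
  ((icost w D)%:R * W <= al * dcost wr D + #|S|%:R * W)%R.
Proof.
move=> + al0 W0 hw; elim=> {S D} S q ch qS hp hv IH.
have hmax (x : R) (l : seq (dtree n)) : (0 <= x)%R -> (forall c, List.In c l -> ((icost w c)%:R * W <= x)%R) ->
    ((\max_(c <- l) icost w c)%:R * W <= x)%R.
  move=> x0; elim: l => [|c l IHl] hl; first by rewrite big_nil mul0r.
  rewrite big_cons /maxn; case: ifP => _; last by apply: hl; left.
  by apply: IHl => c' h; apply: hl; right.
have cardS : (#|S|%:R = 1 + #|S :\ q|%:R :> R)%R by rewrite (cardsD1 q) qS natrD.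
have h : ((\max_(c <- ch) icost w c)%:R * W <= al * (dcost wr (DNode q ch) - wr q) + (#|S :\ q|)%:R * W)%R.
  apply: hmax => [|c hc].
    by rewrite addr_ge0 ?mulr_ge0 // subr_ge0 dcost_node.
  apply: le_trans (IH c hc) _; apply: lerD.
    by rewrite ler_wpM2l // lerBrDr dcost_child.
  by rewrite ler_wpM2r // ler_nat subset_leq_card // (child_subset hp).
rewrite icostE natrD cardS; have := hw q; lra.
Qed.

Lemma icost_le S D m : valid_dtree e S D -> (forall v, w v <= m)%N -> (icost w D <= #|S| * m)%N.
Proof.
move=> + hw; elim=> {S D} S q ch qS hp hv IH; rewrite icostE (cardsD1 q) qS mulnDl mul1n.
apply: leq_add => //.
have : forall c, List.In c ch -> (icost w c <= #|S :\ q| * m)%N.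
  move=> c hc; apply: leq_trans (IH c hc) _; rewrite leq_mul2r; apply/orP; right.
  by apply: subset_leq_card; apply: child_subset hp hc.
elim: (ch) => [|c l IHl] hl; first by rewrite big_nil.
rewrite big_cons geq_max hl /=; last by left.
by apply: IHl => c' h; apply: hl; right.
Qed.

End DecisionTree.

(** * Game values of the classes of a k-monotonic cost function *)

Section Bounds.
Variables (R : realType) (n : nat) (e : rel 'I_n) (w : 'I_n -> R) (part : 'I_n -> 'I_n) (r : 'I_n) (k : nat).
Hypothesis treeE : is_tree e.
Hypothesis kM : k_monotonic_wit e w part r k.
Let aT := tree_answersT treeE.

Lemma klass_convex x : convex (ans e) (klass part x).
Proof.
have [h _] := kM; have [|h1 _] := h (part x); first by apply/set0Pn; exists x; rewrite inE.
by apply: (subtree_convex treeE) => u v; rewrite !inE => uA vA; apply: h1; rewrite inE.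
Qed.

(** Below [t] take a vertex with the smallest subtree. A neighbour other than the one towards [r]
    would have a smaller subtree still. *)
Lemma leaf_below t : exists2 l, leaf e l & forall v, pth (ans e) r t v -> onpath e r l v.
Proof.
have tt := sub_refl aT (rho := r) (in_setT t).
have [l lt hm] := arg_minnP (P := fun l => l \in sub (ans e) setT r t) (fun l => #|sub (ans e) setT r l|) tt.
exists l; last first.
  move=> v pv; rewrite -(pth_onpath treeE); apply: (pth_sub aT _ pv); by move: lt; rewrite !inE.
rewrite /leaf; apply/card_le1_eqP.
suff h u : u \in [set u | e l u] -> u = ans e l r by move=> u v /h -> /h ->.
rewrite inE (ans_edgeE treeE) => /andP[nlu /eqP eu].
have nu : u \notin sub (ans e) setT r l.
  apply/negP => ul; have := hm u (sub_trans aT lt ul); rewrite leqNgt => /negP; apply.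
  apply: proper_card; apply/properP; split; first exact: (sub_sub aT).
  exists l; first by apply: (sub_refl aT); rewrite inE.
  by apply: contra nlu => h; rewrite (sub_anti aT h ul).
move: nu; rewrite !inE /= /pth negb_or negbK => /andP[/eqP h _]; by rewrite h eu.
Qed.

Lemma ncl_le t : ncl (ans e) part r t <= k.
Proof.
have [_ h] := kM; have [l lf hl] := leaf_below t; apply: leq_trans (h l lf).
apply: subset_leq_card; apply: imsetS; apply/subsetP => v; rewrite !inE; exact: hl.
Qed.

Variables (wi bet : 'I_n -> nat) (lv : 'I_n -> nat) (N : nat) (E : 'I_n -> 'I_n -> nat).
Hypothesis w_mono : forall u v, (w u <= w v)%R -> wi u <= wi v.
Hypothesis pw : forall v, bet v = 2 ^ lv v.
Hypothesis wb : forall v, wi v <= bet v < 2 * wi v.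
Hypothesis wi_le : forall v, wi v <= 15 * n.
Hypothesis gE : forall rho : 'I_n, greedy (ans e) (klass part rho) rho bet wi N (E rho).
(** Integer weights are at most [15 * n], so [C <= 15 * n * n] and [bet v < 30 * n]; then 240 is
    [16 * 15] and 180 is [6 * 30], as needed for [16 * C + 6 * bet v]. *)
Hypothesis NC : 240 * (n * n) + 180 * n < N.

Lemma bet_mono u v : wi u <= wi v -> bet u <= bet v.
Proof.
move=> h; rewrite leqNgt; apply/negP => h2; have := bet_half pw h2; have := wb u; have := wb v; slia.
Qed.

Lemma class_bf D x (Y : {set 'I_n}) : valid_dtree e setT D -> Y \subset klass part x -> convex (ans e) Y -> Y != set0 ->
  bf (ans e) bet wi N E (klass part x) 96 Y <= (15 * icost wi D)./2.
Proof.
move=> vD YX cY Y0; have cX := klass_convex (x := x); set X := klass part x in YX cX *.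
have [c [hG hc]] := dtree_labels wi treeE vD (@convexT _ (ans e)).
have Gv x1 y : exists z, [/\ pth (ans e) x1 y z,
   (x1 = z \/ c x1 + 2 * wi z <= c z) & (y = z \/ c y + 2 * wi z <= c z)] by apply: hG; rewrite inE.
have c_ell x1 : 2 * wi x1 <= c x1 by have /andP[] := hc x1 (in_setT _).
have cC x1 : c x1 <= 2 * icost wi D by have /andP[] := hc x1 (in_setT _).
have Cn : icost wi D <= n * (15 * n) by have := icost_le vD wi_le; rewrite cardsT card_ord.
have N16 v : 16 * icost wi D + 6 * bet v < N.
  have := wb v; have := wi_le v; move: NC Cn; rewrite mulnCA; slia.
have NV : #|'I_n| < N by rewrite card_ord; move: NC; slia.
have gE' rho : rho \in X -> greedy (ans e) X rho bet wi N (E rho).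
  by move=> rX; have := gE (rho := rho); rewrite (klass_eq rX).
rewrite -[_./2]divn2 leq_divRL // mulnC.
have [h _] := kM; have [|_ hm] := h (part x); first by apply/set0Pn; exists x; rewrite inE.
have XE v : (v \in X) = (v \in cls part (part x)) by rewrite !inE.
case: hm => [[rho rX hu]|[rho rX hd]].
  rewrite -XE in rX; apply: (bf_up aT cX NV pw wb gE' Gv c_ell cC N16 rX _ YX cY Y0).
  move=> v x1 vX x1X; rewrite pthC pth_onpath // => p; apply: bet_mono; apply: w_mono.
  by apply: hu; rewrite -?XE // -(pth_onpath treeE) pthC (pth_onpath treeE).
rewrite -XE in rX.
have := bf_down aT cX NV pw wb gE' Gv c_ell cC N16 96 rX _ YX cY Y0.
set b := bf _ _ _ _ _ _ _ _; move=> h2; suff : b <= 6 * icost wi D by slia.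
apply: h2 => v x1 vX x1X; rewrite pth_onpath // => p; apply: bet_mono; apply: w_mono.
by apply: hd; rewrite -?XE.
Qed.

End Bounds.

(** * A small programming language and its compiler *)

Inductive expr : Type :=
| ENum of nat | EN | EVar of nat | EIn of expr
| EAdd of expr & expr | ESub of expr & expr | EIf of expr & expr & expr
| ELoop of expr & expr.

Definition push (T : Type) (v : T) (f : nat -> T) : nat -> T := fun x => if x is x'.+1 then f x' else v.

(* In the body of a loop, variable 0 is the counter and variable 1 the accumulator. *)
Fixpoint eval (N : nat) (inp : nat -> nat) (ex : expr) (rho : nat -> nat) : nat :=
  match ex with
  | ENum c => c
  | EN => N
  | EVar x => rho x
  | EIn ex => inp (eval N inp ex rho)
  | EAdd e1 e2 => eval N inp e1 rho + eval N inp e2 rho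
  | ESub e1 e2 => eval N inp e1 rho - eval N inp e2 rho
  | EIf e1 e2 e3 => if eval N inp e1 rho == 0 then eval N inp e3 rho else eval N inp e2 rho
  | ELoop e0 e1 => iteri N (fun x y => eval N inp e1 (push x (push y rho))) (eval N inp e0 rho)
  end.

(* Temporaries and variables alternate on the even cells from 8 on. The copy of the input occupies
   every other cell from the odd address B on, so that it is never overwritten. *)
Definition T k := 10 + 4 * k.
Definition Var x := 8 + 4 * x.

(** [s] gives the cells of the variables, [k] the first free temporary and [o] the absolute address
    of the code, which jumps need. Both branches of a conditional are evaluated and one result is
    selected, so running times simply add up. *)
Fixpoint ce (ex : expr) (s : nat -> nat) (k o : nat) : seq instr :=
  match ex with
  | ENum c => [:: NConst (T k) c]
  | EN => [:: NAdd (T k) 4 0]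
  | EVar x => [:: NAdd (T k) (s x) 0]
  | EIn ex => ce ex s k o ++ [:: NAdd (T k) (T k) (T k); NAdd (T k) (T k) 6; NLoad (T k) (T k)]
  | EAdd e1 e2 => let c1 := ce e1 s k o in
      c1 ++ ce e2 s k.+1 (o + size c1) ++ [:: NAdd (T k) (T k) (T k.+1)]
  | ESub e1 e2 => let c1 := ce e1 s k o in
      c1 ++ ce e2 s k.+1 (o + size c1) ++ [:: NSub (T k) (T k) (T k.+1)]
  | EIf e1 e2 e3 => let c1 := ce e1 s k o in let c2 := ce e2 s k.+1 (o + size c1) in
      let c3 := ce e3 s k.+2 (o + size c1 + size c2) in let o' := o + size c1 + size c2 + size c3 in
      c1 ++ c2 ++ c3 ++ [:: JLe (T k) 0 (o' + 3); NAdd (T k) (T k.+1) 0; JLe 0 0 (o' + 4); NAdd (T k) (T k.+2) 0]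
  | ELoop e0 e1 => let c0 := ce e0 s k o in let l := o + size c0 + 1 in
      let c1 := ce e1 (push (T k.+1) (push (T k) s)) k.+2 (l + 1) in
      c0 ++ [:: NConst (T k.+1) 0; JLe 4 (T k.+1) (l + size c1 + 4)] ++ c1 ++
      [:: NAdd (T k) (T k.+2) 0; NAdd (T k.+1) (T k.+1) 2; JLe 0 0 l]
  end.

Fixpoint te (N : nat) (ex : expr) : nat :=
  match ex with
  | EIn ex => te N ex + 3
  | EAdd e1 e2 | ESub e1 e2 => te N e1 + te N e2 + 1
  | EIf e1 e2 e3 => te N e1 + te N e2 + te N e3 + 3
  | ELoop e0 e1 => te N e0 + 2 + N * (te N e1 + 4)
  | _ => 1
  end.

Section Machine.
Variables (R : realType) (orc : nat -> nat * R) (p : seq instr).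

Definition stepn m (c : config R) : option (config R) := iter m (obind (step orc p)) (Some c).
Definition reach t (c c' : config R) := exists2 m, m <= t & stepn m c = Some c'.

Lemma stepnD m1 m2 c c' : stepn m1 c = Some c' -> stepn (m2 + m1) c = stepn m2 c'.
Proof. by rewrite /stepn iterD => ->. Qed.

Lemma reach_refl c : reach 0 c c. Proof. by exists 0. Qed.

Lemma reach_trans c1 c2 c3 t1 t2 : reach t1 c1 c2 -> reach t2 c2 c3 -> reach (t1 + t2) c1 c3.
Proof.
move=> [m1 h1 e1] [m2 h2 e2]; exists (m2 + m1); first by rewrite addnC leq_add.
by rewrite (stepnD _ e1).
Qed.

Lemma reach_le c1 c2 t1 t2 : t1 <= t2 -> reach t1 c1 c2 -> reach t2 c1 c2.
Proof. by move=> h [m hm e]; exists m => //; apply: leq_trans hm h. Qed.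

Lemma reach_step c c1 c2 t : step orc p c = Some c1 -> reach t c1 c2 -> reach t.+1 c c2.
Proof. by move=> e [m h e2]; exists m.+1 => //; rewrite -addn1 (@stepnD 1 m c c1). Qed.

Definition code_at o (c : seq instr) := forall i, i < size c -> o + i < size p /\ nth (NConst 0 0) p (o + i) = nth (NConst 0 0) c i.

Lemma code_cat o c1 c2 : code_at o (c1 ++ c2) -> code_at o c1 /\ code_at (o + size c1) c2.
Proof.
move=> h; split=> i hi.
  have [|h1 h2] := h i; first by rewrite size_cat ltn_addr.
  by split=> //; rewrite h2 nth_cat hi.
have [|h1 h2] := h (size c1 + i); first by rewrite size_cat ltn_add2l.
by rewrite -addnA; split=> //; rewrite h2 nth_cat ltnNge leq_addr addKn.
Qed.

Lemma code_cons o i c : code_at o (i :: c) ->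
  [/\ o < size p, nth (NConst 0 0) p o = i & code_at o.+1 c].
Proof.
move=> h; have [//|h1 h2] := h 0; rewrite addn0 in h1 h2; split=> // j hj.
by have := h j.+1 hj; rewrite addnS -addSn.
Qed.

Lemma updE (A : Type) (f : nat -> A) a v : upd f a v a = v. Proof. by rewrite /upd eqxx. Qed.
Lemma updN (A : Type) (f : nat -> A) a v x : x <> a -> upd f a v x = f x.
Proof. by rewrite /upd; case: eqP. Qed.

Variables (N B : nat) (inp : nat -> nat).
Hypothesis Bodd : odd B.

Definition regs (M : nat -> nat) :=
  [/\ M 0 = 0, M 2 = 1, M 4 = N, M 6 = B & forall i, M (B + 2 * i) = inp i].

Definition frame k (M M' : nat -> nat) := forall x, (forall j, k <= j -> x <> T j) -> M' x = M x.

Lemma frame_trans k M1 M2 M3 : frame k M1 M2 -> frame k M2 M3 -> frame k M1 M3.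
Proof. by move=> h1 h2 x hx; rewrite h2 ?h1. Qed.
Lemma frameS k k' M1 M2 : k <= k' -> frame k' M1 M2 -> frame k M1 M2.
Proof. by move=> h h1 x hx; apply: h1 => j hj; apply: hx; apply: leq_trans hj. Qed.
Lemma frame_upd k j M v : k <= j -> frame k M (upd M (T j) v).
Proof. by move=> h x hx; apply: updN; apply: hx. Qed.

Lemma regs_frame k M M' : regs M -> frame k M M' -> regs M'.
Proof.
move=> [h0 h1 h2 h3 h4] f; split; try (rewrite f //; by move=> j _; rewrite /T; lia).
move=> i; rewrite f //; move=> j _ h; move: Bodd.
have -> : B = 2 * (5 + 2 * j - i) by move: h; rewrite /T; lia.
by rewrite mul2n odd_double.
Qed.

Lemma frame_low k M M' j : frame k M M' -> j < k -> M' (T j) = M (T j).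
Proof. by clear; move=> f h; apply: f => i hi; rewrite /T; lia. Qed.

Lemma ce_ok ex : forall s k o M X q rho, code_at o (ce ex s k o) -> regs M -> (forall x, M (s x) = rho x) ->
  (forall x j, k <= j -> s x <> T j) ->
  exists M', [/\ reach (te N ex) (Config o M X q) (Config (o + size (ce ex s k o)) M' X q),
    M' (T k) = eval N inp ex rho & frame k M M'].
Proof.
elim: ex => [c||x|ex IH|e1 IH1 e2 IH2|e1 IH1 e2 IH2|e1 IH1 e2 IH2 e3 IH3|e0 IH0 e1 IH1] s k o M X q rho hc hr hs hk.
- have [h1 h2 _] := code_cons hc; exists (upd M (T k) c); split.
  + by apply: reach_step (reach_refl _); rewrite /= h1 h2 addn1.
  + exact: updE.
  + exact: frame_upd.
- have [h1 h2 _] := code_cons hc; have [r0 _ rN _ _] := hr; exists (upd M (T k) N); split.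
  + by apply: reach_step (reach_refl _); rewrite /= h1 h2 addn1 r0 rN addn0.
  + exact: updE.
  + exact: frame_upd.
- have [h1 h2 _] := code_cons hc; have [r0 _ _ _ _] := hr; exists (upd M (T k) (rho x)); split.
  + by apply: reach_step (reach_refl _); rewrite /= h1 h2 addn1 r0 hs addn0.
  + exact: updE.
  + exact: frame_upd.
- move: hc => /= /code_cat[hc1 hc2]; have [M1 [m1 v1 f1]] := IH s k o M X q rho hc1 hr hs hk.
  have r1 := regs_frame hr f1; have [a1 b1 /code_cons[a2 b2 /code_cons[a3 b3 _]]] := code_cons hc2.
  set v := eval N inp ex rho in v1.
  exists (upd (upd (upd M1 (T k) (v + v)) (T k) (v + v + B)) (T k) (inp v)); split.
  + apply: reach_trans m1 _; rewrite size_cat /= addnA !addnS addn0.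
    apply: reach_step; first by rewrite /= a1 b1 v1.
    have n6 : 6 <> T k by rewrite /T; lia.
    have rB : M1 6 = B by have [] := r1.
    apply: reach_step; first by rewrite /= a2 b2 updE (updN _ _ n6) rB.
    apply: reach_step (reach_refl _); rewrite /= a3 b3 updE; congr (Some (Config _ (upd _ _ _) _ _)).
    rewrite !updN.
    * by have [_ _ _ _ h] := r1; rewrite -h; congr M1; lia.
    * move=> h; move: Bodd; have -> : B = 2 * (5 + 2 * k - v) by move: h; rewrite /T; lia.
      by rewrite mul2n odd_double.
    * move=> h; move: Bodd; have -> : B = 2 * (5 + 2 * k - v) by move: h; rewrite /T; lia.
      by rewrite mul2n odd_double.
  + exact: updE.
  + by apply: frame_trans f1 _; do 3! (apply: frame_trans; last exact: frame_upd).
- move: hc => /= /code_cat[hc1 /code_cat[hc2 hc3]].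
  have [M1 [m1 v1 f1]] := IH1 s k o M X q rho hc1 hr hs hk; have r1 := regs_frame hr f1.
  have hs1 x : M1 (s x) = rho x by rewrite f1 // => j hj; apply: hk.
  have [|M2 [m2 v2 f2]] := IH2 s k.+1 _ M1 X q rho hc2 r1 hs1; first by move=> x j h; apply: hk; apply: ltnW.
  have [a1 b1 _] := code_cons hc3.
  exists (upd M2 (T k) (eval N inp e1 rho + eval N inp e2 rho)); split.
  + rewrite [te _ _]/= -addnA; apply: reach_trans m1 _; apply: reach_trans m2 _.
    apply: reach_step (reach_refl _); rewrite /= a1 b1 v2 (frame_low f2) // v1; congr (Some (Config _ _ _ _)).
    by rewrite !size_cat /=; lia.
  + exact: updE.
  + apply: frame_trans f1 _; apply: frame_trans (frameS (leqnSn k) f2) _; exact: frame_upd.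
- move: hc => /= /code_cat[hc1 /code_cat[hc2 hc3]].
  have [M1 [m1 v1 f1]] := IH1 s k o M X q rho hc1 hr hs hk; have r1 := regs_frame hr f1.
  have hs1 x : M1 (s x) = rho x by rewrite f1 // => j hj; apply: hk.
  have [|M2 [m2 v2 f2]] := IH2 s k.+1 _ M1 X q rho hc2 r1 hs1; first by move=> x j h; apply: hk; apply: ltnW.
  have [a1 b1 _] := code_cons hc3.
  exists (upd M2 (T k) (eval N inp e1 rho - eval N inp e2 rho)); split.
  + rewrite [te _ _]/= -addnA; apply: reach_trans m1 _; apply: reach_trans m2 _.
    apply: reach_step (reach_refl _); rewrite /= a1 b1 v2 (frame_low f2) // v1; congr (Some (Config _ _ _ _)).
    by rewrite !size_cat /=; lia.
  + exact: updE.
  + apply: frame_trans f1 _; apply: frame_trans (frameS (leqnSn k) f2) _; exact: frame_upd.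
- move: hc; rewrite [ce _ _ _ _]/=; set c1 := ce e1 s k o; set c2 := ce e2 s k.+1 (o + size c1).
  set c3 := ce e3 s k.+2 (o + size c1 + size c2); set o' := o + size c1 + size c2 + size c3.
  move=> /code_cat[hc1 /code_cat[hc2 /code_cat[hc3 hc4]]]; rewrite -/o' in hc4.
  have eo : o + size (c1 ++ c2 ++ c3 ++ [:: JLe (T k) 0 (o' + 3); NAdd (T k) (T k.+1) 0; JLe 0 0 (o' + 4); NAdd (T k) (T k.+2) 0]) = o' + 4.
    by rewrite !size_cat /= /o'; lia.
  rewrite eo.
  have [M1 [m1 v1 f1]] := IH1 s k o M X q rho hc1 hr hs hk; have r1 := regs_frame hr f1.
  have hs1 x : M1 (s x) = rho x by rewrite f1 // => j hj; apply: hk.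
  have hk1 x j : k.+1 <= j -> s x <> T j by move=> h; apply: hk; apply: ltnW.
  have hk2 x j : k.+2 <= j -> s x <> T j by move=> h; apply: hk1; apply: ltnW.
  have [M2 [m2 v2 f2]] := IH2 s k.+1 _ M1 X q rho hc2 r1 hs1 hk1; have r2 := regs_frame r1 f2.
  have hs2 x : M2 (s x) = rho x by rewrite f2 // => j hj; apply: hk1.
  have [M3 [m3 v3 f3]] := IH3 s k.+2 _ M2 X q rho hc3 r2 hs2 hk2; have r3 := regs_frame r2 f3.
  have [a1 b1 /code_cons[a2 b2 /code_cons[a3 b3 /code_cons[a4 b4 _]]]] := code_cons hc4.
  have [r0 _ _ _ _] := r3.
  have w1 : M3 (T k) = eval N inp e1 rho by rewrite (frame_low f3) ?(frame_low f2) //; lia.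
  have w2 : M3 (T k.+1) = eval N inp e2 rho by rewrite (frame_low f3).
  have nk x : 0 <> T x by rewrite /T; lia.
  exists (upd M3 (T k) (eval N inp (EIf e1 e2 e3) rho)); split.
  + have -> : te N (EIf e1 e2 e3) = te N e1 + (te N e2 + (te N e3 + 3)) by rewrite /= !addnA.
    apply: reach_trans m1 _; apply: reach_trans m2 _; apply: reach_trans m3 _.
    rewrite /=; case: eqP => h0.
    * apply: (@reach_le _ _ 2) => //; apply: reach_step; first by rewrite /= a1 b1 w1 h0 r0.
      rewrite [o' + 3]addnS [o' + 2]addnS addn1.
      by apply: reach_step (reach_refl _); rewrite /= a4 b4 v3 r0 !addnS !addn0.
    * apply: reach_step; first by rewrite /= a1 b1 w1 r0 leqn0 (negbTE (introN eqP h0)).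
      apply: reach_step; first by rewrite /= a2 b2 w2 r0 addn0.
      by apply: reach_step (reach_refl _); rewrite /= a3 b3 leqnn.
  + exact: updE.
  + apply: frame_trans f1 _; apply: frame_trans (frameS (leqnSn k) f2) _.
    by apply: frame_trans (frameS _ f3) _; [lia | exact: frame_upd].
- move: hc => /= /code_cat[hc1 /code_cons[a1 b1 /code_cons[a2 b2 /code_cat[hc2 hc3]]]].
  have [M1 [m1 v1 f1]] := IH0 s k o M X q rho hc1 hr hs hk; have r1 := regs_frame hr f1.
  set l := o + size (ce e0 s k o) + 1 in b2 hc2 hc3 *.
  set c1 := ce e1 _ _ _ in b2 hc2 hc3 *.
  have el : l = (o + size (ce e0 s k o)).+1 by rewrite /l addn1.
  rewrite -el in a2 b2 hc2 hc3.
  have el' : l.+1 = l + 1 by rewrite addn1.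
  rewrite el' in hc2 hc3.
  have [a3 b3 /code_cons[a4 b4 /code_cons[a5 b5 _]]] := code_cons hc3.
  pose F x y := eval N inp e1 (push x (push y rho)).
  have hs1 x : M1 (s x) = rho x by rewrite f1 // => j hj; apply: hk.
  have loop i : i <= N -> exists M', [/\ reach (te N e0 + 1 + i * (te N e1 + 4)) (Config o M X q) (Config l M' X q),
      M' (T k) = iteri i F (eval N inp e0 rho), M' (T k.+1) = i & frame k M M'].
    elim: i => [|i IHi] hi.
      exists (upd M1 (T k.+1) 0); split; rewrite ?updE //.
      - by rewrite mul0n addn0 addn1 -addn1; apply: reach_trans m1 _; apply: reach_step (reach_refl _); rewrite /= a1 b1 el.
      - by rewrite updN //=; rewrite /T; lia.
      - by apply: frame_trans f1 _; apply: frame_upd.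
    have [M2 [m2 v2 i2 f2]] := IHi (ltnW hi); have r2 := regs_frame hr f2.
    have [||M3 [m3 v3 f3]] := IH1 _ _ _ M2 X q (push i (push (iteri i F (eval N inp e0 rho)) rho)) hc2 r2.
    - by move=> [|[|x]] //=; rewrite f2 // => j hj; apply: hk.
    - by move=> [|[|x]] j /= h; [rewrite /T; lia | rewrite /T; lia | apply: hk; apply: leq_trans h; lia].
    have r3 := regs_frame r2 f3; have [z0 z1 zN _ _] := r3; have [_ _ zN2 _ _] := r2.
    exists (upd (upd M3 (T k) (F i (iteri i F (eval N inp e0 rho)))) (T k.+1) i.+1); split.
    - apply: (@reach_le _ _ ((te N e0 + 1 + i * (te N e1 + 4)) + (te N e1 + 3).+1)).
        by rewrite mulSn; lia.
      apply: reach_trans m2 _.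
      apply: reach_step; first by rewrite /= a2 b2 zN2 i2 leqNgt hi /= el'.
      apply: reach_trans m3 _.
      apply: reach_step; first by rewrite /= a3 b3 v3 z0 addn0.
      have nT : T k.+1 <> T k by rewrite /T; lia.
      have n2 : 2 <> T k by rewrite /T; lia.
      have e3 : M3 (T k.+1) = i by rewrite (frame_low f3).
      apply: reach_step; first by rewrite /= a4 b4 (updN _ _ nT) (updN _ _ n2) e3 z1 [i + 1]addn1.
      by apply: reach_step (reach_refl _); rewrite /= a5 b5 leqnn.
    - have nT : T k <> T k.+1 by rewrite /T; lia.
      by rewrite (updN _ _ nT) updE.
    - by rewrite updE.
    - apply: frame_trans f2 _; apply: frame_trans (frameS _ f3) _; first lia.
      by do 2! (apply: frame_trans; last by apply: frame_upd; lia).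
  have [M2 [m2 v2 i2 f2]] := loop N (leqnn N); have [_ _ zN2 _ _] := regs_frame hr f2.
  exists M2; split=> //.
  apply: reach_le (reach_trans m2 _); last first.
    apply: reach_step (reach_refl _); rewrite /= a2 b2 i2 zN2 leqnn; congr (Some (Config _ _ _ _)).
    by rewrite !size_cat /= size_cat /=; lia.
  by lia.
Qed.

End Machine.

(** * Commands with real registers and queries *)

Inductive cmd : Type :=
| CSet of nat & expr | CSeq of cmd & cmd | CRep of cmd | CIf of expr & cmd
| CClr of bool | CAddW of bool & expr | CTest of nat & bool & bool | CQuery of nat & expr.

(** Real cells 0 and 1 are the registers, indexed by booleans, and real cell 2 is scratch. No
    instruction loads a real constant, so zero is obtained as [b - b]. *)
Fixpoint cc (c : cmd) (k o : nat) : seq instr :=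
  match c with
  | CSet x ex => ce ex Var k o ++ [:: NAdd (Var x) (T k) 0]
  | CSeq c1 c2 => let p1 := cc c1 k o in p1 ++ cc c2 k (o + size p1)
  | CRep c => let p := cc c k.+1 (o + 2) in
      [:: NConst (T k) 0; JLe 4 (T k) (o + size p + 4)] ++ p ++ [:: NAdd (T k) (T k) 2; JLe 0 0 o.+1]
  | CIf ex c => let p0 := ce ex Var k o in let p := cc c k (o + size p0 + 1) in
      p0 ++ [:: JLe (T k) 0 (o + size p0 + 1 + size p)] ++ p
  | CClr b => [:: RSub b b b]
  | CAddW b ex => ce ex Var k o ++ [:: NAdd (T k) (T k) 6; RLoad 2 (T k); RAdd b b 2]
  | CTest x b b' => [:: NConst (Var x) 1; RJLe b b' (o + 3); NConst (Var x) 0]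
  | CQuery x ex => ce ex Var k o ++ [:: Query (T k) (Var x)]
  end.

Fixpoint tc (N : nat) (c : cmd) : nat :=
  match c with
  | CSet x ex => te N ex + 1
  | CSeq c1 c2 => tc N c1 + tc N c2
  | CRep c => 2 + N * (tc N c + 3)
  | CIf ex c => te N ex + 1 + tc N c
  | CAddW b ex => te N ex + 3
  | CQuery x ex => te N ex + 1
  | _ => 3
  end.

Section Poly.
Definition poly_bounded (f : nat -> nat) := exists c d, forall N, f N <= c * N.+1 ^ d.

Lemma poly_const m : poly_bounded (fun=> m).
Proof. by exists m, 0 => N; rewrite expn0 muln1. Qed.
Lemma poly_add f g : poly_bounded f -> poly_bounded g -> poly_bounded (fun N => f N + g N).
Proof.
move=> [c [d hf]] [c' [d' hg]]; exists (c + c'), (d + d') => N; rewrite mulnDl; apply: leq_add.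
  by apply: leq_trans (hf N) _; rewrite leq_mul2l leq_pexp2l ?leq_addr ?orbT.
by apply: leq_trans (hg N) _; rewrite leq_mul2l leq_pexp2l ?leq_addl ?orbT.
Qed.
Lemma poly_mul f : poly_bounded f -> poly_bounded (fun N => N * f N).
Proof.
move=> [c [d hf]]; exists c, d.+1 => N; rewrite expnS mulnCA; apply: leq_mul => //.
Qed.

Lemma te_poly ex : poly_bounded (te ^~ ex).
Proof.
elim: ex => /= [c||x|ex IH|e1 IH1 e2 IH2|e1 IH1 e2 IH2|e1 IH1 e2 IH2 e3 IH3|e0 IH0 e1 IH1].
all: repeat (apply: poly_add || apply: poly_mul || apply: poly_const || assumption).
Qed.

Lemma tc_poly c : poly_bounded (tc ^~ c).
Proof.
elim: c => /= [x ex|c1 IH1 c2 IH2|c IH|ex c IH|b|b ex|x b b'|x ex].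
all: repeat (apply: poly_add || apply: poly_mul || apply: poly_const || apply: te_poly || assumption).
Qed.
End Poly.

Record state (R : realType) := State { rho : nat -> nat; rg : bool -> R; qc : R }.

Section Exec.
Variables (R : realType) (orc : nat -> nat * R) (N : nat) (inp : nat -> nat) (wt : nat -> R).
Implicit Types s : state R.

Definition setv s x v := State (upd (rho s) x v) (rg s) (qc s).
Definition setr s b (v : R) := State (rho s) (fun b' => if b' == b then v else rg s b') (qc s).

Fixpoint exec (c : cmd) s : state R :=
  match c with
  | CSet x ex => setv s x (eval N inp ex (rho s))
  | CSeq c1 c2 => exec c2 (exec c1 s)
  | CRep c => iter N (exec c) s
  | CIf ex c => if eval N inp ex (rho s) == 0 then s else exec c s
  | CClr b => setr s b 0%R
  | CAddW b ex => setr s b (rg s b + wt (eval N inp ex (rho s)))%R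
  | CTest x b b' => setv s x (rg s b <= rg s b')%R
  | CQuery x ex => let: (u, v) := orc (eval N inp ex (rho s)) in
      State (upd (rho s) x u) (rg s) (qc s + v)%R
  end.

Variables (p : seq instr) (B : nat).
Hypotheses (Bodd : odd B) (B3 : 3 <= B).
Notation reach := (reach orc p).
Notation regs := (regs N B inp).

Definition rep (M : nat -> nat) (X : nat -> R) s :=
  [/\ regs M, forall x, M (Var x) = rho s x, forall b : bool, X b = rg s b & forall i, X (B + i) = wt i].

Lemma VarT x k : Var x <> T k. Proof. by rewrite /Var /T; lia. Qed.
Lemma TVar x k : T k <> Var x. Proof. by rewrite /Var /T; lia. Qed.
Lemma Var_inj x y : (Var x == Var y) = (x == y). Proof. by rewrite /Var; lia. Qed.

Lemma regs_Var M x v : regs M -> regs (upd M (Var x) v).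
Proof.
move=> [h0 h1 h2 h3 h4]; split; try (by rewrite updN //; rewrite /Var; lia).
move=> i; rewrite updN //; move=> h; move: Bodd.
have -> : B = 2 * (4 + 2 * x - i) by move: h; rewrite /Var; lia.
by rewrite mul2n odd_double.
Qed.

Lemma rep_frame M M' X s k : rep M X s -> frame k M M' -> rep M' X s.
Proof.
move=> [h1 h2 h3 h4] f; split=> //; first exact: (regs_frame Bodd h1 f).
by move=> x; rewrite f // => j _; apply: VarT.
Qed.

Lemma rep_set M X s x v : rep M X s -> rep (upd M (Var x) v) X (setv s x v).
Proof.
move=> [h1 h2 h3 h4]; split=> //; first exact: regs_Var.
by move=> y /=; rewrite /upd Var_inj h2.
Qed.

Lemma rep_setr M X s (b : bool) v : rep M X s -> rep M (upd X b v) (setr s b v).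
Proof.
move=> [h1 h2 h3 h4]; split=> //= [b'|i].
  by rewrite /upd; case: b b' => [] [] //=; rewrite -h3.
by rewrite updN //; move: B3; case: b => /=; lia.
Qed.

Definition keep k (M M' : nat -> nat) := forall j, j < k -> M' (T j) = M (T j).

Lemma cc_ok c : forall k o M X s, code_at p o (cc c k o) -> rep M X s ->
  exists M' X', [/\ reach (tc N c) (Config o M X (qc s)) (Config (o + size (cc c k o)) M' X' (qc (exec c s))),
    rep M' X' (exec c s) & keep k M M'].
Proof.
have E ex k o M X s : code_at p o (ce ex Var k o) -> rep M X s -> exists M',
    [/\ reach (te N ex) (Config o M X (qc s)) (Config (o + size (ce ex Var k o)) M' X (qc s)),
    M' (T k) = eval N inp ex (rho s) & frame k M M'].
  by move=> hc [h1 h2 h3 h4]; apply: (ce_ok orc Bodd X (qc s) hc h1 h2) => x j _; apply: VarT.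
elim: c => [x ex|c1 IH1 c2 IH2|c IH|ex c IH|b|b ex|x b b'|x ex] k o M X s hc hr.
- move: hc => /= /code_cat[hc1 /code_cons[a1 b1 _]]; have [M1 [m1 v1 f1]] := E _ _ _ _ _ _ hc1 hr.
  have r1 := rep_frame hr f1; have [[z0 _ _ _ _] _ _ _] := r1.
  exists (upd M1 (Var x) (eval N inp ex (rho s))), X; split.
  + apply: reach_trans m1 _; apply: reach_step (reach_refl _ _ _); rewrite /= a1 b1 v1 z0 addn0.
    by rewrite size_cat addnA addn1.
  + exact: rep_set.
  + by move=> j hj; rewrite updN; [exact: (frame_low f1) | exact: TVar].
- move: hc => /= /code_cat[hc1 hc2]; have [M1 [X1 [m1 r1 k1]]] := IH1 _ _ _ _ _ hc1 hr.
  have [M2 [X2 [m2 r2 k2]]] := IH2 _ _ _ _ _ hc2 r1.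
  exists M2, X2; split=> //; first by rewrite size_cat addnA; apply: reach_trans m1 m2.
  by move=> j hj; rewrite k2 ?k1.
- move: hc => /= /code_cons[a1 b1 /code_cons[a2 b2 /code_cat[hc hc3]]].
  set q := cc c k.+1 (o + 2) in b2 hc hc3 *; rewrite -[o.+2]addn2 in hc hc3.
  have [a3 b3 /code_cons[a4 b4 _]] := code_cons hc3.
  have loop i : i <= N -> exists M' X', [/\ reach (1 + i * (tc N c + 3)) (Config o M X (qc s)) (Config o.+1 M' X' (qc (iter i (exec c) s))),
      rep M' X' (iter i (exec c) s), M' (T k) = i & keep k M M'].
    elim: i => [|i IHi] hi.
      exists (upd M (T k) 0), X; split; rewrite ?updE //.
      + by apply: reach_step (reach_refl _ _ _); rewrite /= a1 b1.
      + by apply: rep_frame hr _; apply: (frame_upd (k := k)).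
      + by move=> j hj; rewrite updN //; rewrite /T; lia.
    have [M1 [X1 [m1 r1 v1 k1]]] := IHi (ltnW hi).
    have [M2 [X2 [m2 r2 k2]]] := IH _ _ _ _ _ hc r1.
    have [[_ _ zN _ _] _ _ _] := r1; have [[_ z1 _ _ _] _ _ _] := r2.
    have v2 : M2 (T k) = i by rewrite k2.
    exists (upd M2 (T k) i.+1), X2; split.
    + apply: (@reach_le _ _ _ _ _ ((1 + i * (tc N c + 3)) + (tc N c + 2).+1)); first by rewrite mulSn; lia.
      apply: reach_trans m1 _; apply: reach_step; first by rewrite /= a2 b2 zN v1 leqNgt hi.
      rewrite -[o.+2]addn2; apply: reach_trans m2 _.
      apply: reach_step; first by rewrite /= a3 b3 v2 z1 addn1.
      by apply: reach_step (reach_refl _ _ _); rewrite /= a4 b4 leqnn.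
    + by apply: rep_frame r2 _; apply: (frame_upd (k := k)).
    + exact: updE.
    + by move=> j hj; rewrite updN ?k2 ?k1 //; [apply: ltnW | rewrite /T; lia].
  have [M2 [X2 [m2 r2 v2 k2]]] := loop N (leqnn N); have [[_ _ zN _ _] _ _ _] := r2.
  exists M2, X2; split=> //.
  apply: (@reach_le _ _ _ _ _ ((1 + N * (tc N c + 3)) + 1)); first by lia.
  apply: reach_trans m2 _; apply: reach_step (reach_refl _ _ _); rewrite /= a2 b2 v2 zN leqnn.
  by congr (Some (Config _ _ _ _)); rewrite size_cat /=; lia.
- move: hc => /= /code_cat[hc1 /code_cons[a1 b1 hc2]]; have [M1 [m1 v1 f1]] := E _ _ _ _ _ _ hc1 hr.
  have r1 := rep_frame hr f1; have [[z0 _ _ _ _] _ _ _] := r1.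
  set q := cc c k _ in b1 hc2 *; rewrite -addn1 in hc2.
  case: eqP => h0.
    exists M1, X; split=> //; last by move=> j; apply: frame_low f1.
    apply: (@reach_le _ _ _ _ _ (te N ex + 1)); first by lia.
    apply: reach_trans m1 _; apply: reach_step (reach_refl _ _ _); rewrite /= a1 b1 v1 z0 h0.
    by rewrite size_cat /= -/q addnA -addn1 addnAC; congr (Some (Config _ _ _ _)); lia.
  have [M2 [X2 [m2 r2 k2]]] := IH _ _ _ _ _ hc2 r1.
  exists M2, X2; split=> //; last by move=> j hj; rewrite k2 //; exact: (frame_low f1).
  rewrite -addnA; apply: reach_trans m1 _; apply: reach_step; first by rewrite /= a1 b1 v1 z0 leqn0 (negbTE (introN eqP h0)).
  rewrite -addn1; have -> : o + size (ce ex Var k o ++ [:: JLe (T k) 0 (o + size (ce ex Var k o) + 1 + size q)] ++ q) =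
    o + size (ce ex Var k o) + 1 + size q by rewrite size_cat /=; lia.
  exact: m2.
- move: hc => /= /code_cons[a1 b1 _]; exists M, (upd X b 0%R); split=> //; last exact: rep_setr.
  apply: (@reach_le _ _ _ _ _ 1) => //; apply: reach_step (reach_refl _ _ _).
  by rewrite /= a1 b1 subrr addn1.
- move: hc => /= /code_cat[hc1 /code_cons[a1 b1 /code_cons[a2 b2 /code_cons[a3 b3 _]]]].
  have [M1 [m1 v1 f1]] := E _ _ _ _ _ _ hc1 hr.
  have r1 := rep_frame hr f1; have [[_ _ _ zB _] _ xb xw] := r1.
  set i := eval N inp ex (rho s) in v1 *.
  exists (upd M1 (T k) (B + i)), (upd (upd X 2 (wt i)) b (rg s b + wt i)%R); split.
  + apply: reach_trans m1 _; apply: reach_step; first by rewrite /= a1 b1 v1 zB [i + B]addnC.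
    apply: reach_step; first by rewrite /= a2 b2 updE xw.
    have nb : nat_of_bool b <> 2 by case: (b).
    apply: reach_step (reach_refl _ _ _); rewrite /= a3 b3 updE (updN _ _ nb).
    by rewrite xb size_cat /= addnA !addnS addn0.
  + apply: (@rep_setr _ (upd X 2 (wt i))); have [h1 h2 h3 h4] := rep_frame r1 (frame_upd (k := k) M1 (B + i) (leqnn k)).
    by split=> // [b'|j]; rewrite updN //; [case: b' | move: B3; lia].
  + by move=> j hj; rewrite updN; [exact: (frame_low f1) | rewrite /T; lia].
- move: hc => /= /code_cons[a1 b1 /code_cons[a2 b2 /code_cons[a3 b3 _]]].
  have [_ _ xb _] := hr.
  have r1 := rep_set x 1 hr.
  case: (boolP (rg s b <= rg s b')%R) => h; rewrite /= ?h ?(negbTE h).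
    exists (upd M (Var x) 1), X; split=> //.
    + apply: reach_step; first by rewrite /= a1 b1.
      apply: (@reach_le _ _ _ _ _ 1) => //; apply: reach_step (reach_refl _ _ _).
      by rewrite /= a2 b2 !xb h.
    + by move=> j hj; rewrite updN //; apply: TVar.
  exists (upd (upd M (Var x) 1) (Var x) 0), X; split=> //.
  + apply: reach_step; first by rewrite /= a1 b1.
    apply: reach_step; first by rewrite /= a2 b2 !xb (negbTE h).
    by apply: reach_step (reach_refl _ _ _); rewrite /= a3 b3 !addnS addn0.
  + have [h1 h2 h3 h4] := rep_set x 0 r1; split=> // y; rewrite h2 /= /upd; by case: eqP.
  + by move=> j hj; rewrite !updN //; apply: TVar.
- move: hc => /= /code_cat[hc1 /code_cons[a1 b1 _]]; have [M1 [m1 v1 f1]] := E _ _ _ _ _ _ hc1 hr.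
  have r1 := rep_frame hr f1; case eo : (orc (eval N inp ex (rho s))) => [u v].
  exists (upd M1 (Var x) u), X; split.
  + apply: reach_trans m1 _; apply: reach_step (reach_refl _ _ _); rewrite /= a1 b1 v1 eo.
    by rewrite size_cat addnA addn1.
  + exact: (rep_set x u r1).
  + by move=> j hj; rewrite updN; [exact: (frame_low f1) | exact: TVar].
Qed.

End Exec.

(** * Relocating the input *)

(* Cells 0 and 1 hold n and r, cell 2 holds the diagonal entry 0 of the adjacency matrix, and cell 3
   holds an entry that can be read off its symmetric counterpart (for n = 1, an irrelevant label); the other input cells are copied
   to the addresses B + 2 j. *)
Definition boot1 : seq instr := [:: NConst 3 1; NAdd 1 1 0; NAdd 2 2 3; JLe 0 2 5; JLe 2 0 1].
Definition boot2 : seq instr :=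
  [:: NAdd 2 1 1; NConst 3 21; NAdd 2 2 3; NStore 2 0; NConst 3 2; NAdd 3 2 3; NStore 3 1;
      RStore 3 2; RStore 2 0; NConst 3 1; NAdd 3 2 3; RStore 3 1; NConst 0 0; NAdd 1 2 0; NAdd 0 2 0].
Definition boot3 : seq instr :=
  [:: NConst 3 3; JLe 0 3 31; NConst 3 1; NSub 0 0 3; NAdd 2 0 1; RLoad 2 0; RStore 2 2;
      NAdd 2 2 0; NLoad 3 0; NStore 2 3; JLe 0 0 20].
Definition boot4 : seq instr :=
  [:: NConst 3 2; NAdd 2 1 3; NLoad 2 2; NAdd 4 2 2; NAdd 4 4 4; NAdd 4 4 4; NAdd 4 4 4; NAdd 4 4 4;
      NAdd 4 4 4; NAdd 4 4 4; NAdd 4 4 4; NAdd 4 4 4; NAdd 4 4 4; NConst 0 0; NAdd 6 1 0; NConst 2 1].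
Definition boot := boot1 ++ boot2 ++ boot3 ++ boot4.

Section Boot.
Variables (R : realType) (orc : nat -> nat * R) (p : seq instr).
Notation reach := (reach orc p).
Hypothesis hp : code_at p 0 boot.

Lemma boot_at i : i < 47 -> i < size p /\ nth (NConst 0 0) p i = nth (NConst 0 0) boot i.
Proof. by move=> h; have := hp h. Qed.

Ltac bstep i := let h1 := fresh in let h2 := fresh in
  have [h1 h2] := @boot_at i isT;
  apply: reach_step; [rewrite /= h1 h2 /=; reflexivity | clear h1 h2].

Lemma upd_at (A : Type) (f : nat -> A) a v x : x = a -> upd f a v x = v.
Proof. by move=> ->; rewrite updE. Qed.
Ltac up := repeat first [rewrite updN; [|lia] | rewrite upd_at; [|lia]].

(** The square of [n] is added to [r] by [n] additions, with only cells 2 and 3 as working space. *)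
Lemma boot1_ok M X q : 0 < M 0 -> M 2 = 0 -> exists M', [/\ reach (1 + 4 * M 0) (Config 0 M X q) (Config 5 M' X q),
  M' 0 = M 0, M' 1 = M 1 + M 0 * M 0 & forall x, 3 < x -> M' x = M x].
Proof.
move=> n0 M2; have loop i : i < M 0 -> exists M', [/\ reach (1 + 4 * i) (Config 0 M X q) (Config 1 M' X q),
    [/\ M' 0 = M 0, M' 1 = M 1 + i * M 0, M' 2 = i & M' 3 = 1] & forall x, 3 < x -> M' x = M x].
  elim: i => [|i IH] hi.
    exists (upd M 3 1); split; last by move=> x hx; up.
      by bstep 0; apply: reach_refl.
    by split; up; rewrite ?mul0n ?addn0.
  have [M1 [m1 [h0 h1 h2 h3] h4]] := IH (ltnW hi).
  exists (upd (upd M1 1 (M1 1 + M1 0)) 2 (M1 2 + M1 3)); split; last by move=> x hx; up; apply: h4.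
    apply: (@reach_le _ _ _ _ _ (1 + 4 * i + 4)); first by lia.
    apply: reach_trans m1 _; bstep 1; bstep 2.
    have [b1 b2] := @boot_at 3 isT; apply: reach_step; first by rewrite /= b1 b2 /=; up; rewrite h0 h2 h3 leqNgt addn1 hi.
    have [d1 d2] := @boot_at 4 isT; apply: reach_step (reach_refl _ _ _).
    by rewrite /= d1 d2 /=; up; rewrite h0 h2 h3 addn1 (ltnW hi).
  by split; up; rewrite ?h0 ?h1 ?h2 ?h3 ?addn1 // mulSn; lia.
have [M1 [m1 [h0 h1 h2 h3] h4]] := loop (M 0).-1 ltac:(lia).
exists (upd (upd M1 1 (M1 1 + M1 0)) 2 (M1 2 + M1 3)); split.
- apply: (@reach_le _ _ _ _ _ (1 + 4 * (M 0).-1 + 3)); first by lia.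
  apply: reach_trans m1 _; bstep 1; bstep 2.
  have [b1 b2] := @boot_at 3 isT; apply: reach_step (reach_refl _ _ _).
  by rewrite /= b1 b2 /=; up; rewrite h0 h2 h3 addn1 prednK // leqnn.
- by up.
- by up; rewrite h0 h1 -addnA -mulSnr prednK.
- by move=> x hx; up; apply: h4.
Qed.

(** [B] is odd and lies beyond the input. Real cells 0 to 2 are saved at once, because real cell 2
    is the scratch cell of the copying loop. *)
Lemma boot2_ok M X q B : B = 2 * M 1 + 21 -> exists M' X', [/\ reach 15 (Config 5 M X q) (Config 20 M' X' q),
  [/\ M' 0 = B, M' 1 = B, M' B = M 0, M' (B + 2) = M 1 & forall x, 3 < x < B -> M' x = M x],
  (forall x, 2 < x < B -> X' x = X x) & forall i, i < 3 -> X' (B + i) = X i].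
Proof.
move=> eB.
have [M1 [m1 [h0 h1 h2] h3]] : exists M1, [/\ reach 3 (Config 5 M X q) (Config 8 M1 X q),
    [/\ M1 0 = M 0, M1 1 = M 1 & M1 2 = B] & forall x, 3 < x -> M1 x = M x].
  eexists; split; first by bstep 5; bstep 6; bstep 7; apply: reach_refl.
    by split; up; lia.
  by move=> x hx; up.
have [M2 [m2 [g0 g1 g2 g3 g4] g5]] : exists M2, [/\ reach 3 (Config 8 M1 X q) (Config 11 M2 X q),
    [/\ M2 0 = M 0, M2 1 = M 1, M2 2 = B, M2 3 = B + 2 & M2 B = M 0] & forall x, 3 < x < B -> M2 x = M x].
  eexists; split; first by bstep 8; bstep 9; bstep 10; apply: reach_refl.
    by rewrite h2; split; up; rewrite ?h0 ?h1 ?h2.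
  by move=> x hx; rewrite h2; up; apply: h3; lia.
have [M3 [X3 [m3 [[f0 f1 f2 f4 f6] f5] x1 x2]]] : exists M3 X3, [/\ reach 3 (Config 11 M2 X q) (Config 14 M3 X3 q),
    [/\ M3 0 = M 0, M3 1 = M 1, M3 2 = B, M3 B = M 0 & M3 (B + 2) = M 1] /\ (forall x, 3 < x < B -> M3 x = M x),
    (forall x, x < B -> X3 x = X x) & X3 B = X 0 /\ X3 (B + 2) = X 2].
  eexists; eexists; split; first by bstep 11; bstep 12; bstep 13; apply: reach_refl.
  - rewrite g3; split; last by move=> x hx; up; apply: g5.
    by split; up; rewrite ?g0 ?g1 ?g2 ?g4.
  - have -> : upd M2 (M2 3) (M2 1) 3 = B + 2 by rewrite g3; up.
    have -> : upd M2 (M2 3) (M2 1) 2 = B by rewrite g3; up.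
    by move=> x hx; up.
  - have -> : upd M2 (M2 3) (M2 1) 3 = B + 2 by rewrite g3; up.
    have -> : upd M2 (M2 3) (M2 1) 2 = B by rewrite g3; up.
    by split; up.
have [M4 [X4 [m4 k1 k2 k3]]] : exists M4 X4, [/\ reach 3 (Config 14 M3 X3 q) (Config 17 M4 X4 q),
    [/\ M4 2 = B, M4 B = M 0 & M4 (B + 2) = M 1] /\ (forall x, 3 < x < B -> M4 x = M x),
    (forall x, 2 < x < B -> X4 x = X x) & forall i, i < 3 -> X4 (B + i) = X i].
  eexists; eexists; split; first by bstep 14; bstep 15; bstep 16; apply: reach_refl.
  - by split; [split; up | move=> x hx; up; apply: f5].
  - have -> : upd (upd M3 3 1) 3 (upd M3 3 1 2 + upd M3 3 1 3) 3 = B + 1 by up; rewrite f2.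
    by move=> x hx; up; apply: x1; lia.
  - have -> : upd (upd M3 3 1) 3 (upd M3 3 1 2 + upd M3 3 1 3) 3 = B + 1 by up; rewrite f2.
    case: x2 => x20 x22; move=> [|[|[|i]]] // _; up; rewrite ?addn0 //; apply: x1; lia.
case: k1 => [[c1 c2 c3] c4].
eexists; exists X4; split; last exact: k3.
- rewrite -[15]/(3 + (3 + (3 + (3 + 3)))); apply: reach_trans m1 _; apply: reach_trans m2 _; apply: reach_trans m3 _.
  by apply: reach_trans m4 _; bstep 17; bstep 18; bstep 19; apply: reach_refl.
- by split; [..|move=> x hx]; up; rewrite ?c1 ?addn0 //; apply: c4.
- exact: k2.
Qed.

Lemma boot3_ok M X q B M0 X0 : 21 <= B -> M 0 = B -> M 1 = B -> (forall x, 3 < x < B -> M x = M0 x) ->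
  (forall x, 2 < x < B -> X x = X0 x) -> (forall i, i < 3 -> X (B + i) = X0 i) ->
  exists M' X', [/\ reach (2 + 11 * B) (Config 20 M X q) (Config 31 M' X' q),
    [/\ M' 1 = B, M' B = M B, M' (B + 2) = M (B + 2) & forall i, 3 < i < B -> M' (B + 2 * i) = M0 i] &
    forall i, i < B -> X' (B + i) = X0 i].
Proof.
move=> B21 MB M1 hM hX hX3.
have loop d : d + 3 <= B -> exists M' X', [/\ reach (11 * d) (Config 20 M X q) (Config 20 M' X' q),
    [/\ M' 0 = B - d, M' 1 = B, M' B = M B, M' (B + 2) = M (B + 2) & forall i, 3 < i < B -> M' i = M0 i],
    forall i, 3 < i -> B - d <= i < B -> M' (B + 2 * i) = M0 i, 
    forall x, 2 < x < B -> X' x = X0 x & forall i, i < B -> (i < 3) || (B - d <= i) -> X' (B + i) = X0 i].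
  elim: d => [|d IH] hd.
    exists M, X; split=> //.
    - by rewrite muln0; apply: reach_refl.
    - by split=> //; rewrite subn0.
    - by move=> i h1 h2; lia.
    - by move=> i h1 /orP[h2|h2]; [apply: hX3 | lia].
  have [M1' [X1 [m1 [h0 h1 h2 h3 h4] h5 h6 h7]]] := IH ltac:(lia).
  have [M2 [m2 [g0 g1] g2]] : exists M2, [/\ reach 4 (Config 20 M1' X1 q) (Config 24 M2 X1 q),
      M2 0 = B - d.+1 /\ M2 1 = B & forall x, 3 < x -> M2 x = M1' x].
    eexists; split.
    - bstep 20.
      have [b1 b2] := @boot_at 21 isT; apply: reach_step.
        rewrite /= b1 b2 /=; up; rewrite h0; have -> : (B - d <= 3) = false by lia.
        reflexivity.
      by bstep 22; bstep 23; apply: reach_refl.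
    - by split; up; rewrite // h0; lia.
    - by move=> x hx; up.
  have [M3 [X3 [m3 [f0 f1 f2] f3 x1 x2]]] : exists M3 X3, [/\ reach 3 (Config 24 M2 X1 q) (Config 27 M3 X3 q),
      [/\ M3 0 = B - d.+1, M3 1 = B & M3 2 = B - d.+1 + B] , forall x, 3 < x -> M3 x = M1' x,
      forall x, 2 < x < B -> X3 x = X0 x & forall i, i < B -> (i < 3) || (B - d.+1 <= i) -> X3 (B + i) = X0 i].
    eexists; eexists; split.
    - by bstep 24; bstep 25; bstep 26; apply: reach_refl.
    - by split; up; rewrite ?g0 ?g1.
    - by move=> x hx; up; apply: g2.
    - have e2 : upd M2 2 (M2 0 + M2 1) 2 = B - d.+1 + B by up; rewrite g0 g1.
      have e0 : upd M2 2 (M2 0 + M2 1) 0 = B - d.+1 by up; rewrite g0.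
      by move=> x hx; rewrite e2 e0; up; apply: h6.
    - have e2 : upd M2 2 (M2 0 + M2 1) 2 = B - d.+1 + B by up; rewrite g0 g1.
      have e0 : upd M2 2 (M2 0 + M2 1) 0 = B - d.+1 by up; rewrite g0.
      move=> i h8 h9; rewrite e2 e0.
      have [ei|ni] := eqVneq i (B - d.+1); first by up; rewrite ei h6 //; lia.
      by up; apply: h7 => //; lia.
  (* Index 3 is the exception: cell 3 is scratch in this loop, so its copy is not an input value. *)
  have [M4 [m4 [k0 k1 k3] k4]] : exists M4, [/\ reach 4 (Config 27 M3 X3 q) (Config 20 M4 X3 q),
      [/\ M4 0 = B - d.+1, M4 1 = B & M4 (B + 2 * (B - d.+1)) = M3 (B - d.+1) \/ B - d.+1 = 3] &
      forall x, 3 < x -> x != B + 2 * (B - d.+1) -> M4 x = M1' x].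
    eexists; split.
    - bstep 27; bstep 28; bstep 29.
      have [b1 b2] := @boot_at 30 isT; apply: reach_step; first by rewrite /= b1 b2 /= leqnn; reflexivity.
      exact: reach_refl.
    - have -> : upd (upd M3 2 (M3 2 + M3 0)) 3 (upd M3 2 (M3 2 + M3 0) (upd M3 2 (M3 2 + M3 0) 0)) 2 = B + 2 * (B - d.+1).
        by up; rewrite f2 f0; lia.
      split; up => //; have [->|ne] := eqVneq (B - d.+1) 3; [by right | left].
      have -> : upd M3 2 (M3 2 + M3 0) 0 = B - d.+1 by up.
      by up.
    - have -> : upd (upd M3 2 (M3 2 + M3 0)) 3 (upd M3 2 (M3 2 + M3 0) (upd M3 2 (M3 2 + M3 0) 0)) 2 = B + 2 * (B - d.+1).
        by up; rewrite f2 f0; lia.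
      by move=> x hx hne; up; apply: f3.
  exists M4, X3; split=> //.
  - apply: (@reach_le _ _ _ _ _ (11 * d + (4 + (3 + 4)))); first by lia.
    by apply: reach_trans m1 _; apply: reach_trans m2 _; apply: reach_trans m3 m4.
  - split=> //; try (rewrite k4 //; lia).
    by move=> i hi; rewrite k4 ?h4 //; lia.
  - move=> i h8 h9; have [ei|ni] := eqVneq i (B - d.+1).
      by rewrite ei; case: k3 => [->|e3]; [rewrite f3 ?h4; lia | lia].
    by rewrite k4 ?h5 //; lia.
have [M1' [X1 [m1 [h0 h1 h2 h3 h4] h5 h6 h7]]] := loop (B - 3) ltac:(lia).
eexists; exists X1; split.
- apply: (@reach_le _ _ _ _ _ (11 * (B - 3) + 2)); first by lia.
  apply: reach_trans m1 _; bstep 20.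
  have [b1 b2] := @boot_at 21 isT; apply: reach_step; last exact: reach_refl.
  rewrite /= b1 b2 /=; up; rewrite h0; have -> : (B - (B - 3) <= 3) = true by lia.
  reflexivity.
- by split; [..|move=> i hi]; up => //; apply: h5; lia.
- by move=> i hi; apply: h7 => //; lia.
Qed.

(** Ten doublings give [N = 1024 * m]. As [m] is at least [n * n], this leaves room for all label
    bounds. *)
Lemma boot4_ok M X q B : 21 <= B -> M 1 = B -> exists M', [/\ reach 16 (Config 31 M X q) (Config 47 M' X q),
  [/\ M' 0 = 0, M' 2 = 1, M' 4 = 1024 * M (B + 2) & M' 6 = B] & forall x, B <= x -> M' x = M x].
Proof.
move=> B21 MB.
have [M1 [m1 h1 h2]] : exists M1, [/\ reach 3 (Config 31 M X q) (Config 34 M1 X q), M1 1 = B /\ M1 2 = M (B + 2) &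
    forall x, 3 < x -> M1 x = M x].
  eexists; split; first by bstep 31; bstep 32; bstep 33; apply: reach_refl.
    have -> : upd (upd M 3 2) 2 (upd M 3 2 1 + upd M 3 2 3) 2 = B + 2 by up; rewrite MB.
    by split; up.
  by move=> x hx; up.
case: h1 => h1 h3.
have [M2 [m2 g1 g2]] : exists M2, [/\ reach 5 (Config 34 M1 X q) (Config 39 M2 X q), M2 1 = B /\ M2 4 = 32 * M (B + 2) &
    forall x, 4 < x -> M2 x = M x].
  eexists; split; first by bstep 34; bstep 35; bstep 36; bstep 37; bstep 38; apply: reach_refl.
    by split; up; rewrite ?h3; lia.
  by move=> x hx; up; apply: h2; lia.
case: g1 => g1 g3.
have [M3 [m3 f1 f2]] : exists M3, [/\ reach 5 (Config 39 M2 X q) (Config 44 M3 X q), M3 1 = B /\ M3 4 = 1024 * M (B + 2) &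
    forall x, 4 < x -> M3 x = M x].
  eexists; split; first by bstep 39; bstep 40; bstep 41; bstep 42; bstep 43; apply: reach_refl.
    by split; up; rewrite ?g3; lia.
  by move=> x hx; up; apply: g2.
case: f1 => f1 f3.
eexists; split.
- by rewrite -[16]/(3 + (5 + (5 + 3))); apply: reach_trans m1 _; apply: reach_trans m2 _; apply: reach_trans m3 _;
    bstep 44; bstep 45; bstep 46; apply: reach_refl.
- by split; up; rewrite ?f1 ?addn0.
- by move=> x hx; up; apply: f2; lia.
Qed.

End Boot.

Definition prog (c : cmd) (x : nat) : seq instr := boot ++ cc c 0 47 ++ [:: NAdd 0 (Var x) 0].

Section Run.
Variables (R : realType) (orc : nat -> nat * R).

Lemma run_stepn p m f c c' : stepn orc p m c = Some c' -> step orc p c' = None -> m <= f ->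
  run orc p f c = Some c'.
Proof.
elim: m f c => [|m IH] f c.
  by rewrite /stepn /= => -[->] h _; case: f => /= [|f]; rewrite h.
rewrite /stepn iterSr /=; case e: (step orc p c) => [c1|]; last first.
  by rewrite (_ : iter m _ None = None) //; elim: (m) => //= k ->.
by case: f => // f h1 h2 h3; rewrite /= e; apply: IH.
Qed.

Lemma prog_run (c : cmd) (x : nat) M X q m B N f : 0 < M 0 -> M 2 = 0 -> m = M 1 + M 0 * M 0 -> B = 2 * m + 21 ->
  N = 1024 * m -> 35 + 4 * M 0 + 11 * B + tc N c <= f ->
  exists inp wt s0 fin, [/\ inp 0 = M 0, inp 1 = m, forall j, 3 < j < B -> inp j = M j & forall i, i < B -> wt i = X i] /\
    [/\ qc s0 = q, run orc (prog c x) f (Config 0 M X q) = Some fin,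
      NMem fin 0 = rho (exec orc N inp wt c s0) x & qcost fin = qc (exec orc N inp wt c s0)].
Proof.
move=> M0 M2 em eB eN ht; set p := prog c x.
have [hp hc] : code_at p 0 boot /\ code_at p 47 (cc c 0 47 ++ [:: NAdd 0 (Var x) 0]).
  by apply: (@code_cat p 0 boot) => i hi; rewrite add0n.
have [hc1 /code_cons[a1 b1 _]] := code_cat hc.
have [Ma [ma h0 h1 h2]] := boot1_ok orc hp X q M0 M2; rewrite -em in h1.
have eB' : B = 2 * Ma 1 + 21 by rewrite h1.
have [Mb [Xb [mb [g0 g1 g2 g3 g4] g5 g6]]] := boot2_ok orc hp X q eB'.
have B21 : 21 <= B by rewrite eB leq_addl.
have [Mc [Xc [mc [k1 k2 k3 k4] k5]]] := boot3_ok orc hp q B21 g0 g1 g4 g5 g6.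
have [Md [md [d0 d1 d2 d3] d4]] := boot4_ok orc hp Xc q B21 k1.
pose inp i := Md (B + 2 * i); pose wt i := Xc (B + i).
pose s0 := State (fun x => Md (Var x)) (fun b : bool => Xc b) q.
have Bodd : odd B by rewrite eB mul2n oddD odd_double.
have B3 : 3 <= B by apply: leq_trans B21.
have eNN : 1024 * Mc (B + 2) = N by rewrite k3 g3 h1 eN.
have hr : rep N inp wt B Md Xc s0 by split=> //; split=> //; rewrite d2.
have [Me [Xe [me re _]]] := cc_ok orc Bodd B3 hc1 hr.
exists inp, wt, s0, (Config (47 + size (cc c 0 47)).+1 (upd Me 0 (Me (Var x) + Me 0)) Xe (qc (exec orc N inp wt c s0))).
have [[z0 _ _ _ _] zv _ _] := re.
split.
  split; rewrite /inp /wt.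
  - by rewrite muln0 addn0 d4 // k2 g2.
  - by rewrite muln1 d4 ?leq_addr // k3 g3 h1.
  - by move=> j hj; rewrite d4 ?leq_addr // k4 // h2 //; lia.
  - by move=> i hi; rewrite k5.
split=> //; last by rewrite /= /upd eqxx zv z0 addn0.
have hreach : reach orc p (1 + 4 * M 0 + (15 + (2 + 11 * B + (16 + (tc N c + 1))))) (Config 0 M X q)
    (Config (47 + size (cc c 0 47)).+1 (upd Me 0 (Me (Var x) + Me 0)) Xe (qc (exec orc N inp wt c s0))).
  apply: reach_trans ma _; apply: reach_trans mb _; apply: reach_trans mc _; apply: reach_trans md _.
  apply: reach_trans me _; apply: reach_step; last exact: reach_refl.
  by rewrite /step a1 b1.
have [k hk e] := hreach; apply: run_stepn e _ _; last by apply: leq_trans hk _; lia.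
have sp : size p = (47 + size (cc c 0 47)).+1 by rewrite /p /prog !size_cat addn1 addnS.
by rewrite /step sp ltnn.
Qed.

End Run.

(** * The strategy as an arithmetic expression *)

Definition tl (f : nat -> nat) : nat -> nat := fun x => f x.+1.

Fixpoint ren (f : nat -> nat) (ex : expr) : expr :=
  match ex with
  | EVar x => EVar (f x)
  | EIn ex => EIn (ren f ex)
  | EAdd e1 e2 => EAdd (ren f e1) (ren f e2)
  | ESub e1 e2 => ESub (ren f e1) (ren f e2)
  | EIf e1 e2 e3 => EIf (ren f e1) (ren f e2) (ren f e3)
  | ELoop e0 e1 => ELoop (ren f e0) (ren (fun x => if x is x'.+2 then (f x').+2 else x) e1)
  | _ => ex
  end.

Lemma eval_ext N I ex : forall r1 r2, (forall x, r1 x = r2 x) -> eval N I ex r1 = eval N I ex r2.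
Proof.
elim: ex => //= [ex IH|e1 IH1 e2 IH2|e1 IH1 e2 IH2|e1 IH1 e2 IH2 e3 IH3|e0 IH0 e1 IH1] r1 r2 h.
- by rewrite (IH _ _ h).
- by rewrite (IH1 _ _ h) (IH2 _ _ h).
- by rewrite (IH1 _ _ h) (IH2 _ _ h).
- by rewrite (IH1 _ _ h) (IH2 _ _ h) (IH3 _ _ h).
- by rewrite (IH0 _ _ h); apply: eq_iteri => x y; apply: IH1 => -[|[|z]] //=.
Qed.

Lemma eval_ren N I ex : forall f r, eval N I (ren f ex) r = eval N I ex (fun x => r (f x)).
Proof.
elim: ex => //= [ex IH|e1 IH1 e2 IH2|e1 IH1 e2 IH2|e1 IH1 e2 IH2 e3 IH3|e0 IH0 e1 IH1] f r.
- by rewrite IH.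
- by rewrite IH1 IH2.
- by rewrite IH1 IH2.
- by rewrite IH1 IH2 IH3.
- by rewrite IH0; apply: eq_iteri => x y; rewrite IH1; apply: eval_ext => -[|[|z]] //=.
Qed.

Definition fn := nat -> (nat -> nat) -> (nat -> nat) -> nat.
(** One expression has to serve all [N], inputs and environments, so that a single program works for
    trees of every size. Environments are de Bruijn style, and [tl] drops the innermost variable. *)
Definition definable (F : fn) := exists ex, forall N I r, eval N I ex r = F N I r.
Definition definableB (P : nat -> (nat -> nat) -> (nat -> nat) -> bool) := definable (fun N I r => nat_of_bool (P N I r)).

Section Closure.
Variables A B C : fn.
Variables P Q : nat -> (nat -> nat) -> (nat -> nat) -> bool.
Hypotheses (dA : definable A) (dB : definable B) (dC : definable C) (dP : definableB P) (dQ : definableB Q).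

Lemma Def_num k : definable (fun _ _ _ => k). Proof. by exists (ENum k). Qed.
Lemma Def_N : definable (fun N _ _ => N). Proof. by exists EN. Qed.
Lemma Def_var k : definable (fun _ _ r => r k). Proof. by exists (EVar k). Qed.
Lemma Def_var1 k : definable (fun _ _ r => tl r k). Proof. by exists (EVar k.+1). Qed.
Lemma Def_var2 k : definable (fun _ _ r => tl (tl r) k). Proof. by exists (EVar k.+2). Qed.
Lemma Def_in : definable (fun N I r => I (A N I r)).
Proof. by have [e h] := dA; exists (EIn e) => N I r /=; rewrite h. Qed.
Lemma Def_add : definable (fun N I r => A N I r + B N I r).
Proof. by have [e h] := dA; have [e' h'] := dB; exists (EAdd e e') => N I r /=; rewrite h h'. Qed.
Lemma Def_sub : definable (fun N I r => A N I r - B N I r).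
Proof. by have [e h] := dA; have [e' h'] := dB; exists (ESub e e') => N I r /=; rewrite h h'. Qed.
Lemma Def_S : definable (fun N I r => (A N I r).+1).
Proof. by have [e h] := dA; exists (EAdd e (ENum 1)) => N I r /=; rewrite h addn1. Qed.
Lemma Def_if : definable (fun N I r => if P N I r then A N I r else B N I r).
Proof.
have [e h] := dA; have [e' h'] := dB; have [e'' h''] := dP.
by exists (EIf e'' e e') => N I r /=; rewrite h h' h''; case: (P N I r).
Qed.
Lemma Def_bool : definable (fun N I r => nat_of_bool (P N I r)). Proof. exact: dP. Qed.
Lemma Def_tl : definable (fun N I r => A N I (tl r)).
Proof. by have [e h] := dA; exists (ren S e) => N I r; rewrite eval_ren h. Qed.

Lemma DefB_le : definableB (fun N I r => A N I r <= B N I r).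
Proof.
have [e h] := dA; have [e' h'] := dB; exists (ESub (ENum 1) (ESub e e')) => N I r /=.
by rewrite h h'; case: leqP => hh /=; lia.
Qed.
Lemma DefB_eq : definableB (fun N I r => A N I r == B N I r).
Proof.
have [e h] := dA; have [e' h'] := dB; exists (ESub (ENum 1) (EAdd (ESub e e') (ESub e' e))) => N I r /=.
by rewrite h h'; case: eqP => hh /=; lia.
Qed.
Lemma DefB_neg : definableB (fun N I r => ~~ P N I r).
Proof.
by have [e h] := dP; exists (ESub (ENum 1) e) => N I r /=; rewrite h; case: (P N I r).
Qed.
Lemma DefB_and : definableB (fun N I r => P N I r && Q N I r).
Proof.
have [e h] := dP; have [e' h'] := dQ; exists (EIf e e' (ENum 0)) => N I r /=.
by rewrite h h'; case: (P N I r).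
Qed.
End Closure.

Lemma DefB_or P Q : definableB P -> definableB Q -> definableB (fun N I r => P N I r || Q N I r).
Proof.
move=> [e h] [e' h']; exists (EIf e (ENum 1) e') => N I r /=.
by rewrite h h'; case: (P N I r).
Qed.
Lemma DefB_impl P Q : definableB P -> definableB Q -> definableB (fun N I r => P N I r ==> Q N I r).
Proof.
move=> [e h] [e' h']; exists (EIf e e' (ENum 1)) => N I r /=.
by rewrite h h'; case: (P N I r).
Qed.
Lemma DefB_tl P : definableB P -> definableB (fun N I r => P N I (tl r)).
Proof. by move=> [e h]; exists (ren S e) => N I r; rewrite eval_ren h. Qed.

Lemma Def_loop (F0 : fn) (G : nat -> (nat -> nat) -> (nat -> nat) -> nat -> nat -> nat) :
  definable F0 -> definable (fun N I r => G N I (tl (tl r)) (r 0) (r 1)) ->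
  definable (fun N I r => iteri N (G N I r) (F0 N I r)).
Proof.
move=> [e0 h0] [e1 h1]; exists (ELoop e0 e1) => N I r /=; rewrite h0.
by apply: eq_iteri => x y; rewrite h1.
Qed.

Lemma Def_sum (G : nat -> (nat -> nat) -> (nat -> nat) -> nat -> nat) :
  definable (fun N I r => G N I (tl r) (r 0)) -> definable (fun N I r => \sum_(0 <= i < N) G N I r i).
Proof.
move=> [e h]; exists (ELoop (ENum 0) (EAdd (EVar 1) (ren (fun x => if x is x'.+1 then x'.+2 else 0) e))) => N I r /=.
rewrite (@eq_iteri _ _ (fun x y => y + G N I r x)); last by move=> x y; rewrite eval_ren h.
by elim: {1 3}N => [|m IH] /=; [rewrite big_nil | rewrite IH big_nat_recr].
Qed.

Definition hasI N (P : nat -> bool) := \sum_(0 <= i < N) P i != 0.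
Definition hasV N n (P : nat -> bool) := hasI N (fun x => (x < n) && P x).
Definition allV N n (P : nat -> bool) := ~~ hasV N n (fun x => ~~ P x).
Definition sumV N n (P : nat -> bool) (F : nat -> nat) := \sum_(0 <= x < N) (if (x < n) && P x then F x else 0).
(** Counts the indices up to which no witness has appeared; this is the least witness, or [N] if
    there is none. *)
Definition firstI N (P : nat -> bool) := \sum_(0 <= i < N) ~~ hasI N (fun j => (j <= i) && P j).
Definition firstV N n (P : nat -> bool) := firstI N (fun x => (x < n) && P x).

Lemma Def_hasI (P : nat -> (nat -> nat) -> (nat -> nat) -> nat -> bool) :
  definableB (fun N I r => P N I (tl r) (r 0)) -> definableB (fun N I r => hasI N (P N I r)).
Proof.
move=> h; apply: DefB_neg; apply: DefB_eq; last exact: Def_num.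
by apply: Def_sum.
Qed.
Lemma Def_hasV (n : fn) (P : nat -> (nat -> nat) -> (nat -> nat) -> nat -> bool) :
  definable n -> definableB (fun N I r => P N I (tl r) (r 0)) -> definableB (fun N I r => hasV N (n N I r) (P N I r)).
Proof.
move=> hn h; apply: Def_hasI; apply: DefB_and => //; apply: DefB_le; last exact: Def_tl hn.
by apply: Def_S; apply: Def_var.
Qed.
Lemma Def_allV (n : fn) (P : nat -> (nat -> nat) -> (nat -> nat) -> nat -> bool) :
  definable n -> definableB (fun N I r => P N I (tl r) (r 0)) -> definableB (fun N I r => allV N (n N I r) (P N I r)).
Proof. by move=> hn h; apply: DefB_neg; apply: Def_hasV => //; apply: DefB_neg. Qed.
Lemma Def_sumV (n : fn) (P : nat -> (nat -> nat) -> (nat -> nat) -> nat -> bool) F :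
  definable n -> definableB (fun N I r => P N I (tl r) (r 0)) -> definable (fun N I r => F N I (tl r) (r 0)) ->
  definable (fun N I r => sumV N (n N I r) (P N I r) (F N I r)).
Proof.
move=> hn h h'; apply: Def_sum; apply: Def_if => //; first exact: Def_num.
apply: DefB_and => //; apply: DefB_le; last exact: Def_tl hn.
by apply: Def_S; apply: Def_var.
Qed.
Lemma Def_firstI (P : nat -> (nat -> nat) -> (nat -> nat) -> nat -> bool) :
  definableB (fun N I r => P N I (tl r) (r 0)) -> definable (fun N I r => firstI N (P N I r)).
Proof.
move=> [e h]; apply: Def_sum; apply: Def_bool; apply: DefB_neg; apply: Def_hasI; apply: DefB_and.
  by apply: DefB_le; [apply: Def_var | apply: Def_var1].
by exists (ren (fun x => if x is x'.+1 then x'.+2 else 0) e) => N I r; rewrite eval_ren h.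
Qed.
Lemma Def_firstV (n : fn) (P : nat -> (nat -> nat) -> (nat -> nat) -> nat -> bool) :
  definable n -> definableB (fun N I r => P N I (tl r) (r 0)) -> definable (fun N I r => firstV N (n N I r) (P N I r)).
Proof.
move=> hn h; apply: Def_firstI; apply: DefB_and => //; apply: DefB_le; last exact: Def_tl hn.
by apply: Def_S; apply: Def_var.
Qed.

Definition mul N a b := sumV N a xpredT (fun=> b).
Definition pw N i c := iteri N (fun x y => if x < i then \sum_(0 <= z < N) y else y) c.
(** At most [N] subtractions are made, so this is a remainder only for quotients up to [N]. *)
Definition md N p v := iteri N (fun _ y => if p <= y then y - p else y) v.
(** Reduces modulo [N ^ (N - 1)], and so on down to [N ^ (i + 1)], each time with a quotient below
    [N], and then counts the multiples of [N ^ i] that fit. *)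
Definition dig N v i :=
  \sum_(0 <= k < N) (mul N k.+1 (pw N i 1) <=
    iteri N (fun x y => if i < N - x.+1 then md N (pw N (N - x.+1) 1) y else y) v).
(* A vector of numbers below [N] is coded by its value in base [N]. *)
Definition vecI N (F : nat -> nat) := \sum_(0 <= i < N) pw N i (F i).
Definition vecV N n (F : nat -> bool) := vecI N (fun v => (v < n) && F v).

Section Functions.
Variables (N : nat) (I : nat -> nat).
(** Only entries below the diagonal are read. Off the diagonal they lie at addresses above 3, which
    survive the relocation of the input. *)
Definition adj i j := if i == j then 0 else if j <= i then I (2 + mul N i (I 0) + j) else I (2 + mul N j (I 0) + i).
Definition lab i := I (2 + mul N (I 0) (I 0) + i).
Definition same i j := lab i == lab j.
Definition root := I 1 - mul N (I 0) (I 0).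
Definition mem Y v := 0 < dig N Y v.
Definition grow q y := vecV N (I 0) (fun v => (v != q) &&
  (mem y v || hasV N (I 0) (fun x => mem y x && (0 < adj x v)))).
Definition reached q u := iteri N (fun _ => grow q) (pw N u 1).
(** Exactly one neighbour of [q] is joined to [t] off [q], so the sum is that neighbour. *)
Definition answ q t := if q == t then q else
  sumV N (I 0) (fun u => (0 < adj q u) && mem (reached q u) t) id.
Definition pathb x y z := (answ z x != answ z y) || ((z == x) && (z == y)).
Variable W : nat.
Definition wtI v := dig N W v.
Definition betI v := iteri N (fun _ y => if y < wtI v then y + y else y) 1.
Definition subb rho v x := same x rho && pathb rho x v.
Definition btwb rho p x z := [&& subb rho p z, subb rho z x, z != p & z != x].
Definition seenb F rho p x t := ~~ hasV N (I 0) (fun z => btwb rho p x z && (t < dig N F z)).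
Definition cntb F rho p t := sumV N (I 0) (fun x => [&& subb rho p x, x != p, betI p <= betI x,
  (dig N F x - betI x <= t) && (t < dig N F x) & seenb F rho p x t]) (fun=> 1).
Definition rawb F rho p t := sumV N (I 0) (fun x => [&& subb rho p x, x != p, betI x < betI p,
  t < dig N F x & seenb F rho p x t]) wtI.
Definition lrb rho p := (p == rho) || (betI p < betI (answ p rho)).
Definition oktb F rho p e t := [&& ((e - betI p <= t) && (t < e)) ==> (cntb F rho p t == 0),
  (e <= t) ==> (cntb F rho p t <= ~~ lrb rho p) &
  (e <= t) ==> (rawb F rho p t <= (if lrb rho p then wtI p else betI p + betI p))].
(** Labels are bounded by [N - 1] instead of [N], so that the junk label is still a digit in base
    [N]. *)
Definition feasb F rho p e := [&& e < N - 1, 0 < e, hasI N (fun k => mul N k (betI p) == e) &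
  allV N (N - 1) (oktb F rho p e)].
Definition lstep rho F := vecI N (fun p => firstI N (fun e => feasb F rho p e || (e == N - 1))).
Definition labl rho := iteri N (fun _ => lstep rho) 0.
Definition cdvb m d := sumV N (N - 1) (fun k => mul N k d < m) (fun=> 1).
Definition keyb F q u v :=
  (cdvb (dig N F u) (betI q) < cdvb (dig N F v) (betI q)) ||
  ((cdvb (dig N F u) (betI q) == cdvb (dig N F v) (betI q)) &&
   ((betI u < betI v) || ((betI u == betI v) && (dig N F u <= dig N F v)))).
Definition topb rho Y := firstV N (I 0) (fun q => mem Y q && allV N (I 0) (fun v => mem Y v ==> pathb rho v q)).
Definition ruleb F rho Y := firstV N (I 0) (fun v => mem Y v &&
  allV N (I 0) (fun u => mem Y u ==> keyb F (topb rho Y) u v)).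
Definition cutb Y q t := vecV N (I 0) (fun y => mem Y y && ((q != t) && (answ q y == answ q t))).
Definition walkb F rho t Y i := iteri N (fun x y => if x < i then cutb y (ruleb F rho y) t else y) Y.
Definition simb F rho Y t := sumV N (N - 1) (fun i => walkb F rho t Y i != 0)
  (fun i => wtI (ruleb F rho (walkb F rho t Y i))).
(** A maximum is the number of thresholds that some value exceeds; counting only up to [N] truncates
    it there. *)
Definition maxb n (P : nat -> bool) (F : nat -> nat) := \sum_(0 <= m < N) hasV N n (fun t => P t && (m < F t)).
Definition minb n (P : nat -> bool) (F : nat -> nat) := \sum_(0 <= m < N) ((m < N - 1) && allV N n (fun t => P t ==> (m < F t))).
(** The depth is a parameter of the construction, not of the expression language: the recursion
    unfolds into loops nested to a depth proportional to [d]. *)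
Fixpoint bfb d x0 Y := if d is d'.+1 then
    minb (I 0) (mem Y) (fun q => wtI q + maxb (I 0) (fun t => mem Y t && (t != q)) (fun t => bfb d' x0 (cutb Y q t)))
  else minb (I 0) (fun rho => same rho x0) (fun rho => maxb (I 0) (mem Y) (simb (labl rho) rho Y)).
Definition activeb Cd := vecV N (I 0) (fun y => mem Cd y && same y (topb root Cd)).
Definition scoreb d x0 Y q := wtI q + maxb (I 0) (fun t => mem Y t && (t != q)) (fun t => bfb d x0 (cutb Y q t)).
Definition polb d Cd := firstV N (I 0) (fun q => mem (activeb Cd) q &&
  allV N (I 0) (fun q' => mem (activeb Cd) q' ==>
    (scoreb d (topb root Cd) (activeb Cd) q <= scoreb d (topb root Cd) (activeb Cd) q'))).
Definition nextb Cd q u := vecV N (I 0) (fun y => mem Cd y && ((q != u) && (answ q y == u))).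
End Functions.

Ltac leaf := solve [ match goal with H : ?T |- _ => first [exact H | exact (Def_tl H) | exact (Def_tl (Def_tl H))
  | exact (Def_tl (Def_tl (Def_tl H))) | exact (Def_tl (Def_tl (Def_tl (Def_tl H))))
  | exact (DefB_tl H) | exact (DefB_tl (DefB_tl H))] end ].
Ltac df_step := cbv beta; first [ leaf | exact (Def_num _) | exact Def_N | exact (Def_var _) | exact (Def_var1 _) | exact (Def_var2 _)
  | lazymatch goal with
    | |- definableB (fun N I r => andb (@?a N I r) (@?b N I r)) => apply DefB_and
    | |- definableB (fun N I r => orb (@?a N I r) (@?b N I r)) => apply DefB_or
    | |- definableB (fun N I r => negb (@?a N I r)) => apply DefB_neg
    | |- definableB (fun N I r => implb (@?a N I r) (@?b N I r)) => apply DefB_impl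
    | |- definableB (fun N I r => leq (@?a N I r) (@?b N I r)) => apply DefB_le
    | |- definableB (fun N I r => eq_op (@?a N I r) (@?b N I r)) => apply DefB_eq
    | |- definableB (fun N I r => hasI N (@?a N I r)) => apply Def_hasI
    | |- definableB (fun N I r => hasV N (@?n N I r) (@?a N I r)) => apply Def_hasV
    | |- definableB (fun N I r => allV N (@?n N I r) (@?a N I r)) => apply Def_allV
    | |- definable (fun N I r => nat_of_bool (@?a N I r)) => apply Def_bool
    | |- definable (fun N I r => addn (@?a N I r) (@?b N I r)) => apply Def_add
    | |- definable (fun N I r => subn (@?a N I r) (@?b N I r)) => apply Def_sub
    | |- definable (fun N I r => S (@?a N I r)) => apply Def_S
    | |- definable (fun N I r => I (@?a N I r)) => apply Def_in
    | |- definable (fun N I r => iteri N (@?g N I r) (@?a N I r)) => apply Def_loop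
    | |- definable (fun N I r => sumV N (@?n N I r) (@?p N I r) (@?f N I r)) => apply Def_sumV
    | |- definable (fun N I r => firstI N (@?p N I r)) => apply Def_firstI
    | |- definable (fun N I r => firstV N (@?n N I r) (@?p N I r)) => apply Def_firstV
    | |- definable _ => first [apply Def_if | apply Def_sum]
    end ].
Ltac df := repeat df_step.

Lemma Def_mul (A B : fn) : definable A -> definable B -> definable (fun N I r => mul N (A N I r) (B N I r)).
Proof. move=> dA dB; rewrite /mul; repeat first [df_step]. Qed.
Lemma Def_pw (A B : fn) : definable A -> definable B -> definable (fun N I r => pw N (A N I r) (B N I r)).
Proof. move=> dA dB; rewrite /pw; repeat first [df_step]. Qed.
Lemma Def_md (A B : fn) : definable A -> definable B -> definable (fun N I r => md N (A N I r) (B N I r)).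
Proof. move=> dA dB; rewrite /md; repeat first [df_step]. Qed.
Lemma Def_dig (A B : fn) : definable A -> definable B -> definable (fun N I r => dig N (A N I r) (B N I r)).
Proof. move=> dA dB; rewrite /dig; repeat first [apply: Def_mul | apply: Def_pw | apply: Def_md | df_step]. Qed.
Lemma DefB_mem (A B : fn) : definable A -> definable B -> definableB (fun N I r => mem N (A N I r) (B N I r)).
Proof. move=> dA dB; rewrite /mem; repeat first [apply: Def_dig | df_step]. Qed.

Lemma Def_vecI (G : nat -> (nat -> nat) -> (nat -> nat) -> nat -> nat) :
  definable (fun N I r => G N I (tl r) (r 0)) -> definable (fun N I r => vecI N (G N I r)).
Proof. move=> h; apply: Def_sum; apply: Def_pw; [apply: Def_var | exact: h]. Qed.

Lemma Def_vecV (n : fn) (P : nat -> (nat -> nat) -> (nat -> nat) -> nat -> bool) : definable n ->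
  definableB (fun N I r => P N I (tl r) (r 0)) -> definable (fun N I r => vecV N (n N I r) (P N I r)).
Proof. move=> hn h; apply: Def_vecI; df. Qed.

Lemma Def_maxb (n : fn) (P : nat -> (nat -> nat) -> (nat -> nat) -> nat -> bool) G : definable n ->
  definableB (fun N I r => P N I (tl r) (r 0)) -> definable (fun N I r => G N I (tl r) (r 0)) ->
  definable (fun N I r => maxb N (n N I r) (P N I r) (G N I r)).
Proof.
move=> hn [e h] [e' h']; rewrite /maxb; apply: Def_sum; apply: Def_bool; apply: Def_hasV; first by exact: (Def_tl hn).
apply: DefB_and.
  (* The threshold is bound between the vertex variable and the outer environment, so the renaming
     skips index 1. *)
  by exists (ren (fun x => if x is x'.+1 then x'.+2 else 0) e) => N I r; rewrite eval_ren h.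
apply: DefB_le; first by df.
by exists (ren (fun x => if x is x'.+1 then x'.+2 else 0) e') => N I r; rewrite eval_ren h'.
Qed.

Lemma Def_minb (n : fn) (P : nat -> (nat -> nat) -> (nat -> nat) -> nat -> bool) G : definable n ->
  definableB (fun N I r => P N I (tl r) (r 0)) -> definable (fun N I r => G N I (tl r) (r 0)) ->
  definable (fun N I r => minb N (n N I r) (P N I r) (G N I r)).
Proof.
move=> hn [e h] [e' h']; rewrite /minb; apply: Def_sum; apply: Def_bool; apply: DefB_and; first by df.
apply: Def_allV; first by exact: (Def_tl hn).
apply: DefB_impl.
  by exists (ren (fun x => if x is x'.+1 then x'.+2 else 0) e) => N I r; rewrite eval_ren h.
apply: DefB_le; first by df.
by exists (ren (fun x => if x is x'.+1 then x'.+2 else 0) e') => N I r; rewrite eval_ren h'.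
Qed.

Lemma Def_adj (A B : fn) : definable A -> definable B -> definable (fun N I r => adj N I (A N I r) (B N I r)).
Proof. move=> dA dB; rewrite /adj; repeat first [apply: Def_mul | df_step]. Qed.
Lemma DefB_same (A B : fn) : definable A -> definable B -> definableB (fun N I r => same N I (A N I r) (B N I r)).
Proof. move=> dA dB; rewrite /same /lab; repeat first [apply: Def_mul | df_step]. Qed.
Lemma Def_root : definable (fun N I r => root N I ).
Proof. rewrite /root; repeat first [apply: Def_mul | df_step]. Qed.
Lemma Def_grow (A B : fn) : definable A -> definable B -> definable (fun N I r => grow N I (A N I r) (B N I r)).
Proof. move=> dA dB; rewrite /grow; repeat first [apply: Def_vecV | apply: DefB_mem | apply: Def_adj | df_step]. Qed.
Lemma Def_reached (A B : fn) : definable A -> definable B -> definable (fun N I r => reached N I (A N I r) (B N I r)).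
Proof. move=> dA dB; rewrite /reached; repeat first [apply: Def_pw | apply: Def_grow | df_step]. Qed.
Lemma Def_answ (A B : fn) : definable A -> definable B -> definable (fun N I r => answ N I (A N I r) (B N I r)).
Proof. move=> dA dB; rewrite /answ; repeat first [apply: DefB_mem | apply: Def_adj | apply: Def_reached | df_step]. Qed.
Lemma DefB_pathb (A B C : fn) : definable A -> definable B -> definable C -> definableB (fun N I r => pathb N I (A N I r) (B N I r) (C N I r)).
Proof. move=> dA dB dC; rewrite /pathb; repeat first [apply: Def_answ | df_step]. Qed.
Lemma Def_wtI (W A : fn) : definable W -> definable A -> definable (fun N I r => wtI N (W N I r) (A N I r)).
Proof. move=> dW dA; rewrite /wtI; repeat first [apply: Def_dig | df_step]. Qed.
Lemma Def_betI (W A : fn) : definable W -> definable A -> definable (fun N I r => betI N (W N I r) (A N I r)).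
Proof. move=> dW dA; rewrite /betI; repeat first [apply: Def_wtI | df_step]. Qed.
Lemma DefB_subb (A B C : fn) : definable A -> definable B -> definable C -> definableB (fun N I r => subb N I (A N I r) (B N I r) (C N I r)).
Proof. move=> dA dB dC; rewrite /subb; repeat first [apply: DefB_same | apply: DefB_pathb | df_step]. Qed.
Lemma DefB_btwb (A B C D : fn) : definable A -> definable B -> definable C -> definable D -> definableB (fun N I r => btwb N I (A N I r) (B N I r) (C N I r) (D N I r)).
Proof. move=> dA dB dC dD; rewrite /btwb; repeat first [apply: DefB_subb | df_step]. Qed.
Lemma DefB_seenb (F A B C D : fn) : definable F -> definable A -> definable B -> definable C -> definable D -> definableB (fun N I r => seenb N I (F N I r) (A N I r) (B N I r) (C N I r) (D N I r)).
Proof. move=> dF dA dB dC dD; rewrite /seenb; repeat first [apply: DefB_btwb | apply: Def_dig | df_step]. Qed.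
Lemma Def_cntb (W F A B C : fn) : definable W -> definable F -> definable A -> definable B -> definable C -> definable (fun N I r => cntb N I (W N I r) (F N I r) (A N I r) (B N I r) (C N I r)).
Proof. move=> dW dF dA dB dC; rewrite /cntb; repeat first [apply: DefB_subb | apply: DefB_seenb | apply: Def_betI | apply: Def_dig | df_step]. Qed.
Lemma Def_rawb (W F A B C : fn) : definable W -> definable F -> definable A -> definable B -> definable C -> definable (fun N I r => rawb N I (W N I r) (F N I r) (A N I r) (B N I r) (C N I r)).
Proof. move=> dW dF dA dB dC; rewrite /rawb; repeat first [apply: DefB_subb | apply: DefB_seenb | apply: Def_betI | apply: Def_wtI | apply: Def_dig | df_step]. Qed.
Lemma DefB_lrb (W A B : fn) : definable W -> definable A -> definable B -> definableB (fun N I r => lrb N I (W N I r) (A N I r) (B N I r)).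
Proof. move=> dW dA dB; rewrite /lrb; repeat first [apply: Def_betI | apply: Def_answ | df_step]. Qed.
Lemma DefB_oktb (W F A B C D : fn) : definable W -> definable F -> definable A -> definable B -> definable C -> definable D -> definableB (fun N I r => oktb N I (W N I r) (F N I r) (A N I r) (B N I r) (C N I r) (D N I r)).
Proof. move=> dW dF dA dB dC dD; rewrite /oktb; repeat first [apply: DefB_lrb | apply: Def_cntb | apply: Def_rawb | apply: Def_betI | apply: Def_wtI | df_step]. Qed.
Lemma DefB_feasb (W F A B C : fn) : definable W -> definable F -> definable A -> definable B -> definable C -> definableB (fun N I r => feasb N I (W N I r) (F N I r) (A N I r) (B N I r) (C N I r)).
Proof. move=> dW dF dA dB dC; rewrite /feasb; repeat first [apply: DefB_oktb | apply: Def_mul | apply: Def_betI | df_step]. Qed.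
Lemma Def_lstep (W A F : fn) : definable W -> definable A -> definable F -> definable (fun N I r => lstep N I (W N I r) (A N I r) (F N I r)).
Proof. move=> dW dA dF; rewrite /lstep; repeat first [apply: Def_vecI | apply: DefB_feasb | df_step]. Qed.
Lemma Def_labl (W A : fn) : definable W -> definable A -> definable (fun N I r => labl N I (W N I r) (A N I r)).
Proof. move=> dW dA; rewrite /labl; repeat first [apply: Def_lstep | df_step]. Qed.
Lemma Def_cdvb (A B : fn) : definable A -> definable B -> definable (fun N I r => cdvb N (A N I r) (B N I r)).
Proof. move=> dA dB; rewrite /cdvb; repeat first [apply: Def_mul | df_step]. Qed.
Lemma DefB_keyb (W F A B C : fn) : definable W -> definable F -> definable A -> definable B -> definable C -> definableB (fun N I r => keyb N (W N I r) (F N I r) (A N I r) (B N I r) (C N I r)).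
Proof. move=> dW dF dA dB dC; rewrite /keyb; repeat first [apply: Def_cdvb | apply: Def_dig | apply: Def_betI | df_step]. Qed.
Lemma Def_topb (A B : fn) : definable A -> definable B -> definable (fun N I r => topb N I (A N I r) (B N I r)).
Proof. move=> dA dB; rewrite /topb; repeat first [apply: DefB_mem | apply: DefB_pathb | df_step]. Qed.
Lemma Def_ruleb (W F A B : fn) : definable W -> definable F -> definable A -> definable B -> definable (fun N I r => ruleb N I (W N I r) (F N I r) (A N I r) (B N I r)).
Proof. move=> dW dF dA dB; rewrite /ruleb; apply: Def_firstV; first df; repeat first [apply: DefB_mem | apply: DefB_keyb | apply: Def_topb | df_step]. Qed.
Lemma Def_cutb (A B C : fn) : definable A -> definable B -> definable C -> definable (fun N I r => cutb N I (A N I r) (B N I r) (C N I r)).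
Proof. move=> dA dB dC; rewrite /cutb; repeat first [apply: Def_vecV | apply: DefB_mem | apply: Def_answ | df_step]. Qed.
Lemma Def_walkb (W F A B C D : fn) : definable W -> definable F -> definable A -> definable B -> definable C -> definable D -> definable (fun N I r => walkb N I (W N I r) (F N I r) (A N I r) (B N I r) (C N I r) (D N I r)).
Proof. move=> dW dF dA dB dC dD; rewrite /walkb; repeat first [apply: Def_cutb | apply: Def_ruleb | df_step]. Qed.
Lemma Def_simb (W F A B C : fn) : definable W -> definable F -> definable A -> definable B -> definable C -> definable (fun N I r => simb N I (W N I r) (F N I r) (A N I r) (B N I r) (C N I r)).
Proof. move=> dW dF dA dB dC; rewrite /simb; repeat first [apply: Def_walkb | apply: Def_ruleb | apply: Def_wtI | df_step]. Qed.
Lemma Def_bfb d (W A B : fn) : definable W -> definable A -> definable B -> definable (fun N I r => bfb N I (W N I r) d (A N I r) (B N I r)).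
Proof.
elim: d W A B => [|d IH] W A B dW dA dB; rewrite /bfb -/bfb.
  by repeat first [apply: Def_minb | apply: Def_maxb | apply: DefB_same | apply: DefB_mem | apply: Def_simb | apply: Def_labl | df_step].
repeat first [apply: Def_minb | apply: Def_maxb | apply: DefB_mem | apply: Def_wtI | df_step].
by apply: IH; repeat first [apply: Def_cutb | df_step].
Qed.
Lemma Def_activeb (A : fn) : definable A -> definable (fun N I r => activeb N I (A N I r)).
Proof. move=> dA; rewrite /activeb; repeat first [apply: Def_vecV | apply: DefB_mem | apply: DefB_same | apply: Def_topb | apply: Def_root | df_step]. Qed.
Lemma Def_scoreb d (W A B C : fn) : definable W -> definable A -> definable B -> definable C ->
  definable (fun N I r => scoreb N I (W N I r) d (A N I r) (B N I r) (C N I r)).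
Proof.
move=> dW dA dB dC; rewrite /scoreb; repeat first [apply: Def_maxb | apply: Def_bfb | apply: Def_cutb | apply: DefB_mem | apply: Def_wtI | df_step].
Qed.
Lemma Def_polb d (W A : fn) : definable W -> definable A -> definable (fun N I r => polb N I (W N I r) d (A N I r)).
Proof.
move=> dW dA; rewrite /polb; apply: Def_firstV; first df; repeat first [apply: Def_scoreb | apply: Def_activeb | apply: DefB_mem | apply: Def_topb | apply: Def_root | df_step].
Qed.
Lemma Def_nextb (A B C : fn) : definable A -> definable B -> definable C -> definable (fun N I r => nextb N I (A N I r) (B N I r) (C N I r)).
Proof.
move=> dA dB dC; rewrite /nextb; repeat first [apply: Def_vecV | apply: DefB_mem | apply: Def_answ | df_step].
Qed.

(** * Correctness of the arithmetic *)

Section Numbers.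
Variables (N : nat).
Implicit Types P : nat -> bool.

Lemma hasIE P : hasI N P = has P (iota 0 N).
Proof.
rewrite /hasI /index_iota subn0; elim: (iota 0 N) => [|x s IH]; rewrite ?big_nil // big_cons /= -IH.
by case: (P x); rewrite /= ?add0n // add1n.
Qed.

Lemma hasIP P : reflect (exists2 x, x < N & P x) (hasI N P).
Proof.
rewrite hasIE; apply: (iffP hasP) => -[x]; first by rewrite mem_iota /= add0n => xN Px; exists x.
by move=> xN Px; exists x; rewrite // mem_iota add0n.
Qed.

Section Ordinals.
Variable n : nat.
Hypothesis nN : n <= N.

Lemma hasV_ex P : hasV N n P = [exists x : 'I_n, P x].
Proof.
apply/hasIP/existsP => [[x xN /andP[xn Px]]|[x Px]]; first by exists (Ordinal xn).
by exists x; rewrite ?ltn_ord // (leq_trans (ltn_ord x) nN).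
Qed.

Lemma allV_all P : allV N n P = [forall x : 'I_n, P x].
Proof. by rewrite /allV hasV_ex negb_exists; apply: eq_forallb => x; rewrite negbK. Qed.

Lemma sumV_sum P F : sumV N n P F = \sum_(x < n | P x) F x.
Proof.
rewrite /sumV (big_cat_nat (n := n)) //= [X in _ + X]big_nat_cond [X in _ + X]big1 ?addn0; last first.
  by move=> i /andP[/andP[ni _] _]; rewrite ltnNge ni.
by rewrite big_mkord [RHS]big_mkcond; apply: eq_bigr => i _; rewrite ltn_ord.
Qed.

Lemma firstI_min P x : x < N -> P x -> (forall y, y < x -> ~~ P y) -> firstI N P = x.
Proof.
move=> xN Px hm; have h i : hasI N (fun j => (j <= i) && P j) = (x <= i).
  apply/hasIP/idP => [[j jN /andP[ji Pj]]|xi]; last by exists x; rewrite // xi.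
  by rewrite leqNgt; apply/negP => ix; have := hm j (leq_ltn_trans ji ix); rewrite Pj.
rewrite /firstI (eq_bigr (fun i => (i < x : nat))); last by move=> i _; rewrite h -ltnNge.
rewrite (big_cat_nat (n := x)) //=; last exact: ltnW.
rewrite (eq_big_nat _ _ (F2 := fun=> 1)); last by move=> i /andP[_ ->].
rewrite [X in _ + X](eq_big_nat _ _ (F2 := fun=> 0)); last by move=> i /andP[h1 _]; rewrite ltnNge h1.
by rewrite !sum_nat_const_nat muln0 addn0 muln1 subn0.
Qed.

Lemma firstIP P : hasI N P -> [/\ firstI N P < N, P (firstI N P) & forall y, y < firstI N P -> ~~ P y].
Proof.
move=> /hasIP[x xN Px]; have ex : exists x, P x by exists x.
have [m Pm hm] := ex_minnP ex; have mN : m < N by apply: leq_ltn_trans (hm x Px) xN.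
have hm' y : y < m -> ~~ P y by move=> ym; apply/negP => /hm; rewrite leqNgt ym.
by rewrite (firstI_min mN Pm hm').
Qed.

(** [enum] lists ordinals in increasing order, so [pick] agrees with the least index found by the
    arithmetic version. *)
Lemma pick_ord (P : pred 'I_n) y : [pick x | P x] = Some y -> forall x : 'I_n, P x -> y <= x.
Proof.
rewrite /pick => hy x Px; have xs : x \in enum P by rewrite mem_enum.
have : sorted (fun a b : 'I_n => a < b) (enum P).
  rewrite /enum_mem; apply: sorted_filter => [a b c|]; first exact: ltn_trans.
  by have := iota_ltn_sorted 0 n; rewrite -val_enum_ord sorted_map enumT.
case: (enum P) xs hy => //= z s xs [<-] hp; move: xs; rewrite inE => /orP[/eqP ->//|xs].
by move: hp; rewrite path_sortedE => [/andP[/allP h _]|a b c]; [apply: ltnW; apply: h | apply: ltn_trans].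
Qed.

Lemma firstV_pick (P : nat -> bool) (Q : pred 'I_n) d : (forall x : 'I_n, P x = Q x) -> [exists x, Q x] ->
  firstV N n P = odflt d [pick x | Q x].
Proof.
move=> PQ /existsP[x0 Qx0]; case e : [pick x | Q x] => [y|]; last first.
  by move: e; case: pickP => // /(_ x0); rewrite Qx0.
have Qy : Q y by move: e; case: pickP => // z Qz [<-].
apply: firstI_min; rewrite ?ltn_ord ?PQ //; first exact: leq_trans (ltn_ord y) nN.
move=> z zy; apply/negP => /andP[zn Pz].
have := pick_ord e (x := Ordinal zn); rewrite -PQ Pz => /(_ isT); by rewrite leqNgt zy.
Qed.

End Ordinals.

Lemma mulE a b : a <= N -> mul N a b = a * b.
Proof. by move=> aN; rewrite /mul sumV_sum //= sum_nat_const card_ord. Qed.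

Lemma iteri_prefix (A : Type) (g : A -> A) m i y : iteri m (fun x y => if x < i then g y else y) y = iter (minn i m) g y.
Proof.
elim: m => [|m IH]; first by rewrite minn0.
rewrite /= IH; case: ltnP => h.
  by rewrite (minn_idPr h).
by rewrite (minn_idPl (leqW h)).
Qed.

Lemma pwE i c : i <= N -> pw N i c = c * N ^ i.
Proof.
move=> iN; rewrite /pw (iteri_prefix (fun y => \sum_(0 <= z < N) y)) (minn_idPl iN).
elim: i {iN} => [|i IH]; first by rewrite muln1.
by rewrite iterS IH sum_nat_const_nat subn0 expnS mulnCA.
Qed.

Lemma md_eq p a b : a <= N -> b < p -> md N p (a * p + b) = b.
Proof.
move=> aN bp; have h m : iteri m (fun _ y => if p <= y then y - p else y) (a * p + b) = (a - m) * p + b.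
  elim: m => [|m IH]; first by rewrite subn0.
  rewrite /= IH subnS; case: (a - m) => [|k] /=; first by rewrite leqNgt bp.
  by rewrite mulSn -addnA leq_addr addKn.
by rewrite /md h (eqP (_ : a - N == 0)) ?subn_eq0.
Qed.

Lemma vecIE F : vecI N F = \sum_(0 <= i < N) F i * N ^ i.
Proof. by apply: eq_big_nat => i /andP[_ iN]; rewrite pwE // ltnW. Qed.

Lemma digE F i : (forall j, j < N -> F j < N) -> i < N -> dig N (vecI N F) i = F i.
Proof.
move=> hF iN; pose V m := \sum_(0 <= j < m) F j * N ^ j.
have VS m : V m.+1 = F m * N ^ m + V m by rewrite /V big_nat_recr // addnC.
have Vlt m : m <= N -> V m < N ^ m.
  elim: m => [|m IH] mN; first by rewrite /V big_nil.
  rewrite VS expnS; have := IH (ltnW mN); have := hF m mN => h1 h2.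
  apply: (@leq_trans ((F m).+1 * N ^ m)); first by rewrite mulSn addnC ltn_add2r.
  by rewrite leq_mul2r h1 orbT.
(* The reductions strip digits from the top and stop just above digit [i]. *)
have rem m : m <= N -> iteri m (fun x y => if i < N - x.+1 then md N (pw N (N - x.+1) 1) y else y) (vecI N F) = V (maxn (N - m) i.+1).
  elim: m => [|m IH] mN; first by rewrite subn0 (maxn_idPl iN) vecIE.
  rewrite iteriS IH; last exact: ltnW.
  case: ltnP => h; last by rewrite (maxn_idPr _) ?(maxn_idPr _) //; lia.
  have -> : maxn (N - m) i.+1 = (N - m.+1).+1 by lia.
  have -> : maxn (N - m.+1) i.+1 = N - m.+1 by lia.
  rewrite VS pwE ?leq_subr // mul1n md_eq //; last by apply: Vlt; rewrite leq_subr.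
  by apply: ltnW; apply: hF; lia.
rewrite /dig rem // subnn max0n VS (eq_big_nat _ _ (F2 := fun k => (k < F i : nat))); last first.
  move=> k /andP[_ kN]; rewrite mulE // pwE ?(ltnW iN) // mul1n; congr (nat_of_bool _).
  have := Vlt i (ltnW iN) => hV; apply/idP/idP => h.
    by rewrite -ltnS -(ltn_pmul2r (m := N ^ i)) ?expn_gt0 ?(leq_ltn_trans _ iN) // mulSn; apply: leq_ltn_trans h _; rewrite addnC ltn_add2r.
  by apply: leq_trans (leq_addr _ _); rewrite leq_mul2r h orbT.
rewrite (big_cat_nat (n := F i)) //=; last exact: ltnW (hF i iN).
rewrite (eq_big_nat _ _ (F2 := fun=> 1)); last by move=> k /andP[_ ->].
rewrite [X in _ + X](eq_big_nat _ _ (F2 := fun=> 0)); last by move=> k /andP[h1 _]; rewrite ltnNge h1.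
by rewrite !sum_nat_const_nat muln0 addn0 muln1 subn0.
Qed.

End Numbers.

Lemma count_lt m x : \sum_(0 <= i < m) (i < x : nat) = minn m x.
Proof.
elim: m => [|m IH]; first by rewrite big_nil min0n.
by rewrite big_nat_recr //= IH; case: (ltnP m x) => h; lia.
Qed.

(** * The expressions compute the strategy on vertex sets *)

Section Spec.
Variables (n : nat) (e : rel 'I_n) (part : 'I_n -> 'I_n) (r : 'I_n) (N : nat) (I : nat -> nat).
Hypothesis treeE : is_tree e.
Hypotheses (nN : n.+2 < N) (I0 : I 0 = n) (rootE : root N I = r).
Hypothesis adjE : forall i j : 'I_n, (0 < adj N I i j) = e i j.
Hypothesis labE : forall i j : 'I_n, same N I i j = (part i == part j).
Let aT := tree_answersT treeE.
Let nN' : n <= N. Proof. by lia. Qed.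
Let vN (v : 'I_n) : v < N. Proof. exact: leq_trans (ltn_ord v) nN'. Qed.

Definition enc (S : {set 'I_n}) : nat := vecV N n (fun v => if insub v is Some u then u \in S else false).

Lemma vecV_enc P (S : {set 'I_n}) : (forall u : 'I_n, P (val u) = (u \in S)) -> vecV N n P = enc S.
Proof.
move=> h; apply: eq_bigr => i _; congr pw; congr nat_of_bool; case: (ltnP i n) => //= hi.
by rewrite insubT -h.
Qed.

Lemma mem_enc (S : {set 'I_n}) (u : 'I_n) : mem N (enc S) u = (u \in S).
Proof.
rewrite /mem /enc /vecV digE // => [|j _]; last by apply: leq_ltn_trans (leq_b1 _) _; lia.
by rewrite ltn_ord valK /=; case: (u \in S).
Qed.

Lemma enc_eq0 (S : {set 'I_n}) : (enc S == 0) = (S == set0).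
Proof.
apply/eqP/eqP => [h|->]; last first.
  rewrite /enc /vecV vecIE big1 // => i _; case: insubP => [u _ _|_]; rewrite ?inE andbF //.
apply/setP => u; rewrite inE -(mem_enc S) h /mem; apply/negbTE; rewrite -leqNgt.
have h0 : vecI N (fun=> 0) = 0 by rewrite vecIE big1.
by rewrite -h0 digE // => j _; lia.
Qed.

Lemma enc1 (u : 'I_n) : pw N u 1 = enc [set u].
Proof.
rewrite pwE ?(ltnW (vN u)) // mul1n /enc /vecV vecIE (big_cat_nat (n := u)) //=; last exact: ltnW.
rewrite (big_ltn (vN u)) (eq_big_nat _ _ (F2 := fun=> 0)) => [|i /andP[_ iu]]; last first.
  case: insubP => [v _ ev|_]; rewrite ?andbF // inE; case: eqP => [ev'|]; rewrite ?andbF //.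
  by rewrite -ev ev' ltnn in iu.
rewrite [X in _ + (_ + X)](eq_big_nat _ _ (F2 := fun=> 0)) => [|i /andP[ui _]]; last first.
  case: insubP => [v _ ev|_]; rewrite ?andbF // inE; case: eqP => [ev'|]; rewrite ?andbF //.
  by rewrite -ev ev' ltnn in ui.
by rewrite !sum_nat_const_nat !muln0 add0n addn0 valK ltn_ord inE eqxx mul1n.
Qed.

Definition growS (q : 'I_n) (S : {set 'I_n}) := [set v | (v != q) && ((v \in S) || [exists x, (x \in S) && e x v])].

Lemma grow_enc (q : 'I_n) S : grow N I q (enc S) = enc (growS q S).
Proof.
rewrite /grow I0; apply: vecV_enc => u; rewrite inE mem_enc hasV_ex //; congr (_ && (_ || _)).
by apply: eq_existsb => x; rewrite mem_enc adjE.
Qed.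

(** A simple path has at most [n] vertices, and a vertex once reached stays reached; so [N] rounds
    of growth suffice. *)
Lemma reached_mem (q u t : 'I_n) : u != q -> mem N (reached N I q u) t = connect (restr e (~: [set q])) u t.
Proof.
move=> nuq; have eN m : iteri m (fun _ => grow N I q) (pw N u 1) = enc (iter m (growS q) [set u]).
  by elim: m => [|m IH] /=; [exact: enc1 | rewrite IH grow_enc].
rewrite /reached eN mem_enc; apply/idP/idP.
  elim: N t => [|m IH] t /=; first by rewrite inE => /eqP ->.
  rewrite inE => /andP[ntq /orP[/IH//|/existsP[x /andP[xS ext]]]].
  apply: connect_trans (IH _ xS) _; apply: connect1; rewrite /restr ext !inE ntq andbT /=.
  case: m xS {IH} => [|m] /=; first by rewrite inE => /eqP ->.
  by rewrite inE => /andP[].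
case/connectP => p0 pp0 lp0; case: (shortenP pp0) lp0 => p pp up _ lp.
have sp : size p <= N.
  have := card_uniqP up => h; have := max_card [in u :: p]; rewrite h card_ord /= => h2; lia.
have mono m s (v : 'I_n) : v != q -> v \in iter m (growS q) [set u] -> v \in iter (s + m) (growS q) [set u].
  by move=> nv; elim: s => // s IH /IH h; rewrite addSn /= inE nv h.
have nlast : t != q.
  rewrite lp; case/lastP: p pp {up lp sp} => [|p x]; rewrite ?last_rcons //.
  by rewrite rcons_path => /andP[_ /and3P[_ _]]; rewrite !inE.
rewrite -(subnK sp); apply: mono => //; rewrite lp.
elim/last_ind: p pp {up lp sp} => [|p x IH]; first by rewrite /= inE.
rewrite rcons_path last_rcons size_rcons => /andP[/IH h /and3P[ex _ xq]] /=.
rewrite inE; move: xq; rewrite !inE => -> /=; apply/orP; right; apply/existsP; exists (last u p).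
by rewrite h.
Qed.

Lemma answE (q t : 'I_n) : answ N I q t = ans e q t.
Proof.
rewrite /answ; have [/val_inj ->|nqt] := eqVneq (val q) (val t); first by rewrite (ta_self aT).
have nqt' : q != t by [].
rewrite I0 sumV_sum // (bigD1 (ans e q t)) /=; last first.
  have [h1 h2] := ansP treeE nqt'; rewrite adjE h1 reached_mem //; exact: (ta_neq aT).
rewrite big1 ?addn0 // => u /andP[/andP[h1 h2] nu]; exfalso; case/negP: nu; rewrite adjE in h1.
have nqu := edge_neq treeE h1.
rewrite reached_mem 1?eq_sym // -(ans_eqP treeE) // (ans_edge treeE h1) in h2; by rewrite (eqP h2).
Qed.

Lemma pathbE (x y z : 'I_n) : pathb N I x y z = pth (ans e) x y z.
Proof. by rewrite /pathb !answE. Qed.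

Variables (W : nat) (wi : 'I_n -> nat).
Hypothesis WE : forall v : 'I_n, wtI N W v = wi v.
Hypothesis wi0 : forall v, 0 < wi v < N.

Definition bet (v : 'I_n) := betI N W v.

(** Each doubling adds at least 1, so [N] rounds pass every weight below [N]; the value stays below
    twice the weight because doubling stops there. *)
Lemma bet_spec v : (exists l, bet v = 2 ^ l) /\ wi v <= bet v < 2 * wi v.
Proof.
have h m : let y := iteri m (fun _ y => if y < wtI N W v then y + y else y) 1 in
    [/\ exists l, y = 2 ^ l, y < 2 * wi v & wi v <= y \/ m < y].
  elim: m => [|m]; first by split; [exists 0 | have := wi0 v => /=; lia | right].
  rewrite /=; move: (iteri m _ 1) => y [[l el] h1 h2]; rewrite WE; case: ltnP => h3; last first.
    by split; [exists l | exact: h1 | left].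
  split; [by exists l.+1; rewrite el addnn expnS mul2n | lia|]; case: h2 => h2; [left|right]; lia.
have [h1 h2 h3] := h N; split=> //; rewrite /bet /betI h2 andbT.
by case: h3 => // h3; have := wi0 v; lia.
Qed.

Definition lv v := logn 2 (bet v).
Lemma bet_pow v : bet v = 2 ^ lv v.
Proof. by have [[l el] _] := bet_spec v; rewrite /lv el pfactorK. Qed.
Lemma bet_w v : wi v <= bet v < 2 * wi v. Proof. by have [] := bet_spec v. Qed.

Section Labels.
Variable rho : 'I_n.
Let X := klass part rho.
Notation sub := (sub (ans e) X rho).

Lemma subbE (v x : 'I_n) : subb N I rho v x = (x \in sub v).
Proof. by rewrite /subb pathbE labE !inE. Qed.

Section Vector.
Variable F : nat.
Let f (v : 'I_n) := dig N F v.

Lemma seenbE (p x : 'I_n) t : seenb N I F rho p x t = seen (ans e) X rho f p x t.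
Proof.
rewrite /seenb I0 hasV_ex // negb_exists; apply: eq_forallb => z.
by rewrite /btwb !subbE negb_and implybE -leqNgt.
Qed.

Lemma cntbE (p : 'I_n) t : cntb N I W F rho p t = cnt (ans e) X rho bet f p t.
Proof.
rewrite /cntb I0 sumV_sum //; apply: eq_bigl => x; by rewrite subbE seenbE.
Qed.

Lemma rawbE (p : 'I_n) t : rawb N I W F rho p t = raw (ans e) X rho bet wi f p t.
Proof.
rewrite /rawb I0 sumV_sum //; apply: eq_big => [x|x _]; last exact: WE.
by rewrite subbE seenbE.
Qed.

Lemma lrbE (p : 'I_n) : lrb N I W rho p = lr (ans e) rho bet p.
Proof. by rewrite /lrb answE. Qed.

Lemma oktbE (p : 'I_n) E t : oktb N I W F rho p E t = okt (ans e) X rho bet wi f p E t.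
Proof.
rewrite /oktb /okt cntbE rawbE lrbE WE addnn -mul2n.
by congr [&& _ ==> _, _ & _].
Qed.

Lemma feasbE (p : 'I_n) E : feasb N I W F rho p E = feas (ans e) X rho bet wi N.-1 f p E.
Proof.
rewrite /feasb /feas subn1; case: (boolP (E < N.-1)) => //= hE; congr (_ && _); congr (_ && _).
- apply/hasIP/dvdnP => [[k kN /eqP]|[k ek]].
    by rewrite mulE ?(ltnW kN) // => <-; exists k.
  have kE : k <= E by rewrite ek leq_pmulr // bet_pow expn_gt0.
  have kN : k < N by lia.
  by exists k; rewrite // mulE ?(ltnW kN) // -/(bet p) ek.
- by rewrite allV_all ?leq_pred //; apply: eq_forallb => t; rewrite oktbE.
Qed.
End Vector.

Lemma feas_ext f g (p : 'I_n) E : (forall x, x \in sub p -> x != p -> f x = g x) ->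
  feas (ans e) X rho bet wi N.-1 f p E = feas (ans e) X rho bet wi N.-1 g p E.
Proof.
move=> h; have hs x t : x \in sub p -> x != p -> seen (ans e) X rho f p x t = seen (ans e) X rho g p x t.
  move=> xp nxp; apply: eq_forallb => z; case: (boolP (btw _ _ _ _ _ _)) => //= /and4P[zp _ nz _].
  by rewrite h.
have hc t : cnt (ans e) X rho bet f p t = cnt (ans e) X rho bet g p t.
  apply: eq_bigl => x; case: (boolP (x \in sub p)) => //= xp; case: (boolP (x != p)) => //= nxp.
  by rewrite /iv h // hs.
have hr t : raw (ans e) X rho bet wi f p t = raw (ans e) X rho bet wi g p t.
  apply: eq_bigl => x; case: (boolP (x \in sub p)) => //= xp; case: (boolP (x != p)) => //= nxp.
  by rewrite h // hs.
by rewrite /feas; congr [&& _, _, _ & _]; apply: eq_forallb => t; rewrite /okt hc hr.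
Qed.

Lemma lstep_dig F (p : 'I_n) (L := dig N (lstep N I W rho F) p) :
  (forall E, feas (ans e) X rho bet wi N.-1 (fun v => dig N F v) p E ->
     feas (ans e) X rho bet wi N.-1 (fun v => dig N F v) p L /\ L <= E) /\
  ((forall E, ~~ feas (ans e) X rho bet wi N.-1 (fun v => dig N F v) p E) -> L = N.-1).
Proof.
have has x : hasI N (fun E => feasb N I W F rho x E || (E == N - 1)).
  by apply/hasIP; exists (N - 1); rewrite ?eqxx ?orbT //; lia.
have eL : L = firstI N (fun E => feasb N I W F rho p E || (E == N - 1)).
  by rewrite /L digE // => j _; have [] := firstIP (has j).
have [h1 h2 h3] := firstIP (has p); rewrite -eL in h1 h2 h3; rewrite subn1 feasbE in h2.
have hE E : feas (ans e) X rho bet wi N.-1 (fun v => dig N F v) p E -> L <= E.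
  by move=> fE; rewrite leqNgt; apply/negP => /h3; rewrite feasbE fE.
split=> [E fE|no]; last by case/orP: h2 => [h2|/eqP //]; have := no L; rewrite h2.
split; last exact: hE.
case/orP: h2 => // /eqP eN; have := hE E fE; case/feasP: fE => EN _ _ _; lia.
Qed.

Definition label (v : 'I_n) := dig N (labl N I W rho) v.

(** A label depends only on the labels strictly below it. After [k] rounds the labels of subtrees
    with at most [k] vertices are final, so after [N] rounds the vector is a fixed point of the
    step, which is greediness. *)
Lemma label_greedy : convex (ans e) X -> greedy (ans e) X rho bet wi N.-1 label.
Proof.
move=> cX'; have rX : rho \in X by rewrite inE.
have [f [fS fN0]] : exists f : nat -> 'I_n -> nat, (forall k v,
    (forall E, feas (ans e) X rho bet wi N.-1 (f k) v E ->
       feas (ans e) X rho bet wi N.-1 (f k) v (f k.+1 v) /\ f k.+1 v <= E) /\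
    ((forall E, ~~ feas (ans e) X rho bet wi N.-1 (f k) v E) -> f k.+1 v = N.-1)) /\ f N = label.
  exists (fun k v => dig N (iteri k (fun _ => lstep N I W rho) 0) v); split=> // k v; exact: lstep_dig.
have det k k' (v : 'I_n) : (forall x, x \in sub v -> x != v -> f k x = f k' x) -> f k.+1 v = f k'.+1 v.
  move=> h; have [a1 a2] := fS k v; have [b1 b2] := fS k' v.
  case: (boolP (feas (ans e) X rho bet wi N.-1 (f k) v (f k.+1 v))) => hf.
    have hf' := hf; rewrite (feas_ext _ h) in hf'; have [c1 c2] := b1 _ hf'.
    have c1' := c1; rewrite -(feas_ext _ h) in c1'; have [_ c3] := a1 _ c1'.
    by apply: anti_leq; rewrite c3 c2.
  have no E : ~~ feas (ans e) X rho bet wi N.-1 (f k) v E.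
    by apply/negP => /a1[]; rewrite (negbTE hf).
  by rewrite a2 // b2 // => E; rewrite -(feas_ext _ h).
have stable m v j : v \in X -> #|sub v| <= m -> m <= j -> f j v = f m v.
  elim: m v j => [|m IH] v j vX; first by rewrite leqn0 cards_eq0 => /eqP h; have := sub_refl aT (rho := rho) vX; rewrite h inE.
  case: j => // j hm hj; apply: det => x xv nx; apply: IH => //; first exact: (subX xv).
  rewrite -ltnS; apply: leq_trans hm; apply: proper_card; apply/properP; split; first exact: (sub_sub aT).
  exists v; first exact: (sub_refl aT vX).
  by apply: contra nx => h; rewrite (sub_anti aT xv h).
have sN v : #|sub v| <= N by apply: leq_trans (max_card _) _; rewrite card_ord.
have fN v : v \in X -> f N.+1 v = f N v by move=> vX; apply: stable => //; apply: sN.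
by rewrite -fN0 => p pX; have := fS N p; rewrite fN.
Qed.

End Labels.
Lemma cdvbE m d : cdvb N m d = cdv N.-1 m d.
Proof.
rewrite /cdvb /cdv subn1 sumV_sum ?leq_pred // big_mkcond; apply: eq_bigr => k _.
by rewrite mulE; [case: (k * d < m) | have := ltn_ord k; lia].
Qed.

Lemma keybE F (q u v : 'I_n) : keyb N W F q u v = keyle bet N.-1 (fun v : 'I_n => dig N F v) q u v.
Proof. by rewrite /keyb !cdvbE. Qed.

Lemma topbE (rho : 'I_n) (Y : {set 'I_n}) : convex (ans e) Y -> Y != set0 ->
  topb N I rho (enc Y) = topof (ans e) rho Y.
Proof.
move=> cY Y0; have [q qY hq] := top_ex aT (@convexT _ (ans e)) (in_setT rho) (subsetT Y) cY Y0.
rewrite /topb I0; apply: firstV_pick => // [x|].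
  rewrite mem_enc allV_all //; congr (_ && _); apply: eq_forallb => v; by rewrite mem_enc pathbE.
apply/existsP; exists q; rewrite qY; apply/forall_inP => v /hq; by rewrite inE => /andP[].
Qed.

Lemma rulebE (rho : 'I_n) (Y : {set 'I_n}) : convex (ans e) Y -> Y != set0 ->
  ruleb N I W (labl N I W rho) rho (enc Y) = rule (ans e) bet N.-1 label rho Y.
Proof.
move=> cY Y0; have [v vY hv] := keyle_max bet N.-1 (label rho) (topof (ans e) rho Y) Y0.
rewrite /ruleb I0; apply: firstV_pick => // [x|].
  rewrite mem_enc allV_all //; congr (_ && _); apply: eq_forallb => u.
  by rewrite mem_enc topbE // keybE.
by apply/existsP; exists v; rewrite vY; apply/forall_inP.
Qed.

Lemma cutbE (Y : {set 'I_n}) (q t : 'I_n) : cutb N I (enc Y) q t = enc (cut (ans e) Y q t).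
Proof. by rewrite /cutb I0; apply: vecV_enc => u; rewrite inE mem_enc !answE. Qed.

Lemma cutb0 q t : cutb N I (enc set0) q t = enc set0.
Proof. by rewrite /cutb I0; apply: vecV_enc => u; rewrite mem_enc inE. Qed.

Definition walk (R : {set 'I_n} -> 'I_n) t i (Y : {set 'I_n}) := iter i (fun Z => cut (ans e) Z (R Z) t) Y.

Lemma walk_convex R t i Y : convex (ans e) Y -> convex (ans e) (walk R t i Y).
Proof. by move=> cY; elim: i => //= i; apply: (convex_cut aT). Qed.

Lemma walkbE (rho t : 'I_n) (Y : {set 'I_n}) i : convex (ans e) Y -> i <= N ->
  walkb N I W (labl N I W rho) rho t (enc Y) i = enc (walk (rule (ans e) bet N.-1 label rho) t i Y).
Proof.
move=> cY iN; rewrite /walkb (iteri_prefix (fun y => cutb N I y (ruleb N I W (labl N I W rho) rho y) t)) (minn_idPl iN).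
elim: i {iN} => [|i IH] //; rewrite iterS IH /walk iterS -/(walk _ _ _ _).
have cZ := @walk_convex (rule (ans e) bet N.-1 label rho) t i Y cY.
have [->|Z0] := eqVneq (walk (rule (ans e) bet N.-1 label rho) t i Y) set0.
  by rewrite cutb0; congr enc; apply/setP => x; rewrite !inE.
by rewrite rulebE // cutbE.
Qed.

Lemma walk0 R t i : walk R t i set0 = set0.
Proof. by elim: i => // i; rewrite /walk iterS => ->; apply/setP => x; rewrite !inE. Qed.

Lemma simc_sum R k (Y : {set 'I_n}) t : simc (ans e) wi R k Y t =
  \sum_(i < k) (if walk R t i Y == set0 then 0 else wi (R (walk R t i Y))).
Proof.
elim: k Y => [|k IH] Y; first by rewrite big_ord0.
rewrite [LHS]/= big_ord_recl.
have -> : (if walk R t (@ord0 k) Y == set0 then 0 else wi (R (walk R t (@ord0 k) Y))) = (if Y == set0 then 0 else wi (R Y)) by [].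
case: eqP => [->|_]; first by rewrite big1 // => i _; rewrite walk0 eqxx.
by rewrite IH; congr (_ + _); apply: eq_bigr => i _; rewrite lift0 /walk iterSr.
Qed.

Lemma simbE (rho t : 'I_n) (Y : {set 'I_n}) : convex (ans e) Y ->
  simb N I W (labl N I W rho) rho (enc Y) t = simc (ans e) wi (rule (ans e) bet N.-1 label rho) N.-1 Y t.
Proof.
move=> cY; rewrite /simb subn1 sumV_sum ?leq_pred // simc_sum big_mkcond; apply: eq_bigr => i _.
have iN : i <= N by have := ltn_ord i; lia.
rewrite walkbE // enc_eq0; case: eqP => //= /eqP Z0.
by rewrite rulebE // ?WE //; apply: walk_convex.
Qed.

Lemma maxbE P F : maxb N n P F = minn N (\max_(t < n | P t) F t).
Proof.
rewrite -count_lt; apply: eq_big_nat => m _; congr nat_of_bool; rewrite hasV_ex //.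
apply/existsP/idP => [[t /andP[Pt h]]|].
  by apply: leq_trans h _; apply: (leq_bigmax_cond (F := fun t : 'I_n => F t)).
rewrite ltnNge => h; apply/existsP; apply: contraR h; rewrite negb_exists => /forallP h.
by apply/bigmax_leqP => t Pt; have := h t; rewrite Pt /= -leqNgt.
Qed.

Lemma minbE P F : minb N n P F = \big[minn/N.-1]_(t < n | P t) F t.
Proof.
have -> : \big[minn/N.-1]_(t < n | P t) F t = minn N (\big[minn/N.-1]_(t < n | P t) F t).
  by apply/esym/minn_idPr; apply: leq_trans (bigmin_leN _ _ _) _; rewrite leq_pred.
rewrite -count_lt; apply: eq_big_nat => m _; congr nat_of_bool; rewrite allV_all // subn1.
apply/andP/idP => [[h1 /forallP h2]|h].
  by apply: bigmin_ge => // t Pt; have := h2 t; rewrite Pt.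
split; first by apply: leq_trans h (bigmin_leN _ _ _).
apply/forallP => t; apply/implyP => Pt; apply: leq_trans h _.
exact: (bigmin_le N.-1 (fun t : 'I_n => F t) (P := fun t : 'I_n => P t)).
Qed.

(** Truncating values at [N] is harmless inside a minimum whose default is [N - 1]. *)
Lemma bigminC (Q : pred 'I_n) (F : 'I_n -> nat) :
  \big[minn/N.-1]_(t | Q t) minn N (F t) = \big[minn/N.-1]_(t | Q t) F t.
Proof.
apply/eqP; rewrite eqn_leq; apply/andP; split; apply: bigmin_ge; try exact: bigmin_leN.
  by move=> t Qt; apply: leq_trans (bigmin_le _ _ Qt) _; rewrite geq_min leqnn orbT.
move=> t Qt; rewrite leq_min (bigmin_le _ _ Qt) andbT.
by apply: leq_trans (bigmin_leN _ _ _) _; rewrite leq_pred.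
Qed.

Lemma bfbE d (x0 : 'I_n) (Y : {set 'I_n}) : Y \subset klass part x0 -> convex (ans e) Y -> Y != set0 ->
  bfb N I W d x0 (enc Y) = bf (ans e) bet wi N.-1 label (klass part x0) d Y.
Proof.
elim: d Y => [|d IH] Y YX cY Y0; rewrite [LHS]/= [RHS]/= I0 minbE.
  rewrite -[RHS]bigminC; apply: eq_big => [rho|rho _]; first by rewrite labE inE.
  rewrite maxbE.
  apply: (congr1 (minn N)); apply: eq_big => t; first by rewrite mem_enc.
  by move=> _; apply: simbE.
apply: eq_big => [q|q]; rewrite mem_enc // => qY.
rewrite WE maxbE; congr (_ + _).
have -> : \max_(t < n | mem N (enc Y) t && (val t != val q)) bfb N I W d x0 (cutb N I (enc Y) q t) =
    \max_(t in Y | t != q) bf (ans e) bet wi N.-1 label (klass part x0) d (cut (ans e) Y q t).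
  apply: eq_big => [t|t]; rewrite mem_enc // => /andP[tY ntq].
  rewrite cutbE IH //.
  - exact: subset_trans (cut_sub _ _ _ _) YX.
  - exact: (convex_cut aT).
  - by apply/set0Pn; exists t; apply: mem_cut.
apply/minn_idPr; apply/bigmax_leqP => t _; apply: leq_trans (bf_leN _ _ _ _ _ _ _ _) _; exact: leq_pred.
Qed.

Lemma activebE (Cd : {set 'I_n}) : convex (ans e) Cd -> Cd != set0 ->
  activeb N I (enc Cd) = enc (active (ans e) part r Cd).
Proof.
move=> cC C0; rewrite /activeb I0 rootE topbE //; apply: vecV_enc => u.
by rewrite mem_enc labE !inE.
Qed.

Hypothesis kC : forall x, convex (ans e) (klass part x).

Lemma scorebE d (Cd : {set 'I_n}) (q : 'I_n) : convex (ans e) Cd -> Cd != set0 -> q \in active (ans e) part r Cd ->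
  scoreb N I W d (topb N I (root N I) (enc Cd)) (activeb N I (enc Cd)) q = score (ans e) bet wi N.-1 label part r d Cd q.
Proof.
move=> cC C0 qA; rewrite rootE topbE // activebE // /scoreb /score /bfq WE I0 maxbE; congr (_ + _).
have cA : convex (ans e) (active (ans e) part r Cd) := active_convex kC cC.
set A := active _ _ _ _ in qA cA *.
have -> : \max_(t < n | mem N (enc A) t && (val t != val q)) bfb N I W d (topof (ans e) r Cd) (cutb N I (enc A) q t) =
    \max_(t in A | t != q) bf (ans e) bet wi N.-1 label (klass part (topof (ans e) r Cd)) d (cut (ans e) A q t).
  apply: eq_big => [t|t]; rewrite mem_enc // => /andP[tY ntq].
  rewrite cutbE bfbE //.
  - by apply: subset_trans (cut_sub _ _ _ _) _; apply: subsetIr.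
  - exact: (convex_cut aT).
  - by apply/set0Pn; exists t; apply: mem_cut.
apply/minn_idPr; apply/bigmax_leqP => t _; apply: leq_trans (bf_leN _ _ _ _ _ _ _ _) _; exact: leq_pred.
Qed.

Lemma polbP d (Cd : {set 'I_n}) : convex (ans e) Cd -> Cd != set0 ->
  exists q : 'I_n, [/\ polb N I W d (enc Cd) = q, q \in active (ans e) part r Cd &
    forall q', q' \in active (ans e) part r Cd ->
      score (ans e) bet wi N.-1 label part r d Cd q <= score (ans e) bet wi N.-1 label part r d Cd q'].
Proof.
move=> cC C0; have A0 : active (ans e) part r Cd != set0 := active_n0 part r aT cC C0.
case/set0Pn: A0 => y yA.
have [q qA hq] := arg_minnP (P := fun q => q \in active (ans e) part r Cd) (fun q => score (ans e) bet wi N.-1 label part r d Cd q) yA.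
pose Q (q : 'I_n) := (q \in active (ans e) part r Cd) &&
  [forall q' in active (ans e) part r Cd, score (ans e) bet wi N.-1 label part r d Cd q <= score (ans e) bet wi N.-1 label part r d Cd q'].
have ex : [exists q, Q q] by apply/existsP; exists q; rewrite /Q qA; apply/forall_inP.
have eq_ : polb N I W d (enc Cd) = odflt r [pick q | Q q].
  rewrite /polb I0; apply: firstV_pick => // x; rewrite /Q.
  rewrite {1}activebE // mem_enc; case: (boolP (x \in _)) => //= xA.
  rewrite allV_all //; apply: eq_forallb => q'; rewrite {1}activebE // mem_enc.
  by case: (boolP (q' \in _)) => //= q'A; rewrite !scorebE.
exists (odflt r [pick q | Q q]); split=> //; case: pickP => [x /andP[xA /forall_inP h]|no] //=;
  by case/existsP: ex => x; rewrite no.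
Qed.

Lemma nextbE (Cd : {set 'I_n}) (q t : 'I_n) : nextb N I (enc Cd) q (ans e q t) = enc (cut (ans e) Cd q t).
Proof.
rewrite /nextb I0; apply: vecV_enc => u; rewrite inE mem_enc answE; congr (_ && _); congr (_ && _).
have [->|nqt] := eqVneq q t; first by rewrite (ta_self aT) eqxx.
by rewrite eq_sym (ta_neq aT nqt).
Qed.

End Spec.

(** * The search program *)

Definition lte (a b : expr) := ESub (ENum 1) (ESub (EAdd a (ENum 1)) b).
Definition eqe (a b : expr) := ESub (ENum 1) (EAdd (ESub a b) (ESub b a)).
Definition incr x := CSet x (EAdd (EVar x) (ENum 1)).
Fixpoint seqc (c : cmd) (l : seq cmd) : cmd := if l is c' :: l' then CSeq c (seqc c' l') else c.

Lemma lteE N I a b r : eval N I (lte a b) r = (eval N I a r < eval N I b r).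
Proof. by rewrite /lte /=; case: ltnP => h /=; lia. Qed.
Lemma eqeE N I a b r : eval N I (eqe a b) r = (eval N I a r == eval N I b r).
Proof. by rewrite /eqe /=; case: eqP => h /=; lia. Qed.

Opaque lte eqe.

(* Registers: 0 candidates, 1 coded integer weights, 2 a vertex of maximum weight, 3 loop counter,
   4 second counter, 5 test result, 6 answer, 7 queried vertex, 8 result. *)
Section Program.
Variables epw efull epol enext : expr.
Let nE := EIn (ENum 0).
Let n15 := let n3 := EAdd nE (EAdd nE nE) in EAdd n3 (EAdd n3 (EAdd n3 (EAdd n3 n3))).

Definition max_body := CSeq
  (CIf (lte (EVar 3) nE) (seqc (CClr true) [:: CAddW true (EVar 3); CClr false; CAddW false (EVar 2);
     CTest 5 false true; CIf (EVar 5) (CSet 2 (EVar 3))])) (incr 3).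
Definition max_prog := seqc (CSet 2 (ENum 0)) [:: CSet 3 (ENum 0); CRep max_body].

Definition num_body := CSeq (CIf (lte (EVar 4) n15) (CAddW true (EVar 3))) (incr 4).
Definition cnt_body := seqc (CTest 5 true false) [:: CSet 4 (EAdd (EVar 4) (ESub (ENum 1) (EVar 5))); CAddW false (EVar 2)].
Definition wt_body := CSeq (CIf (lte (EVar 3) nE)
  (seqc (CClr true) [:: CSet 4 (ENum 0); CRep num_body; CClr false; CSet 4 (ENum 0); CRep cnt_body;
     CSet 1 (EAdd (EVar 1) epw)])) (incr 3).
Definition wt_prog := seqc (CSet 1 (ENum 0)) [:: CSet 3 (ENum 0); CRep wt_body].

Definition query_body := CIf (EVar 0) (seqc (CSet 7 epol) [:: CQuery 6 (EVar 7); CSet 0 enext;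
  CIf (eqe (EVar 7) (EVar 6)) (CSet 8 (EVar 7))]).
Definition query_prog := seqc (CSet 0 efull) [:: CRep query_body].

Definition search_prog := seqc max_prog [:: wt_prog; query_prog].

(** * Rounding the real weights on the machine *)

Section Weights.
Variables (R : realType) (orc : nat -> nat * R) (N : nat) (I : nat -> nat) (wt : nat -> R).
Variables (n : nat) (w : 'I_n -> R).
Hypotheses (I0 : I 0 = n) (n0 : 0 < n) (nN : 15 * n < N).
Hypothesis wtE : forall v : 'I_n, wt v = w v.
Hypothesis w0 : forall v, (0 < w v)%R.
Hypothesis epwE : forall r, eval N I epw r = pw N (r 3) (r 4).
Notation exec := (exec orc N I wt).
Implicit Types s : state R.

Lemma execE : ((forall x ex s, exec (CSet x ex) s = setv s x (eval N I ex (rho s))) *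
  (forall c1 c2 s, exec (CSeq c1 c2) s = exec c2 (exec c1 s)) *
  (forall c s, exec (CRep c) s = iter N (exec c) s) *
  (forall ex c s, exec (CIf ex c) s = if eval N I ex (rho s) == 0 then s else exec c s) *
  (forall b s, exec (CClr b) s = setr s b 0%R))%type.
Proof. by []. Qed.

Lemma max_ok s : exists m : 'I_n, [/\ rho (exec max_prog s) 2 = m, forall v, (w v <= w m)%R & qc (exec max_prog s) = qc s].
Proof.
rewrite /max_prog /=; set s0 := setv (setv s 2 0) 3 0.
have loop i : i <= N -> exists m : 'I_n, [/\ rho (iter i (exec max_body) s0) 2 = m, rho (iter i (exec max_body) s0) 3 = i,
    qc (iter i (exec max_body) s0) = qc s & forall v : 'I_n, v < i -> (w v <= w m)%R].
  elim: i => [|i IH] hi; first by exists (Ordinal n0); split.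
  have [m [h2 h3 hq hm]] := IH (ltnW hi); rewrite iterS; set s1 := iter i _ _ in h2 h3 hq *.
  rewrite /max_body /=.
  rewrite lteE /= h3 I0 /upd /=; case: (ltnP i n) => hin /=; last first.
    exists m; split; rewrite /= /upd /= ?h3 ?addn1 // => v vi; apply: hm; exact: leq_trans (ltn_ord v) hin.
  rewrite h2 h3 !add0r wtE (wtE (Ordinal hin)); case: (boolP (w m <= w (Ordinal hin))%R) => hw /=.
    exists (Ordinal hin); split; rewrite /= /upd /= ?h3 ?addn1 // => v; rewrite ltnS leq_eqVlt => /orP[/eqP ev|/hm h].
      by have -> : v = Ordinal hin by apply: val_inj.
    exact: le_trans h hw.
  exists m; split; rewrite /= /upd /= ?h3 ?addn1 // => v; rewrite ltnS leq_eqVlt => /orP[/eqP ev|/hm //].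
  have -> : v = Ordinal hin by apply: val_inj.
  by rewrite ltW // ltNge.
have [m [h2 _ hq hm]] := loop N (leqnn N); exists m; split=> // v; apply: hm.
by apply: leq_trans (ltn_ord v) _; lia.
Qed.

Lemma num_ok s (v : 'I_n) i (s' := iter i (exec num_body) s) : rho s 3 = v -> rho s 4 = 0 ->
  [/\ rho s' 4 = i, forall x, x != 4 -> rho s' x = rho s x, rg s' true = (rg s true + w v *+ minn i (15 * n))%R & qc s' = qc s].
Proof.
move=> h3 h4; rewrite {}/s'; elim: i => [|i]; first by rewrite min0n addr0.
rewrite iterS; move: (iter i _ s) => s1 [g4 gx gt gq]; rewrite /num_body /= lteE /= I0 g4 (gx 3 isT) h3 wtE.
have -> : n + (n + n) + (n + (n + n) + (n + (n + n) + (n + (n + n) + (n + (n + n))))) = 15 * n by lia.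
case: (ltnP i (15 * n)) => hi /=.
  split; rewrite ?addn1 //; first by rewrite /upd /= g4.
  - by move=> x nx; rewrite /upd (negbTE nx) gx.
  - by rewrite gt (minn_idPl (ltnW hi)) -addrA -mulrSr (minn_idPl hi).
split; rewrite ?addn1 //; first by rewrite /upd /= g4.
- by move=> x nx; rewrite /upd (negbTE nx) gx.
- by rewrite gt (minn_idPr hi) (minn_idPr (leqW hi)).
Qed.

Lemma cnt_ok s (m : 'I_n) i (s' := iter i (exec cnt_body) s) : rho s 2 = m ->
  [/\ rho s' 4 = rho s 4 + \sum_(0 <= j < i) ~~ (rg s true <= rg s false + w m *+ j)%R,
   forall x, x \notin [:: 4; 5] -> rho s' x = rho s x,
   rg s' true = rg s true, rg s' false = (rg s false + w m *+ i)%R & qc s' = qc s].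
Proof.
move=> h2; rewrite {}/s'; elim: i => [|i]; first by rewrite big_nil addn0 addr0.
rewrite iterS; move: (iter i _ s) => s1 [g4 gx gt gf gq]; rewrite /cnt_body /= /upd /= (gx 2 isT) h2 wtE gt gf.
split=> //.
- rewrite big_nat_recr //= addnA g4; case: (_ <= _)%R => //.
- by move=> x nx; rewrite -(gx x nx); move: nx; rewrite !inE negb_or => /andP[/negbTE -> /negbTE ->].
- by rewrite -addrA -mulrSr.
Qed.

(** The least integer not below [15 * n * w v / w m], found by counting failed comparisons, because
    no instruction turns a real into a natural number. *)
Definition roundw (m v : 'I_n) := \sum_(0 <= j < N) ~~ (w v *+ (15 * n) <= w m *+ j)%R.

Opaque num_body cnt_body.

Lemma wt_ok s (m : 'I_n) : rho s 2 = m -> [/\ qc (exec wt_prog s) = qc s &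
  rho (exec wt_prog s) 1 = vecI N (fun v => if insub v is Some u then roundw m u else 0)].
Proof.
move=> h2; rewrite /wt_prog /seqc !execE; set s0 := setv (setv s 1 _) 3 _.
set F := fun v => _.
have loop i : i <= N -> let s' := iter i (exec wt_body) s0 in
    [/\ rho s' 3 = i, rho s' 2 = m, rho s' 1 = \sum_(0 <= v < i) pw N v (F v) & qc s' = qc s].
  elim: i => [|i IH] hi; first by rewrite big_nil.
  have := IH (ltnW hi); rewrite iterS; move: (iter i _ s0) => s1 [g3 g2 g1 gq]; rewrite big_nat_recr //.
  rewrite /wt_body /seqc !execE lteE [eval _ _ (EVar 3) _]/= [eval _ _ nE _]/= g3 I0; case: (ltnP i n) => hin; last first.
    have -> : pw N i (F i) = 0.
      rewrite pwE ?(ltnW hi) // /F; case: insubP => [u hu eu|_] //; by rewrite ltnNge hin in hu.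
    by rewrite /= /upd /= g3 addn1 addn0.
  rewrite /=; set s2 := setv (setr s1 true _) 4 _.
  have [//|//|] := @num_ok s2 (Ordinal hin) N; move: (iter N _ s2) => s3 n4 nx nt nq.
  set s4 := setv (setr s3 false _) 4 _.
  have [|] := @cnt_ok s4 m N; first by rewrite /s4 /= /upd /= nx //= /upd /=.
  move: (iter N _ s4) => s5 c4 cx ct cf cq.
  have rx x : x \in [:: 1; 2; 3] -> rho s5 x = rho s1 x.
    move=> hx; rewrite cx; last by move: hx; rewrite !inE => /or3P[] /eqP ->.
    have n4x : x == 4 = false by move: hx; rewrite !inE => /or3P[] /eqP ->.
    by rewrite /s4 /= /upd n4x nx ?n4x // /s2 /= /upd n4x.
  have e4 : rho s5 4 = roundw m (Ordinal hin).
    rewrite c4 /s4 /= /upd /= add0n nt /s2 /= add0r (minn_idPr (ltnW nN)).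
    by apply: eq_bigr => j _; rewrite add0r.
  have eF : F i = roundw m (Ordinal hin) by rewrite /F insubT.
  rewrite epwE e4 /upd /= !rx // g1 g2 g3 eF addn1; split=> //.
  by rewrite cq /s4 /= nq /s2 /= gq.
have [_ h2' h1 hq] := loop N (leqnn N); by split.
Qed.

Section Rounding.
Variable m : 'I_n.
Hypothesis wm : forall v, (w v <= w m)%R.

Lemma roundwP v : [/\ (w v *+ (15 * n) <= w m *+ roundw m v)%R, roundw m v <= 15 * n, 0 < roundw m v,
  (w m *+ roundw m v <= w v *+ (15 * n) + w m)%R & forall k, (w v *+ (15 * n) <= w m *+ k)%R -> roundw m v <= k].
Proof.
have ex : exists k, (w v *+ (15 * n) <= w m *+ k)%R by exists (15 * n); rewrite lerMn2r wm orbT.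
have [k hk kmin] := ex_minnP ex.
have k15 : k <= 15 * n by apply: kmin; rewrite lerMn2r wm orbT.
have -> : roundw m v = k.
  rewrite /roundw -[RHS](minn_idPr (_ : k <= N)) ?(leq_trans k15 (ltnW nN)) // -count_lt.
  apply: eq_bigr => j _; congr nat_of_bool; rewrite ltnNge; congr negb; apply/idP/idP => [/kmin //|kj].
  by apply: le_trans hk _; rewrite ler_pMn2l.
have k0 : 0 < k.
  rewrite lt0n; apply/eqP => ek; move: hk; rewrite ek mulr0n leNgt => /negP; apply.
  by rewrite pmulrn_rgt0 ?w0 // muln_gt0 n0.
split=> //; have : ~~ (w v *+ (15 * n) <= w m *+ k.-1)%R by apply/negP => /kmin; lia.
by rewrite -ltNge -{2}(prednK k0) mulrSr => /ltW h; rewrite lerD2r.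
Qed.

Lemma roundw_mono u v : (w u <= w v)%R -> roundw m u <= roundw m v.
Proof.
move=> h; have [_ _ _ _ hu] := roundwP u; have [hv _ _ _ _] := roundwP v; apply: hu.
by apply: le_trans hv; rewrite lerMn2r h orbT.
Qed.
End Rounding.

End Weights.

(** * The query loop *)

Section Search.
Variables (R : realType) (n : nat) (e : rel 'I_n) (w : 'I_n -> R) (part : 'I_n -> 'I_n) (r t : 'I_n).
Variables (N : nat) (I : nat -> nat) (wt : nat -> R) (W : nat) (wi : 'I_n -> nat) (al W1 : R).
Hypothesis treeE : is_tree e.
Hypotheses (nN : n.+2 < N) (I0 : I 0 = n) (rootE : root N I = r).
Hypothesis adjE : forall i j : 'I_n, (0 < adj N I i j) = e i j.
Hypothesis labE : forall i j : 'I_n, same N I i j = (part i == part j).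
Hypothesis WE : forall v : 'I_n, wtI N W v = wi v.
Hypothesis kC : forall x, convex (ans e) (klass part x).
Hypothesis wr : forall v, (al * w v <= (wi v)%:R * W1)%R.
Hypothesis epolE : forall rh, eval N I epol rh = polb N I (rh 1) 96 (rh 0).
Hypothesis enextE : forall rh, eval N I enext rh = nextb N I (rh 0) (rh 7) (rh 6).
Notation exec := (exec (oracle e w t) N I wt).
Let aT := tree_answersT treeE.
Notation spent := (spent (ans e) (bet N W) wi N.-1 (label N I W) part r 96).

Definition bounds (B : nat) := B < N.-1 /\ forall x (Y : {set 'I_n}), Y \subset klass part x -> convex (ans e) Y ->
  Y != set0 -> bf (ans e) (bet N W) wi N.-1 (label N I W) (klass part x) 96 Y <= B.

(** [K] is the integer cost paid so far. The amortised bound is stated for all [B] at once: the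
    program knows no such bound, and in the end every decision tree supplies its own. *)
Lemma query_ok s i (s' := iter i (exec query_body) s) : rho s 0 = enc N [set: 'I_n] -> rho s 1 = W -> qc s = 0%R ->
  exists (Cd : {set 'I_n}) K, [/\ rho s' 0 = enc N Cd /\ rho s' 1 = W, convex (ans e) Cd /\ #|Cd| <= n - i,
    t \in Cd \/ (Cd = set0 /\ rho s' 8 = t), (al * qc s' <= K%:R * W1)%R &
    forall B, bounds B -> K + (if t \in Cd then spent B Cd t else 0) <= B * ncl (ans e) part r t].
Proof.
move=> h0 h1 hq; rewrite {}/s'; elim: i => [|i].
  exists [set: 'I_n], 0; split=> //.
  - by split; [exact: convexT | rewrite subn0 cardsT card_ord].
  - by left; rewrite inE.
  - by rewrite /= hq mulr0 mul0r.
  - move=> B [BN hB]; rewrite inE add0n; exact: (spent_init r aT kC hB).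
rewrite iterS; move: (iter i _ s) => s1 [Cd [K [[g0 g1] [cC hc] ht hK hB]]].
rewrite /query_body /= g0 (enc_eq0 nN I0 rootE); case: eqP => [C0|/eqP C0].
  exists Cd, K; split=> //; split=> //; by rewrite C0 cards0.
have {ht} tC : t \in Cd by case: ht => // -[h]; rewrite h eqxx in C0.
rewrite tC in hB.
have [q [eq qA hq']] := polbP treeE nN I0 rootE adjE labE WE kC 96 cC C0.
have qC : q \in Cd by move: qA; rewrite in_setI => /andP[].
have eo : oracle e w t (upd (rho s1) 7 q 7) = (val (ans e q t), w q) by rewrite updE /oracle valK.
rewrite !epolE g0 g1 eq !eo /= !enextE /upd /= g0 (nextbE treeE nN I0 rootE adjE) eqeE /=.
set Cd' := cut (ans e) Cd q t.
have cC' : convex (ans e) Cd' by apply: (convex_cut aT).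
have hc' : #|Cd'| <= n - i.+1.
  have : #|Cd'| < #|Cd|; last by lia.
  apply: proper_card; apply/properP; split; first exact: cut_sub.
  by exists q => //; apply: (notin_cut aT).
have hK' : (al * (qc s1 + w q) <= (K + wi q)%:R * W1)%R.
  by rewrite mulrDr natrD mulrDl lerD.
have gd B : bounds B -> wi q <= spent B Cd t /\ (q != t -> wi q + spent B Cd' t <= spent B Cd t).
  move=> [BN hBB]; apply: (spent_step aT kC hBB cC tC qA).
  by apply: (score_good aT kC _ BN hBB cC C0 qA hq'); rewrite card_ord; lia.
exists Cd', (K + wi q); have [eqt|nqt] := eqVneq q t.
  have C'0 : Cd' = set0 by apply/setP => x; rewrite !inE eqt eqxx andbF.
  have -> : val q == val (ans e q t) by rewrite eqt (ta_self aT).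
  split=> //=.
  - by right; split=> //; rewrite eqt.
  - move=> B hBB; rewrite C'0 inE addn0; apply: leq_trans (hB B hBB); rewrite leq_add2l.
    by case: (gd B hBB).
have -> : (val q == val (ans e q t)) = false.
  by apply/negbTE; apply: contra (ta_neq aT nqt) => /eqP /val_inj <-.
have tC' : t \in Cd' by apply: mem_cut => //; rewrite eq_sym.
split=> //=; first by left.
move=> B hBB; rewrite tC' -addnA; apply: leq_trans (hB B hBB); rewrite leq_add2l.
by have [_ ->] := gd B hBB.
Qed.

End Search.
End Program.

(** * Layout of the initial memory *)

Section Init.
Variables (R : realType) (n : nat) (e : rel 'I_n) (w : 'I_n -> R) (part : 'I_n -> 'I_n) (r : 'I_n).
Notation M := (NMem (init e w part r)).
Notation X := (XMem (init e w part r)).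
Let n0 : 0 < n := leq_ltn_trans (leq0n r) (ltn_ord r).

Lemma init_adj (i j : 'I_n) : M (2 + i * n + j) = e i j.
Proof.
rewrite /= -addnA ltn_add2l addKn.
have -> : i * n + j < n * n.
  apply: (@leq_trans (i.+1 * n)); first by rewrite mulSn addnC ltn_add2r.
  by rewrite leq_mul2r ltn_ord orbT.
by rewrite divnMDl // divn_small // addn0 modnMDl modn_small // !valK.
Qed.

Lemma init_lab (i : 'I_n) : M (2 + n * n + i) = part i.
Proof.
rewrite /= -[2 + n * n + i]addnA ltn_add2l ltnNge leq_addr /= addnA ltn_add2l ltn_ord.
by rewrite -addnA addKn addKn valK.
Qed.

Lemma init_X (i : 'I_n) : X i = w i.
Proof. by rewrite /= valK. Qed.

Lemma init_M2 : irreflexive e -> M 2 = 0.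
Proof.
move=> ei; have := init_adj (Ordinal n0) (Ordinal n0); by rewrite mul0n ei.
Qed.
End Init.

(** * Polynomial running time and the approximation factor *)

Local Open Scope ring_scope.

Theorem theorem3 (R : realType) (k : nat) : (0 < k)%N ->
  exists (p : seq instr) (c d : nat),
  forall (n : nat) (e : rel 'I_n) (w : 'I_n -> R) (part : 'I_n -> 'I_n) (r : 'I_n),
    is_tree e -> (forall v, 0 < w v) -> k_monotonic_wit e w part r k ->
    forall t : 'I_n,
      exists fin : config R,
        run (oracle e w t) p (c * n.+1 ^ d)%N (init e w part r) = Some fin /\
        NMem fin 0%N = val t /\
        (forall D : dtree n, valid_dtree e [set: 'I_n] D ->
           qcost fin <= (8 * k)%:R * dcost w D).
Proof.
Local Open Scope nat_scope.
move=> _.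
have [epw hpw] := Def_pw (Def_var 3) (Def_var 4).
have [efull hfull] : definable (fun N I r => vecV N (I 0) xpredT).
  by apply: Def_vecV; [apply: Def_in; apply: Def_num | apply: (Def_num 1)].
have [epol hpol] := Def_polb 96 (Def_var 1) (Def_var 0).
have [enext hnext] := Def_nextb (Def_var 0) (Def_var 7) (Def_var 6).
pose c := search_prog epw efull epol enext.
have [c0 [d0 hc]] := tc_poly c.
(* Variable 8 holds the result. As [N + 1] is at most [1025 * (n + 1) ^ 2], a bound of degree [d0]
   in [N] becomes one of degree [2 * d0] in [n]; the leading 700 covers the relocation of the
   input. *)
exists (prog c 8), (700 + c0 * 1025 ^ d0), (2 + 2 * d0) => n e w part r treeE w0 kM t.
have n0 : 0 < n := leq_ltn_trans (leq0n r) (ltn_ord r).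
have [e_irr e_sym _ _] := treeE.
set M := NMem (init e w part r); set X := XMem (init e w part r).
pose m := r + n * n; pose B := 2 * m + 21; pose N := 1024 * m.
have nn : n <= n * n by rewrite leq_pmulr.
have m1 : n * n <= m by rewrite leq_addl.
have m2 : m <= n * n + n by rewrite /m addnC leq_add2l ltnW.
have time : 35 + 4 * M 0 + 11 * B + tc N c <= (700 + c0 * 1025 ^ d0) * n.+1 ^ (2 + 2 * d0).
  have h1 : N.+1 <= 1025 * n.+1 ^ 2 by rewrite /N -mulnn; lia.
  rewrite mulnDl; apply: leq_add.
    apply: (@leq_trans (700 * n.+1 ^ 2)); last by rewrite leq_mul2l leq_pexp2l // leq_addr.
    by rewrite /B -mulnn /M /=; lia.
  apply: leq_trans (hc N) _; rewrite -mulnA leq_mul2l; apply/orP; right.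
  apply: (@leq_trans ((1025 * n.+1 ^ 2) ^ d0)).
    by elim: d0 {hc} => // d IH; rewrite expnS [leqRHS]expnS leq_mul.
  by rewrite expnMn -expnM leq_mul2l leq_pexp2l ?orbT // leq_addl.
have M0 : M 0 = n by [].
have M1 : M 1 = r by [].
have h0 : 0 < M 0 by rewrite M0.
have em : m = M 1 + M 0 * M 0 by rewrite M0 M1.
have [inp [wt [s0 [fin [[I0 I1 IM IX] [q0 hrun hres hcost]]]]]] :=
  prog_run (oracle e w t) (c := c) 8 X 0%R h0 (init_M2 w part r e_irr) em (erefl B) (erefl N) time.
rewrite M0 in I0.
have nB : n < B by rewrite /B; lia.
have nN : n.+2 < N by rewrite /N; lia.
have n15 : 15 * n < N by rewrite /N; lia.
have adj0 (i j : 'I_n) : j < i -> inp (2 + mul N i (inp 0) + j) = e i j.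
  move=> ji; rewrite I0 mulE; last by have := ltn_ord i; lia.
  have inn : i.+1 * n <= n * n by rewrite leq_mul2r ltn_ord orbT.
  have in1 : n <= i * n by rewrite leq_pmull //; lia.
  have hj := ltn_ord j; have hi := ltn_ord i; rewrite mulSn in inn.
  by rewrite IM; [exact: init_adj | rewrite /B; slia].
have adjE (i j : 'I_n) : (0 < adj N inp i j) = e i j.
  rewrite /adj; case: (ssrnat.ltngtP i j) => [ij|ji|ij]; last by rewrite (val_inj ij) e_irr.
  - by rewrite adj0 // e_sym lt0b.
  - by rewrite adj0 // lt0b.
have labE (i j : 'I_n) : same N inp i j = (part i == part j).
  (* For [n = 1] the only label sits in cell 3 and is lost, but it is compared only with itself. *)
  have [n1|n1] := leqP n 1.
    suff -> : i = j by rewrite /same !eqxx.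
    by apply: val_inj; have := ltn_ord i; have := ltn_ord j => /=; lia.
  have lE (a : 'I_n) : lab N inp a = part a.
    rewrite /lab I0 mulE; last by lia.
    by rewrite IM; [exact: init_lab | have := ltn_ord a; rewrite /B; slia].
  by rewrite /same !lE.
have rootE : root N inp = r.
  rewrite /root I0 mulE; last by lia.
  by rewrite I1 /m addnK.
have wtE (v : 'I_n) : wt v = w v by rewrite IX; [exact: init_X | exact: ltn_trans (ltn_ord v) nB].
set orc := oracle e w t in hrun hcost hres *.
have epwE rh : eval N inp epw rh = pw N (rh 3) (rh 4) by rewrite hpw.
have [mx [mx2 mxw mxq]] := max_ok orc I0 n0 n15 wtE s0.
set s1 := exec _ _ _ _ max_prog s0 in mx2 mxq.
have [wq wW] := wt_ok orc I0 n0 n15 wtE epwE mx2.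
set s2 := exec _ _ _ _ (wt_prog epw) s1 in wq wW.
pose wi := roundw N w mx.
have wP v := roundwP I0 n0 n15 w0 mxw v.
have wi_le v : wi v <= 15 * n by have [] := wP v.
have wi0 v : 0 < wi v < N.
  have [_ _ h _ _] := wP v; rewrite h /=; exact: leq_ltn_trans (wi_le v) n15.
set W := rho s2 1.
have WE (v : 'I_n) : wtI N W v = wi v.
  rewrite /wtI /W wW digE; first by rewrite valK.
    move=> j _; case: insubP => [u _ _|_]; last by lia.
    exact: leq_ltn_trans (wi_le u) n15.
  by apply: ltn_trans (ltn_ord v) _; lia.
have kC x := klass_convex treeE kM (x := x).
pose al : R := ((15 * n)%:R)%R.
have wr v : (al * w v <= (wi v)%:R * w mx)%R.
  by have [h _ _ _ _] := wP v; rewrite /al mulr_natl mulr_natl.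
set s3 := setv s2 0 (eval N inp efull (rho s2)).
have e3 : exec orc N inp wt c s0 = iter N (exec orc N inp wt (query_body epol enext)) s3 by [].
have [|//||Cd [K [_ [cC hCd] hCt hK hB]]] := query_ok (s := s3) t wt treeE nN I0 rootE adjE labE WE kC wr
    (fun rh => hpol N inp rh) (fun rh => hnext N inp rh) N.
- by rewrite /s3 /= hfull I0; apply: vecV_enc => u; rewrite inE.
- by rewrite /s3 /= wq mxq.
rewrite -/orc -e3 in hCt hK.
have C0 : Cd = set0 by apply: cards0_eq; lia.
exists fin; split=> //; split.
  by rewrite hres; case: hCt => [|[_ ->//]]; rewrite C0 inE.
move=> D vD; rewrite hcost.
pose B' := (15 * icost wi D)./2.
have NN : 240 * (n * n) + 180 * n < N.-1 by rewrite /N; lia.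
have hB' : bounds e part N inp W wi B'.
  split.
    have := icost_le vD wi_le; rewrite cardsT card_ord /B'; move: NN; rewrite mulnCA; slia.
  move=> x Y YX cY Y0; apply: (class_bf treeE kM (lv := lv N W)) => //.
  - by move=> u v; apply: (roundw_mono I0 n0 n15 w0 mxw).
  - exact: (bet_pow nN I0 rootE WE wi0).
  - by move=> v; exact: (bet_w nN I0 rootE WE wi0).
  - by move=> rh; exact: (label_greedy treeE nN I0 rootE adjE labE WE wi0).
have hK2 : K <= B' * k.
  have := hB B' hB'; rewrite C0 inE addn0 => h; apply: leq_trans h _.
  by rewrite leq_mul2l (ncl_le treeE kM) orbT.
have al0 : (0 < al)%R by rewrite ltr0n muln_gt0 n0.
have hI := icost_dcost (w := wi) (wr := w) (al := al) (W := w mx) vD (ltW al0) (ltW (w0 mx)).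
have {}hI : ((icost wi D)%:R * w mx <= al * dcost w D + n%:R * w mx)%R.
  rewrite -[n in (_ + n%:R * _)%R]card_ord -cardsT; apply: hI => v.
  by have [_ _ _ h _] := wP v; rewrite mulr_natl /al mulr_natl.
have hW : (w mx <= dcost w D)%R by apply: (dcost_ge _ vD); [move=> v; apply: ltW | rewrite inE].
have D0 := le_trans (ltW (w0 mx)) hW.
(* At scale [15 * n]: the cost is at most [15 * k / 2] times [icost] in units of [w mx], and
   rounding adds at most [n] units to [icost], each at most [dcost w D]. Now [15 / 2 * (15 * n + n)]
   is [8 * (15 * n)]. *)
rewrite -(ler_pM2l al0); apply: le_trans hK _.
have hKI : ((2 * K)%:R * w mx <= (15 * k)%:R * ((icost wi D)%:R * w mx))%R.
  rewrite mulrA -natrM; apply: ler_wpM2r; first exact: ltW.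
  rewrite ler_nat; have h2 : 2 * B' <= 15 * icost wi D by rewrite /B'; slia.
  by have := leq_mul h2 (leqnn k); move: hK2; nia.
have k0 : (0 <= (15 * k)%:R :> R)%R by [].
have hall := le_trans hKI (ler_wpM2l k0 hI).
have hn : (n%:R * w mx <= n%:R * dcost w D)%R by apply: ler_wpM2l.
have hk : (0 <= k%:R :> R)%R by [].
have hkn := ler_wpM2l hk hn.
move: hall; rewrite /al !natrM => hall; nra.
Qed.
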